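(* Let $(X,d,\mu)$ be a quasiconvex uniform metric measure space supporting a local weak $(1,1)$-Poincar\'e inequality, and let $\varrho$ be a control function. Then $(X,d,\mu)$ satisfies the Sobolev inequality $(S_{1,1}^\varrho)$ if and only if $0=[\Gamma]\in H_0^\varrho(\Gamma)$ for any quasi-lattice $\Gamma\subseteq X$.
   Context: A metric measure space $(X,d,\mu)$ is a metric space $(X,d)$ with a Borel regular outer measure $\mu$ such that $\mu(X)>0$ and $\mu(B(x,r))<\infty$ for all $x\in X$, $r>0$; $B(x,r)$ denotes the open ball. It is quasiconvex if there is $Q\ge 1$ such that any $x,y\in X$ are joined by a rectifiable path of length at most $Q\,d(x,y)$. It is uniform if there are non-decreasing functions $f,g\colon(0,\infty)\to(0,\infty)$ with $f(r)\le\mu(B(x,r))\le g(r)$ for all $x\in X$ and $0<r<\infty$. Upper gradients: a Borel function $g\colon X\to[0,\infty]$ is an upper gradient of $u$ if $|u(\gamma(a))-u(\gamma(b))|\le\int_\gamma g\,ds$ for every rectifiable path $\gamma\colon[a,b]\to X$, and a $1$-weak upper gradient if this holds for all rectifiable paths outside a family of $1$-modulus zero. $N^{1,1}(X,d,\mu)$ is the Newton-Sobolev space of (equivalence classes of) integrable functions $u\colon X\to[-\infty,\infty]$ having an integrable upper gradient, and $|\nabla u|$ is the minimal $1$-weak upper gradient of $u$. The space supports a local weak $(1,1)$-Poincar\'e inequality (up to scale $R_P$) if there are $C_P,R_P>0$ and $\tau\ge1$ such that for all balls $B(x,r)\subseteq X$ with $0<r\le R_P$ one has $0<\mu(B(x,\tau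 r))<\infty$ and $$\frac1{\mu(B(x,r))}\int_{B(x,r)}|u-u_{B(x,r)}|\,d\mu\le C_P\,r\,\frac1{\mu(B(x,\tau r))}\int_{B(x,\tau r)}g_u\,d\mu$$ for every $u\colon X\to\mathbb R$ with $u\in L^1(B(x,\tau r),d,\mu)$, where $g_u\colon X\to[0,\infty]$ is its minimal $1$-weak upper gradient and $u_A=\frac1{\mu(A)}\int_A u\,d\mu$. A control function is a non-decreasing $\varrho\colon[0,\infty)\to[0,\infty)$ with $\varrho(0)=1$ for which there are functions $L,M\colon(0,\infty)\to(0,\infty)$ with $\varrho(\varepsilon+t)\le L(\varepsilon)\varrho(t)$ and $\varrho(\varepsilon t)\le M(\varepsilon)\varrho(t)$ for all $t,\varepsilon>0$. $(X,d,\mu)$ satisfies $(S_{1,1}^\varrho)$ if there exist $C>0$ and $o\in X$ such that $\int_X|u|\,d\mu\le C\int_X|\nabla u|\,\varrho(d(o,\cdot))\,d\mu$ for every $u\in N^{1,1}(X,d,\mu)$ with bounded support. A quasi-lattice in $X$ is a set $\Gamma\subseteq X$ that is cobounded (there is $C>0$ with $\{x\in X: d(x,\Gamma)<C\}=X$) and uniformly locally finite (there is $N\colon(0,\infty)\to\mathbb N$ with $\#(\Gamma\cap B(x,r))\le N(r)$ for every ball $B(x,r)\subseteq X$). Controlled coarse homology: let $\Gamma$ be a quasi-lattice with basepoint $o\in\Gamma$. On $\Gamma^{q+1}$ use the max metric $d(\bar x,\bar y)=\max_i d(x_i,y_i)$ and $\bar o=(o,\dots,o)$. $C_q^\varrho(\Gamma)$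 is the real vector space of functions $c\colon\Gamma^{q+1}\to\mathbb R$ such that: (a) there is $K(c)\ge0$ with $|c(\bar x)|\le K(c)\varrho(d(\bar x,\bar o))$ for all $\bar x$; (b) $c$ is alternating, $c(x_{\sigma(0)},\dots,x_{\sigma(q)})=\mathrm{sign}(\sigma)c(x_0,\dots,x_q)$ for all permutations $\sigma$; (c) there is $P(c)\ge0$ with $c(x_0,\dots,x_q)=0$ whenever $\max_{i\ne j}d(x_i,x_j)>P(c)$. This does not depend on the basepoint. Writing $c=\sum c(x_0,\dots,x_q)[x_0,\dots,x_q]$, the boundary $\partial_q\colon C_q^\varrho(\Gamma)\to C_{q-1}^\varrho(\Gamma)$ is the linear extension of $\partial_q[x_0,\dots,x_q]=\sum_{i=0}^q(-1)^i[x_0,\dots,\hat x_i,\dots,x_q]$ for $q\ge1$, and $\partial_0=0$; $H_q^\varrho(\Gamma)=\ker\partial_q/\mathrm{im}\,\partial_{q+1}$. The fundamental class $[\Gamma]\in H_0^\varrho(\Gamma)$ is the class of $\chi_\Gamma=\sum_{x\in\Gamma}[x]\in C_0^\varrho(\Gamma)$ (the constant function $1$ on $\Gamma$). *)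

(* Defs.v *)
From HB Require Import structures.
From mathcomp Require Import all_boot all_order all_algebra all_fingroup.
From mathcomp Require Import all_classical all_reals all_analysis measurable_realfun.

Set Implicit Arguments.
Unset Strict Implicit.
Unset Printing Implicit Defensive.

Import Order.TTheory GRing.Theory Num.Theory.
Import numFieldNormedType.Exports.

Local Open Scope classical_set_scope.
Local Open Scope ring_scope.

(* [caratheodory_type] needs a pointed carrier. The metric measure spaces below
   have positive total measure, so they are nonempty, and no definition depends
   on the chosen point. *)
#[short(type="pmetricType")]
HB.structure Definition PointedMetric (K : numDomainType) :=
  {M of Pointed M & Metric K M}.

(* Borel sets and functions of a topological space *)

Definition borel_set (X : topologicalType) (A : set X) : Prop :=
  <<s [set U : set X | open U] >> A.

Definition borel_fun (R : realType) (X : ptopologicalType) (g : X -> \bar R) :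
    Prop :=
  measurable_fun [set: g_sigma_algebraType [set U : set X | open U]] g.

Definition bounded_subset (R : realType) (X : metricType R) (A : set X) : Prop :=
  exists (x : X) (r : R), A `<=` ball x r.

(* Metric measure spaces *)

Section measure.
Variables (R : realType) (X : pmetricType R).
Variable mu : {outer_measure set X -> \bar R}.
Local Open Scope ereal_scope.

Definition borel_regular : Prop :=
  (forall A : set X, borel_set A -> mu.-caratheodory A) /\
  (forall A : set X, exists B : set X,
     [/\ borel_set B, A `<=` B & mu B = mu A]).

Definition metric_measure_space : Prop :=
  [/\ borel_regular, 0 < mu setT &
      forall (x : X) (r : R), (0 < r)%R -> mu (ball x r) < +oo].

Definition uniform_measure : Prop :=
  exists f g : R -> R,
    [/\ (forall r, 0 < r -> 0 < f r /\ 0 < g r)%R,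
        (forall r s, 0 < r -> r <= s -> f r <= f s /\ g r <= g s)%R &
        forall (x : X) (r : R), (0 < r)%R ->
          (f r)%:E <= mu (ball x r) <= (g r)%:E].

(* [mu] as a (complete) measure on the sigma-algebra of its Caratheodory
   measurable sets; measurability, integrals and "almost everywhere" are taken
   with respect to it. *)
Definition cara_measure : {measure set (caratheodory_type mu) -> \bar R} :=
  (mu : set (caratheodory_type mu) -> \bar R).

Definition integral_on (A : set X) (f : X -> \bar R) : \bar R :=
  \int[cara_measure]_(x in (A : set (caratheodory_type mu))) f x.

Definition integrable_on (A : set X) (f : X -> \bar R) : Prop :=
  cara_measure.-integrable (A : set (caratheodory_type mu)) f.

Definition locally_integrable_fun (f : X -> \bar R) : Prop :=
  forall x : X, exists2 r : R, (0 < r)%R & integrable_on (ball x r) f.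

(* Mean values are only used on sets of positive finite measure. *)
Definition emean (A : set X) (f : X -> \bar R) : \bar R :=
  ((fine (mu A))^-1)%:E * integral_on A f.

Definition mean (A : set X) (u : X -> R) : R := fine (emean A (EFin \o u)).

End measure.

(* Rectifiable paths and path integrals *)

Section paths.
Variables (R : realType) (X : pmetricType R).

Definition polygon_length (c : R -> X) (a b : R) (s : seq R) : R :=
  let F := c \o nth b (a :: s) in
  \sum_(0 <= n < size s) mdist (F n) (F n.+1).

Definition curve_length (c : R -> X) (a b : R) : \bar R :=
  ereal_sup [set (polygon_length c a b s)%:E | s in itv_partition a b].

(* The values of [rpath_fun] outside [rpath_start, rpath_end] are irrelevant. *)
Record rpath := RPath {
  rpath_fun :> R -> X;
  rpath_start : R;
  rpath_end : R;
  rpath_le : rpath_start <= rpath_end;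
  rpath_continuous : {within `[rpath_start, rpath_end], continuous rpath_fun};
  rpath_rectifiable : (curve_length rpath_fun rpath_start rpath_end < +oo)%E }.

Implicit Type p : rpath.

Definition path_length p : \bar R := curve_length p (rpath_start p) (rpath_end p).

(* The parametrization by arc length: its value at [s] is [p t] for any time [t]
   at which the length run through is [s]. Any two such [t] give the same
   point, and one exists for each [s] between 0 and the length of [p]. *)
Definition arclength_param p (s : R) : X :=
  p (xget (rpath_start p)
       [set t | t \in `[rpath_start p, rpath_end p] /\
                curve_length p (rpath_start p) t = s%:E]).

Definition path_integral p (g : X -> \bar R) : \bar R :=
  (\int[lebesgue_measure]_(s in `[0%R, fine (path_length p)])
     g (arclength_param p s))%E.

Definition nonconstant p : Prop :=
  exists2 t, t \in `[rpath_start p, rpath_end p] & p t <> p (rpath_start p).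

Definition quasiconvex : Prop :=
  exists2 Q : R, 1 <= Q & forall x y : X, exists p,
    [/\ p (rpath_start p) = x, p (rpath_end p) = y &
        (path_length p <= (Q * mdist x y)%:E)%E].

End paths.

(* Upper gradients *)

Section upper_gradients.
Variables (R : realType) (X : pmetricType R).
Variable mu : {outer_measure set X -> \bar R}.
Local Open Scope ereal_scope.
Implicit Types (u g : X -> \bar R) (E : set (rpath X)).

Definition admissible E g : Prop :=
  [/\ borel_fun g, forall x, 0 <= g x &
      forall p, E p -> 1 <= path_integral p g].

Definition modulus1 E : \bar R :=
  ereal_inf [set integral_on mu setT g | g in admissible E].

(* In [\bar R] one has [`|+oo - +oo| = +oo], the usual convention for upper
   gradients. Constant paths have to be left out then: the inequality is trivial
   on them where [u] is finite, but would exclude every infinite value. *)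
Definition upper_gradient_along u g (p : rpath X) : Prop :=
  `|u (p (rpath_start p)) - u (p (rpath_end p))| <= path_integral p g.

Definition upper_gradient u g : Prop :=
  [/\ borel_fun g, forall x, 0 <= g x &
      forall p, nonconstant p -> upper_gradient_along u g p].

Definition weak_upper_gradient u g : Prop :=
  [/\ borel_fun g, forall x, 0 <= g x &
      exists2 E, modulus1 E = 0 &
        forall p, nonconstant p -> ~ E p -> upper_gradient_along u g p].

(* Minimality is among the locally integrable 1-weak upper gradients, as usual;
   it determines [g] up to almost everywhere equality. *)
Definition minimal_weak_upper_gradient u g : Prop :=
  [/\ weak_upper_gradient u g, locally_integrable_fun mu g &
      forall g', weak_upper_gradient u g' -> locally_integrable_fun mu g' ->
        {ae cara_measure mu, forall x, g x <= g' x}].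

Definition newton_sobolev u : Prop :=
  integrable_on mu setT u /\
  exists2 g, upper_gradient u g & integrable_on mu setT g.

Definition local_poincare : Prop :=
  exists CP RP tau : R,
    [/\ (0 < CP)%R, (0 < RP)%R, (1 <= tau)%R &
        forall (x : X) (r : R), (0 < r)%R -> (r <= RP)%R ->
          0 < mu (ball x (tau * r)%R) < +oo /\
          forall (u : X -> R) g,
            integrable_on mu (ball x (tau * r)%R) (EFin \o u) ->
            minimal_weak_upper_gradient (EFin \o u) g ->
            emean mu (ball x r)
              (fun y => (`|u y - mean mu (ball x r) u|%R)%:E)
            <= (CP * r)%:E * emean mu (ball x (tau * r)%R) g].

Definition sobolev11 (rho : R -> R) : Prop :=
  exists (C : R) (o : X), (0 < C)%R /\
    forall u g, newton_sobolev u ->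
      bounded_subset (closure [set x | u x != 0]) ->
      minimal_weak_upper_gradient u g ->
      integral_on mu setT (fun x => `|u x|)
      <= C%:E * integral_on mu setT (fun x => g x * (rho (mdist o x))%:E).

End upper_gradients.

(* A control function is only evaluated on nonnegative reals. *)
Definition control_function (R : realType) (rho : R -> R) : Prop :=
  [/\ forall t, 0 <= t -> 0 <= rho t,
      forall s t, 0 <= s -> s <= t -> rho s <= rho t,
      rho 0 = 1 &
      exists L M : R -> R, forall e, 0 < e ->
        [/\ 0 < L e, 0 < M e &
            forall t, 0 < t ->
              rho (e + t) <= L e * rho t /\ rho (e * t) <= M e * rho t]].

(* Quasi-lattices *)

Section quasi_lattices.
Variables (R : realType) (X : metricType R).

Definition cobounded (G : set X) : Prop :=
  exists2 C : R, 0 < C & forall x : X, exists2 y, G y & mdist x y < C.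

Definition uniformly_locally_finite (G : set X) : Prop :=
  exists N : R -> nat, forall (x : X) (r : R), 0 < r ->
    (G `&` ball x r #<= `I_(N r))%card.

Definition quasi_lattice (G : set X) : Prop :=
  cobounded G /\ uniformly_locally_finite G.

End quasi_lattices.

(* Controlled coarse homology of a subset [G] of a metric space *)

Section coarse_homology.
Variables (R : realType) (X : metricType R) (rho : R -> R).
Variables (G : set X) (o : G).

Definition simplex (q : nat) : Type := 'I_q.+1 -> G.

(* A function on [simplex q] is the formal, possibly infinite, sum of its
   values times simplices. *)
Definition formal_chain (q : nat) : Type := simplex q -> R.

Definition simplex_dist q (x y : simplex q) : R :=
  \big[Num.max/0]_(i < q.+1) mdist (\val (x i)) (\val (y i)).

Definition simplex_diam q (x : simplex q) : R :=
  \big[Num.max/0]_(ij : 'I_q.+1 * 'I_q.+1 | ij.1 != ij.2)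
    mdist (\val (x ij.1)) (\val (x ij.2)).

Definition is_chain q (c : formal_chain q) : Prop :=
  [/\ exists2 K : R, 0 <= K &
        forall x, `|c x| <= K * rho (simplex_dist x (fun=> o)),
      forall (s : 'S_q.+1) x, c (x \o s) = (-1) ^+ s * c x &
      exists2 P : R, 0 <= P & forall x, P < simplex_diam x -> c x = 0].

Definition face q (i : 'I_q.+2) (x : simplex q.+1) : simplex q :=
  fun j => x (lift i j).

(* [boundary] is the operator from degree [q.+1] to degree [q]: the coefficient
   of [y] collects those of all simplices having [y] as a face. For a chain on a
   uniformly locally finite set these sums are finite. *)
Definition boundary q (c : formal_chain q.+1) : formal_chain q :=
  fun y => \sum_(i < q.+2) (-1) ^+ i * \sum_(x \in [set x | face i x = y]) c x.

Definition is_cycle q : formal_chain q -> Prop :=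
  match q with
  | 0 => fun c => is_chain c
  | _.+1 => fun c => is_chain c /\ boundary c = fun=> 0
  end.

(* Elements of the quotient of cycles by boundaries are represented as cosets. *)
Definition homology_class q (z : formal_chain q) : set (formal_chain q) :=
  [set z' | is_cycle z' /\
    exists2 b : formal_chain q.+1, is_chain b &
      z' = fun x => z x + boundary b x].

Definition coarse_homology q : set (set (formal_chain q)) :=
  [set homology_class z | z in @is_cycle q].

Definition homology_zero q : set (formal_chain q) := homology_class (fun=> 0).

Definition fundamental_class : set (formal_chain 0) := homology_class (fun=> 1).

Lemma fundamental_class_in_homology :
  control_function rho -> coarse_homology fundamental_class.
Proof.
move=> [_ rho_mono rho0 _]; exists (fun=> 1) => //; split.
- exists 1 => // x; rewrite normr1 mul1r -[leLHS]rho0 rho_mono//.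
  by rewrite /simplex_dist; elim/big_ind: _ => // [a b a0 b0|i _];
    [rewrite le_max a0 | exact: mdist_ge0].
- by move=> s x; rewrite mulr1 (_ : s = 1%g) ?odd_perm1//;
    apply/permP => i; rewrite !ord1.
- exists 0 => // x; rewrite /simplex_diam (big_pred0 _ _ _ _) ?ltxx// => -[i j].
  by rewrite /= !ord1 eqxx.
Qed.

End coarse_homology.

Arguments coarse_homology {R X} rho {G} o q.
Arguments homology_zero {R X} rho {G} o q.

(* Main.v *)
Require Import Defs.
From mathcomp Require Import all_boot all_order all_algebra all_fingroup.
From mathcomp Require Import all_classical all_reals all_analysis measurable_realfun.
From mathcomp Require Import ring lra.

(* A 1-chain of controlled growth with boundary the constant 1 amounts to a flow
   on Gamma, controlled by rho, with net flux 1 at every point.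

   Sobolev => flow. The inequality is applied to tents, which are 1 near a
   finite set F in Gamma and 0 far from it and whose upper gradient lives near
   the boundary of F. This bounds #F by a weighted count of the edges leaving F.
   Slicing a function on Gamma into level sets gives a discrete Sobolev
   inequality, and the Hahn-Banach theorem turns it into the flow. Since the
   inequality speaks of minimal weak upper gradients, the tents must be shown to
   have one: the integrable weak upper gradients are closed under minima and
   decreasing limits, so one of least integral exists and is minimal.

   Flow => Sobolev. Summation by parts against the flow bounds the sum of the
   absolute means of u over balls centred at a net by the differences of the
   means of neighbouring balls, which chains of small balls along the paths given
   by quasiconvexity reduce to the local Poincare inequality. *)

Set Implicit Arguments.
Unset Strict Implicit.
Unset Printing Implicit Defensive.

Import Order.TTheory GRing.Theory Num.Theory.
Import numFieldNormedType.Exports.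

Local Open Scope classical_set_scope.
Local Open Scope ring_scope.

(** * Length of curves *)

(** Both directions rest on one duality. Pairing an antisymmetric edge function with the differences
    of phi on Gamma gives, by summation by parts, the sum of phi against its flux. The growth bound
    on controlled chains is dual to the l^1 norm of edge differences weighted by rho, so a bound of
    the sum of phi by that norm is just what Hahn-Banach asks for. Only edges of bounded length
    occur, hence rho varies along an edge by a bounded factor. Two scales are chosen. The tents use
    the cobounding constant C of the given quasi-lattice, and edges shorter than 5 C then suffice;
    conversely a single quasi-lattice of spacing RP / 2 is enough. The obstacle to minima of weak
    upper gradients g and h is that along a path the set where g <= h is merely measurable, so the
    inequalities on subintervals cannot be pasted together according to it. Approximating both in
    L^1 by continuous functions along the path removes this. It takes finite path integrals and the
    inequality on all subpaths, and both are available outside families of modulus zero. *)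

Section curve_length_theory.
Variables (R : realType) (X : pmetricType R).
Implicit Types (c : R -> X) (a b m : R) (s : seq R).

Lemma polygon_length_nil c a b : polygon_length c a b [::] = 0.
Proof. by rewrite /polygon_length big_geq. Qed.

Lemma polygon_length_cons c a b x s :
  polygon_length c a b (x :: s) = mdist (c a) (c x) + polygon_length c x b s.
Proof. by rewrite /polygon_length/= big_nat_recl. Qed.

Lemma polygon_length_cat c a m b s1 s2 : last a s1 = m ->
  polygon_length c a b (s1 ++ s2) =
  polygon_length c a m s1 + polygon_length c m b s2.
Proof.
elim: s1 a => [a /= ->|x s1 ih a /= lm]; first by rewrite polygon_length_nil add0r.
by rewrite !polygon_length_cons ih// addrA.
Qed.

(** Inserting m as a further vertex can only lengthen the polygon, by the triangle inequality. *)
Lemma polygon_length_split c a m b s : itv_partition a b s -> a <= m <= b ->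
  exists s1 s2, [/\ itv_partition a m s1, itv_partition m b s2 &
    polygon_length c a b s <= polygon_length c a m s1 + polygon_length c m b s2].
Proof.
elim: s a => [a /itv_partition_nil -> bmb|x s ih a abs /andP[am mb]].
  have -> : m = b by apply/eqP; rewrite eq_le andbC.
  exists [::], [::]; rewrite !polygon_length_nil addr0; split => //;
    by split => //=.
have [ax _] : a < x /\ true by case: abs => /= /andP[].
have [xm|mx] := leP x m.
  have [|s1 [s2 [p1 p2 le12]]] := ih _ (itv_partition_cons abs); first by rewrite xm.
  exists (x :: s1), s2; split => //; last by rewrite !polygon_length_cons -addrA lerD2l.
  by case: p1 => ? ?; split => //=; rewrite ax.
have p2 : itv_partition m b (x :: s).
  by case: abs => /= /andP[_ ? ?]; split => //=; rewrite mx.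
move: am; rewrite le_eqVlt => /orP[/eqP am|am].
  by exists [::], (x :: s); rewrite -am in p2 *; rewrite polygon_length_nil add0r; split.
exists [:: m], (x :: s); split => //; first exact: itv_partition1.
rewrite !polygon_length_cons polygon_length_nil addr0 addrA lerD2r.
exact: metric_triangle.
Qed.

Local Open Scope ereal_scope.

Lemma curve_length_ge_dist c a b : (a <= b)%R ->
  (mdist (c a) (c b))%:E <= curve_length c a b.
Proof.
rewrite le_eqVlt => /orP[/eqP ->|ab].
  rewrite mdistxx; apply: ereal_sup_ubound; exists [::]; first by split => /=.
  by rewrite polygon_length_nil.
apply: ereal_sup_ubound; exists [:: b]; first exact: itv_partition1.
by rewrite polygon_length_cons polygon_length_nil addr0.
Qed.

Lemma curve_length_ge0 c a b : (a <= b)%R -> 0 <= curve_length c a b.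
Proof.
move=> /(curve_length_ge_dist c); apply: le_trans; rewrite lee_fin.
exact: mdist_ge0.
Qed.

Lemma curve_lengthxx c a : curve_length c a a = 0.
Proof.
apply/eqP; rewrite eq_le curve_length_ge0// andbT.
by apply: ub_ereal_sup => _ [s /itv_partitionxx -> <-]; rewrite polygon_length_nil.
Qed.

Lemma curve_lengthD c a m b : (a <= m <= b)%R ->
  curve_length c a b = curve_length c a m + curve_length c m b.
Proof.
move=> /andP[am mb]; apply/eqP; rewrite eq_le; apply/andP; split.
  apply: ub_ereal_sup => _ [s abs <-].
  have [|s1 [s2 [p1 p2 le12]]] := polygon_length_split c abs (m := m).
    by rewrite am.
  apply: (@le_trans _ _ (polygon_length c a m s1 + polygon_length c m b s2)%:E).
    by rewrite lee_fin.
  by rewrite EFinD leeD//; apply: ereal_sup_ubound; [exists s1|exists s2].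
(* Once the total length is finite, the suprema over the two halves can be taken one after the
   other, each time subtracting a finite length. *)
have [->|aboo] := eqVneq (curve_length c a b) +oo; first exact: leey.
have abfin : curve_length c a b \is a fin_num.
  by rewrite ge0_fin_numE ?ltey// curve_length_ge0// (le_trans am).
have le12 s1 s2 : itv_partition a m s1 -> itv_partition m b s2 ->
    (polygon_length c a m s1)%:E + (polygon_length c m b s2)%:E <= curve_length c a b.
  move=> p1 p2; rewrite -EFinD -polygon_length_cat; last by case: p1 => _ /eqP.
  by apply: ereal_sup_ubound; exists (s1 ++ s2) => //; exact: itv_partition_cat p1 p2.
have le1 s1 : itv_partition a m s1 ->
    (polygon_length c a m s1)%:E + curve_length c m b <= curve_length c a b.
  move=> p1; rewrite addeC -leeBrDr//; apply: ge_ereal_sup => _ [s2 p2 <-].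
  by rewrite leeBrDr// addeC le12.
have mbfin : curve_length c m b \is a fin_num.
  rewrite ge0_fin_numE ?curve_length_ge0//.
  have [s1 p1] : exists s, itv_partition a m s.
    move: am; rewrite le_eqVlt => /orP[/eqP ->|am]; last by exists [:: m]; exact: itv_partition1.
    by exists [::]; split => /=.
  have := le1 _ p1; rewrite addeC -leeBrDr// => /le_lt_trans; apply.
  by rewrite -(fineK abfin) -EFinB ltry.
rewrite -leeBrDr//; apply: ge_ereal_sup => _ [s1 p1 <-].
by rewrite leeBrDr// le1.
Qed.

End curve_length_theory.

Section rectifiable_curve.
Variables (R : realType) (X : pmetricType R) (c : R -> X) (a b : R).
Hypothesis rect : (curve_length c a b < +oo)%E.
Implicit Types (x y z t : R).

Let len x y : R := fine (curve_length c x y).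

Lemma curve_length_fin_num x y : a <= x -> x <= y -> y <= b ->
  curve_length c x y \is a fin_num.
Proof.
move=> ax xy yb; rewrite ge0_fin_numE ?curve_length_ge0//.
apply: le_lt_trans rect; rewrite (@curve_lengthD _ _ _ a x b) ?ax ?(le_trans xy)//.
rewrite (@curve_lengthD _ _ _ x y b) ?xy//.
by rewrite addeCA leeDl// adde_ge0// curve_length_ge0.
Qed.

Let lenD x y z : a <= x -> x <= y -> y <= z -> z <= b ->
  len x z = len x y + len y z.
Proof.
move=> ax xy yz zb; rewrite /len (@curve_lengthD _ _ _ x y z) ?xy// fineD//;
by apply: curve_length_fin_num => //; first [exact: le_trans zb|exact: le_trans xy].
Qed.

Let len_ge_dist x y : a <= x -> x <= y -> y <= b -> mdist (c x) (c y) <= len x y.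
Proof.
move=> ax xy yb; rewrite -lee_fin fineK ?curve_length_ge_dist//.
exact: curve_length_fin_num.
Qed.

Let len_ge0 x y : x <= y -> 0 <= len x y.
Proof. by move=> xy; rewrite fine_ge0// curve_length_ge0. Qed.

Let flat e x y := len x y <= mdist (c x) (c y) + e.

(** The excess of length over distance does not grow on a subinterval, since the outer pieces are at
    least as long as the distance of their ends. *)
Let flat_sub e x x' y' y : a <= x -> x <= x' -> x' <= y' -> y' <= y -> y <= b ->
  flat e x y -> flat e x' y'.
Proof.
rewrite /flat => ax xx' xy' yy' yb.
have ax' := le_trans ax xx'; have y'b := le_trans yy' yb.
rewrite (@lenD x x' y)// ?(le_trans xy')// (@lenD x' y' y)//.
have := len_ge_dist ax xx' (le_trans xy' y'b).
have := len_ge_dist (le_trans ax' xy') yy' yb.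
have := metric_triangle (c x) (c x') (c y).
have := metric_triangle (c x') (c y') (c y).
by lra.
Qed.

(* A polygon whose length is within e of the length of the curve has only
   e-flat pieces. *)
Let flat_nbhs e s x t : a <= x -> itv_partition x b s -> x <= t <= b ->
  len x b <= polygon_length c x b s + e ->
  (t < b -> exists2 y, t < y <= b & flat e t y) /\
  (x < t -> exists2 y, x <= y < t & flat e y t).
Proof.
elim: s x => [x ax /itv_partition_nil xb|y s ih x ax xbs /andP[xt tb] le].
  by rewrite xb => bt; rewrite !ltNge; case/andP: bt => -> ->.
have xy : x < y by case: xbs => /= /andP[].
have ybs := itv_partition_cons xbs; have yb := itv_partition_le ybs.
have ay := le_trans ax (ltW xy).
have Pyb : polygon_length c y b s <= len y b.
  rewrite -lee_fin fineK ?curve_length_fin_num//.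
  by apply: ereal_sup_ubound; exists s.
have D := lenD ax (ltW xy) yb (lexx b).
have d := len_ge_dist ax (ltW xy) yb.
rewrite polygon_length_cons in le.
have [ty|yt] := leP t y.
  have fxy : flat e x y by rewrite /flat; lra.
  split=> [tltb|xltt].
    move: ty; rewrite le_eqVlt => /orP[/eqP ty|ty].
      by apply: (ih y _ _ _ _).1 => //; rewrite ?ty ?lexx//; lra.
    by exists y; [rewrite ty|apply: flat_sub fxy => //; exact: ltW].
  by exists x; [rewrite lexx|apply: flat_sub fxy => //].
have [||h1 h2] := ih _ ay ybs; [by rewrite tb ltW|lra|].
split=> // _; have [//|z /andP[yz zt] fz] := h2.
by exists z => //; rewrite zt andbT (le_trans (ltW xy)).
Qed.

Hypothesis ab : a <= b.
Hypothesis cont : {within `[a, b], continuous c}.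

Let dist_cvg t e : t \in `[a, b] -> 0 < e ->
  exists2 d, 0 < d & forall t', t' \in `[a, b] -> `|t' - t| < d -> mdist (c t) (c t') < e.
Proof.
move=> tab e0; move/subspace_continuousP : cont => /(_ t tab).
move=> /metricType_numDomainType.cvgrPdist_lt /(_ e e0).
rewrite near_withinE => -[d /= d0 hd]; exists d => // t' t'ab t't.
by apply: hd => //=; rewrite distrC.
Qed.

Let T t := len a t.

Let dist_T x y : x \in `[a, b] -> y \in `[a, b] -> x <= y -> T y - T x = len x y.
Proof.
rewrite !in_itv/= => /andP[ax xb] /andP[ay yb] xy.
by rewrite /T (@lenD a x y)// addrC addKr.
Qed.

(** A polygon of almost full length provides an e/2-flat piece on each side of t. On it the length
    exceeds the distance of the endpoints by at most e/2, and that distance is small because c is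
    continuous. *)
Let T_continuous : {within `[a, b], continuous T}.
Proof.
apply/subspace_continuousP => t tab; apply/cvgrPdist_lt => e e0.
have [s abs les] : exists2 s, itv_partition a b s &
    len a b <= polygon_length c a b s + e / 2.
  have := curve_length_fin_num (lexx a) ab (lexx b).
  move=> /(ub_ereal_sup_adherent (divr_gt0 e0 (ltr0Sn _ 1)))[_ [s abs <-] lts]; exists s => //.
  rewrite -lerBlDr -lee_fin EFinB fineK; first exact: ltW.
  exact: curve_length_fin_num.
have /andP[at_ tb] : a <= t <= b by move: tab; rewrite /= in_itv.
have [fr fl] := flat_nbhs (lexx a) abs (introT andP (conj at_ tb)) les.
have [d1 d10 hd1] := dist_cvg tab (divr_gt0 e0 (ltr0Sn _ 1)).
have [dr dr0 hr] : exists2 d, 0 < d & forall t', t <= t' -> t' <= b -> t' - t < d ->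
    len t t' <= mdist (c t) (c t') + e / 2.
  move: tb; rewrite le_eqVlt => /orP[/eqP tb|tb].
    exists 1 => // t' tt' t'b _.
    have -> : t' = t by apply/eqP; rewrite eq_le tt' -tb in t'b *; rewrite t'b.
    by rewrite /len curve_lengthxx mdistxx add0r divr_ge0// ltW.
  have [y /andP[ty yb] fy] := fr tb; exists (y - t); first by rewrite subr_gt0.
  move=> t' tt' t'b; rewrite ltrD2r => t'y.
  by apply: flat_sub fy => //; exact: ltW.
have [dl dl0 hl] : exists2 d, 0 < d & forall t', a <= t' -> t' <= t -> t - t' < d ->
    len t' t <= mdist (c t') (c t) + e / 2.
  move: at_; rewrite le_eqVlt => /orP[/eqP at_|at_].
    exists 1 => // t' tt' t'b _.
    have -> : t' = t by apply/eqP; rewrite eq_le -{2}at_ tt' t'b.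
    by rewrite /len curve_lengthxx mdistxx add0r divr_ge0// ltW.
  have [y /andP[ay yt] fy] := fl at_; exists (t - y); first by rewrite subr_gt0.
  move=> t' at' t't; rewrite ltrD2l ltrN2 => yt'.
  by apply: flat_sub fy => //; exact: ltW.
rewrite near_withinE; near=> t' => t'ab.
have t'd : `|t' - t| < Num.min d1 (Num.min dr dl).
  by rewrite distrC; near: t'; apply: (@cvgr_dist_lt _ R^o); rewrite ?lt_min ?d10 ?dr0.
move: t'd; rewrite !lt_min => /and3P[/(hd1 _ t'ab) dtt' t'dr t'dl].
have /andP[at' t'b] : a <= t' <= b by move: t'ab; rewrite /= in_itv.
have [tt'|t't] := leP t t'.
  rewrite distrC dist_T// ger0_norm ?len_ge0//.
  have := hr t' tt' t'b; rewrite ger0_norm ?subr_ge0// in t'dr => /(_ t'dr).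
  by move/le_lt_trans; apply; lra.
rewrite dist_T// ?(ltW t't)// ger0_norm ?len_ge0 ?(ltW t't)//.
have := hl t' at' (ltW t't); rewrite distrC ger0_norm ?subr_ge0 ?(ltW t't)// in t'dl => /(_ t'dl).
by move/le_lt_trans; apply; rewrite metric_sym; lra.
Unshelve. all: by end_near.
Qed.

Lemma curve_length_surj (s : R) : 0 <= s -> (s%:E <= curve_length c a b)%E ->
  exists2 t, t \in `[a, b] & curve_length c a t = s%:E.
Proof.
move=> s0 sL; have [|t tab Tt] := @IVT _ T a b s ab T_continuous.
  have Tab : T a <= T b by rewrite /T {1}/len curve_lengthxx len_ge0.
  rewrite (min_idPl Tab) (max_idPr Tab) {1}/T /len curve_lengthxx s0/=.
  by rewrite -lee_fin fineK// curve_length_fin_num.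
exists t => //; rewrite -Tt fineK//.
by move: tab; rewrite in_itv/= => /andP[? ?]; exact: curve_length_fin_num.
Qed.

End rectifiable_curve.

(** * Parametrization by arc length *)

Section arclength.
Variables (R : realType) (X : pmetricType R).
Implicit Types (p : rpath X) (s t : R).

Definition plen p : R := fine (path_length p).

Lemma path_length_plen p : path_length p = (plen p)%:E.
Proof.
by rewrite fineK// (curve_length_fin_num (rpath_rectifiable p))// rpath_le.
Qed.

Lemma plen_ge0 p : 0 <= plen p.
Proof. by rewrite fine_ge0// curve_length_ge0// rpath_le. Qed.

(** Between two times with the same length run through, the curve has length 0 and hence equal
    endpoints, so the time picked by [xget] does not matter. *)
Lemma arclength_paramE p s t : t \in `[rpath_start p, rpath_end p] ->
  curve_length p (rpath_start p) t = s%:E -> arclength_param p s = p t.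
Proof.
move=> tab ts; rewrite /arclength_param; case: xgetP => [t' _ [t'ab t's]|]; last first.
  by move/(_ t) => /= H; exfalso; apply: H.
wlog tt' : t t' tab t'ab ts t's / t <= t'.
  by move=> W; have [/W|/ltW/W] := leP t t'; [exact|move=> W'; rewrite W'].
apply/esym/mdist_positivity/eqP; rewrite eq_le mdist_ge0 andbT.
have /andP[at_ tb] : rpath_start p <= t <= rpath_end p by move: tab; rewrite in_itv.
have /andP[at'_ t'b] : rpath_start p <= t' <= rpath_end p by move: t'ab; rewrite in_itv.
have := curve_length_ge_dist p tt'.
have := @curve_lengthD _ _ p (rpath_start p) t t'; rewrite at_ tt' => /(_ isT).
have fin : curve_length p t t' \is a fin_num.
  by apply: (@curve_length_fin_num _ _ p (rpath_start p) (rpath_end p)) => //; exact: rpath_rectifiable.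
rewrite ts t's -(fineK fin) => -[] e; rewrite lee_fin.
by move/le_trans; apply; lra.
Qed.

Lemma arclength_time p s : s \in `[0, plen p] ->
  exists t, [/\ t \in `[rpath_start p, rpath_end p],
    curve_length p (rpath_start p) t = s%:E & arclength_param p s = p t].
Proof.
rewrite in_itv/= => /andP[s0 sL].
have [|t tab ts] := @curve_length_surj _ _ p _ _ (rpath_rectifiable p) (rpath_le p)
   (@rpath_continuous _ _ p) s s0.
  by rewrite -/(path_length p) path_length_plen lee_fin.
by exists t; split => //; exact: arclength_paramE.
Qed.

(** The path p' is p itself on a smaller time interval; continuity and rectifiability are inherited,
    and additivity of length makes its parameter a shift of that of p. *)
Lemma arclength_param_sub p s1 s2 : 0 <= s1 -> s1 <= s2 -> s2 <= plen p ->
  exists p', [/\ p' (rpath_start p') = arclength_param p s1,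
    p' (rpath_end p') = arclength_param p s2, plen p' = s2 - s1 &
    forall s, s \in `[0, s2 - s1] -> arclength_param p' s = arclength_param p (s1 + s)].
Proof.
move=> s10 s12 s2L.
have [t1 [t2 [t1ab t2ab t12 t1s t2s]]] : exists t1 t2,
    [/\ t1 \in `[rpath_start p, rpath_end p], t2 \in `[rpath_start p, rpath_end p],
      t1 <= t2, curve_length p (rpath_start p) t1 = s1%:E &
      curve_length p (rpath_start p) t2 = s2%:E].
  have [|t1 [t1ab t1s _]] := @arclength_time p s1.
    by rewrite in_itv/= s10 (le_trans s12).
  have [|t2 [t2ab t2s _]] := @arclength_time p s2.
    by rewrite in_itv/= s2L (le_trans s10).
  (* The times can come in the wrong order only if s1 = s2, and then t1 serves for both. *)
  have [t12|/ltW t21] := leP t1 t2; first by exists t1, t2.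
  exists t1, t1; split => //; rewrite t1s; congr EFin; apply/eqP; rewrite eq_le s12/=.
  rewrite -lee_fin -t2s -t1s (@curve_lengthD _ _ p _ t2 t1) ?leeDl ?curve_length_ge0//.
  by rewrite t21 andbT; move: t2ab; rewrite in_itv/= => /andP[].
have /andP[at1 t1b] : rpath_start p <= t1 <= rpath_end p by move: t1ab; rewrite in_itv.
have /andP[at2 t2b] : rpath_start p <= t2 <= rpath_end p by move: t2ab; rewrite in_itv.
have add t : t1 <= t -> t <= rpath_end p ->
    curve_length p (rpath_start p) t = (s1%:E + curve_length p t1 t)%E.
  by move=> t1t tb; rewrite (@curve_lengthD _ _ p _ t1 t) ?t1s// at1.
have fin := curve_length_fin_num (rpath_rectifiable p).
have L12 : curve_length p t1 t2 = (s2 - s1)%:E.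
  move: (add _ t12 t2b); rewrite t2s -(fineK (fin _ _ at1 t12 t2b)) => -[->].
  by congr EFin; lra.
have ct : {within `[t1, t2], continuous p}.
  apply: continuous_subspaceW (@rpath_continuous _ _ p).
  by move=> t /=; rewrite !in_itv/= => /andP[t1t tt2]; rewrite (le_trans at1)//= (le_trans tt2).
have rt : (curve_length p t1 t2 < +oo)%E by rewrite L12 ltry.
pose p' := RPath t12 ct rt.
have arc' t s : t \in `[t1, t2] -> curve_length p t1 t = s%:E ->
    arclength_param p' s = p t.
  by move=> tt ts; apply: (@arclength_paramE p').
have L' : plen p' = s2 - s1 by rewrite /plen /path_length/= L12.
exists p'; split => //.
- exact/esym/(@arclength_paramE p).
- exact/esym/(@arclength_paramE p).
move=> s; rewrite -L' => /arclength_time[t [tt ts ->]] /=.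
have /andP[t1t tt2] : t1 <= t <= t2 by move: tt; rewrite in_itv.
have tb : t <= rpath_end p by exact: le_trans t2b.
apply/esym/(@arclength_paramE p); first by rewrite in_itv/= (le_trans at1).
by rewrite add// ts.
Qed.

Lemma arclength_param0 p : arclength_param p 0 = p (rpath_start p).
Proof.
by apply: arclength_paramE; rewrite ?curve_lengthxx// in_itv/= lexx rpath_le.
Qed.

Lemma arclength_param_plen p : arclength_param p (plen p) = p (rpath_end p).
Proof.
apply: arclength_paramE; first by rewrite in_itv/= lexx rpath_le.
exact: path_length_plen.
Qed.

Lemma arclength_param_lip p s s' : s \in `[0, plen p] -> s' \in `[0, plen p] ->
  mdist (arclength_param p s) (arclength_param p s') <= `|s - s'|.
Proof.
wlog ss' : s s' / s <= s'.
  move=> W sL s'L; have [/W|/ltW/W] := leP s s'; first exact.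
  by rewrite metric_sym distrC; exact.
rewrite !in_itv/= => /andP[s0 sL] /andP[s'0 s'L].
have [p' [<- <- Lp' _]] := arclength_param_sub s0 ss' s'L.
rewrite distrC ger0_norm ?subr_ge0// -Lp' -lee_fin -path_length_plen.
exact/curve_length_ge_dist/rpath_le.
Qed.

(** Extended by constants to the whole line, the parametrization is continuous everywhere, so that
    compositions with Borel functions are measurable on all of R. *)
Definition pclamp p s := arclength_param p (Num.max 0 (Num.min s (plen p))).

End arclength.

(** * Path integrals and modulus *)

Section path_integral_theory.
Variables (R : realType) (X : pmetricType R).
Implicit Types (p : rpath X) (s t : R) (g : X -> \bar R).

Lemma pclampE p s : s \in `[0, plen p] -> pclamp p s = arclength_param p s.
Proof.
rewrite in_itv/= => /andP[s0 sL].
by rewrite /pclamp (min_idPl sL) (max_idPr s0).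
Qed.

Lemma clamp_itv (l s : R) : 0 <= l -> Num.max 0 (Num.min s l) \in `[0, l].
Proof. by move=> l0; rewrite in_itv/= le_max lexx ge_max l0 ge_min lexx orbT. Qed.

Lemma pclamp_lip p s t : mdist (pclamp p s) (pclamp p t) <= `|s - t|.
Proof.
have L0 := plen_ge0 p.
apply: le_trans (arclength_param_lip (clamp_itv s L0) (clamp_itv t L0)) _.
wlog st : s t / s <= t.
  move=> W; have [/W//|/ltW/W] := leP s t.
  by rewrite distrC (distrC s).
rewrite distrC (distrC s) !ger0_norm ?subr_ge0//; last first.
  rewrite /Num.max /Num.min.
  by do ! case: ifPn => //; rewrite ?ltNge ?negbK; lra.
rewrite /Num.max /Num.min.
by do ! case: ifPn => //; rewrite ?ltNge ?negbK; lra.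
Qed.

Lemma pclamp_continuous p : continuous (pclamp p).
Proof.
move=> t; apply/metricType_numDomainType.cvgrPdist_lt => e e0.
near=> s; apply: le_lt_trans (pclamp_lip _ _ _) _.
by near: s; apply: (@cvgr_dist_lt _ R^o).
Unshelve. all: by end_near. Qed.

Lemma borel_fun_comp_measurable (c : R -> X) g : continuous c -> borel_fun g ->
  measurable_fun [set: measurableTypeR R] (g \o c).
Proof.
move=> cc bg.
have mc : measurable_fun [set: measurableTypeR R]
    (c : _ -> g_sigma_algebraType [set U : set X | open U]).
  apply: (@measurability _ _ (measurableTypeR R) (g_sigma_algebraType [set U : set X | open U]) setT c [set U : set X | open U]) => //.
  move=> _ [U oU <-]; rewrite setTI; apply: open_measurable.
  by move/continuousP : cc; exact.
exact: (measurableT_comp bg mc).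
Qed.

Local Open Scope ereal_scope.

Lemma path_integralE p g : path_integral p g =
  \int[lebesgue_measure]_(s in `[0%R, plen p]) g (pclamp p s).
Proof. by apply: eq_integral => s; rewrite inE/= => /pclampE ->. Qed.

Lemma pclamp_measurable p g (D : set R) : borel_fun g ->
  measurable_fun (D : set (measurableTypeR R)) (g \o pclamp p).
Proof.
move=> bg; apply: measurable_funTS; apply: borel_fun_comp_measurable => //.
exact: pclamp_continuous.
Qed.

Lemma path_integral_ge0 p g : (forall x, 0 <= g x) -> 0 <= path_integral p g.
Proof. by move=> g0; apply: integral_ge0. Qed.

Lemma path_integral_le p g h : borel_fun g -> borel_fun h ->
  (forall x, 0 <= g x) -> (forall x, g x <= h x) ->
  path_integral p g <= path_integral p h.
Proof.
move=> bg bh g0 gh; rewrite !path_integralE; apply: ge0_le_integral => //.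
- exact: pclamp_measurable.

- exact: pclamp_measurable.
Qed.

Lemma path_integralZ p g (k : R) : borel_fun g -> (forall x, 0 <= g x) ->
  (0 <= k)%R -> path_integral p (fun x => k%:E * g x) = k%:E * path_integral p g.
Proof.
move=> bg g0 k0; rewrite !path_integralE; apply: ge0_integralZl_EFin => //.
exact: pclamp_measurable.
Qed.

Lemma lebesgue_measure_translation (A : set R) (k : R) : measurable A ->
  pushforward lebesgue_measure ((fun x => x + k)%R : _ -> measurableTypeR R) A =
  lebesgue_measure A.
Proof.
move=> mA; apply/esym/lebesgue_measure_unique => //=.
  exact: measurable_funD.
move=> _ _ [[a b]] _ <-.
rewrite /pushforward.
rewrite [X in _ = lebesgue_measure X](_ : _ = `](a - k)%R, (b - k)%R]%classic); last first.
  by apply/seteqP; split => x /=; rewrite !in_itv/= ?ltrBlDr ?lerBrDr.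
rewrite !lebesgue_measure_itv/= !lte_fin ltrD2r.
by case: ifP => // _; congr EFin; lra.
Qed.

Lemma ge0_integral_translation (f : R -> \bar R) (s t k : R) :
  measurable_fun [set: measurableTypeR R] f -> (forall x, 0 <= f x) ->
  \int[lebesgue_measure]_(x in `[s, t]) f (x + k)%R =
  \int[lebesgue_measure]_(x in `[(s + k)%R, (t + k)%R]) f x.
Proof.
move=> mf f0; rewrite (_ : `[s, t]%classic =
   ((fun x => x + k)%R : _ -> measurableTypeR R) @^-1` `[(s + k)%R, (t + k)%R]%classic); last first.
  by apply/seteqP; split => x /=; rewrite !in_itv/= !lerD2r.
have mk : measurable_fun setT ((fun x => x + k)%R : measurableTypeR R -> measurableTypeR R).
  exact: measurable_funD.
have -> := esym (ge0_integral_pushforward mk lebesgue_measure (measurable_itv _) _ _ ); last 2 first.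
- exact: measurable_funS mf.
- by [].
apply: eq_measure_integral => A mA AS; exact: lebesgue_measure_translation.
Qed.

(** Integrals over subpaths become integrals over subintervals of one fixed parametrization; this
    reduces statements about weak upper gradients to functions of a real variable. *)
Lemma subpath_integral p (s1 s2 : R) : (0 <= s1)%R -> (s1 <= s2)%R -> (s2 <= plen p)%R ->
  exists p', [/\ p' (rpath_start p') = arclength_param p s1,
    p' (rpath_end p') = arclength_param p s2 &
    forall g, borel_fun g -> (forall x, 0 <= g x) -> path_integral p' g =
      \int[lebesgue_measure]_(s in `[s1, s2]) g (pclamp p s)].
Proof.
move=> s10 s12 s2L; have [p' [p'1 p'2 L' arc']] := arclength_param_sub s10 s12 s2L.
exists p'; split => // g bg g0.
transitivity (\int[lebesgue_measure]_(s in `[0%R, (s2 - s1)%R]) g (pclamp p (s + s1)%R)).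
  rewrite /path_integral -/(plen p') L'; apply: eq_integral => s.
  rewrite inE/= => sL; rewrite arc'// addrC pclampE//.
  by move: sL; rewrite !in_itv/= => /andP[? ?]; apply/andP; split; lra.
have mg := @pclamp_measurable p g setT bg.
rewrite (@ge0_integral_translation (g \o pclamp p) 0%R (s2 - s1)%R s1 mg (fun=> g0 _)).
by rewrite add0r subrK.
Qed.

End path_integral_theory.

(** * Families of paths of modulus zero *)

Section modulus.
Variables (R : realType) (X : pmetricType R).
Variable mu : {outer_measure set X -> \bar R}.
Hypothesis mms : metric_measure_space mu.
Local Open Scope ereal_scope.
Implicit Types (g h : X -> \bar R) (E : set (rpath X)).

Lemma borel_set_measurable (A : set X) : borel_set A ->
  measurable (A : set (caratheodory_type mu)).
Proof. by case: mms => -[bs _] _ _ => /bs. Qed.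

Lemma borel_fun_measurable g : borel_fun g ->
  measurable_fun (setT : set (caratheodory_type mu)) g.
Proof.
move=> bg _ B mB; apply: borel_set_measurable.
exact: (bg measurableT B mB).
Qed.

Lemma open_borel (A : set X) : open A -> borel_set A.
Proof. exact: sub_sigma_algebra. Qed.

Lemma open_measurable_cara (A : set X) : open A ->
  measurable (A : set (caratheodory_type mu)).
Proof. by move=> /open_borel; exact: borel_set_measurable. Qed.

Lemma modulus1_ge0 E : 0 <= modulus1 mu E.
Proof.
apply: le_ereal_inf_tmp => _ [g [_ g0 _] <-]; exact: integral_ge0.
Qed.

Lemma modulus1_eq0P E : modulus1 mu E = 0 <->
  forall e : R, (0 < e)%R -> exists2 g, admissible E g & integral_on mu setT g <= e%:E.
Proof.
split=> [m0 e e0|H].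
  have fin : modulus1 mu E \is a fin_num by rewrite m0.
  have [_ [g ag <-]] := lb_ereal_inf_adherent e0 fin.
  rewrite -/(modulus1 mu E) m0 add0e => /ltW ge.
  by exists g.
apply/eqP; rewrite eq_le modulus1_ge0 andbT; apply/lee_addgt0Pr => e e0.
have [g ag ge] := H e e0; rewrite add0e; apply: le_trans ge.
by apply: ereal_inf_lbound; exists g.
Qed.

Lemma modulus1_sub E E' : E `<=` E' -> modulus1 mu E' = 0 -> modulus1 mu E = 0.
Proof.
move=> EE' /modulus1_eq0P H; apply/modulus1_eq0P => e /H[g [bg g0 ag] ge].
by exists g => //; split => // p /EE'; exact: ag.
Qed.

Lemma borel_fun_series (g : nat -> X -> \bar R) : (forall n, borel_fun (g n)) ->
  (forall n x, 0 <= g n x) -> borel_fun (fun x => \sum_(n <oo) g n x).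
Proof.
move=> bg g0.
have := @ge0_emeasurable_sum _ (g_sigma_algebraType [set U : set X | open U]) _ setT g xpredT.
by apply=> [k x _ _|k _]; [exact: g0|exact: bg].
Qed.

(** The sum of functions admissible for the single families, with integrals at most e / 2^(n+1), is
    admissible for the union because it dominates each of them. *)
Lemma modulus1_bigcup (E : nat -> set (rpath X)) : (forall n, modulus1 mu (E n) = 0) ->
  modulus1 mu (\bigcup_n E n) = 0.
Proof.
move=> E0; apply/modulus1_eq0P => e e0.
have /choice[g gP] : forall n, exists g, admissible (E n) g /\
    integral_on mu setT g <= (e / (2 ^ n.+1)%:R)%:E.
  move=> n; have /modulus1_eq0P := E0 n => /(_ (e / (2 ^ n.+1)%:R)%R) [|g ? ?].
    by rewrite divr_gt0// ltr0n expn_gt0.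
  by exists g.
have bg n : borel_fun (g n) by have [[]] := gP n.
have g0 n x : 0 <= g n x by have [[_ + _] _] := gP n; exact.
exists (fun x => \sum_(n <oo) g n x); first split.
- exact: borel_fun_series.
- by move=> x; exact: nneseries_ge0.
- move=> p [n _ Enp]; have [[_ _ /(_ p Enp) le1] _] := gP n.
  apply: (le_trans le1); apply: path_integral_le => //; first exact: borel_fun_series.
  move=> x; rewrite (nneseriesD1 (n := n) (fun k _ => g0 k x))//.
  by rewrite leeDl// nneseries_ge0.
rewrite /integral_on integral_nneseries//; last by move=> n; exact: borel_fun_measurable.
apply: le_trans (epsilon_trick0 xpredT (ltW e0)).
apply: lee_nneseries => [n _ _|n _]; first by apply: integral_ge0.
by have [] := gP n.
Qed.

Lemma modulus1_setU E E' : modulus1 mu E = 0 -> modulus1 mu E' = 0 ->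
  modulus1 mu (E `|` E') = 0.
Proof.
move=> E0 E'0.
apply: (@modulus1_sub _ (\bigcup_n (if n == 0%N then E else E'))); last first.
  by apply: modulus1_bigcup => n; case: ifP.
by move=> p [Ep|E'p]; [exists 0%N|exists 1%N].
Qed.

Lemma modulus1_path_integral_pinfty g : borel_fun g -> (forall x, 0 <= g x) ->
  integral_on mu setT g < +oo -> modulus1 mu [set p | path_integral p g = +oo] = 0.
Proof.
move=> bg g0 goo; apply/modulus1_eq0P => e e0.
pose I := fine (integral_on mu setT g).
have I0 : (0 <= I)%R by rewrite fine_ge0// integral_ge0.
have IE : integral_on mu setT g = I%:E.
  by rewrite fineK// ge0_fin_numE// integral_ge0.
(* Scaling g by this factor makes its integral at most e, also when I = 0, while infinite path
   integrals stay infinite. *)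
have k0 : (0 < e / (1 + I))%R by rewrite divr_gt0// ltr_pwDl.
exists (fun x => (e / (1 + I))%:E * g x); first split.
- exact: measurable_funeM.
- by move=> x; rewrite mule_ge0// lee_fin ltW.
- by move=> p /= poo; rewrite path_integralZ ?(ltW k0)// poo gt0_muley ?leey// lte_fin.
rewrite /integral_on ge0_integralZl_EFin//.
- rewrite -/(integral_on mu setT g) IE -EFinM lee_fin -mulrA ger_pMr// mulrC.
  by rewrite ler_pdivrMr ?mul1r ?ltr_pwDl// lerDr.
- exact: borel_fun_measurable.
- exact: ltW.
Qed.

Lemma borel_fun_restrict g (B : set X) : borel_fun g -> borel_set B ->
  borel_fun (g \_ B).
Proof.
move=> bg bB.
apply/(@measurable_restrictT _ _ (g_sigma_algebraType [set U : set X | open U]) _ B g) => //.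
exact: measurable_funS bg.
Qed.

(** The image of a path is compact, so finitely many [B n] cover it. If the path integral of g is
    infinite, so is that of the restriction of g to one of them, and this restriction is
    integrable. *)
Lemma modulus1_path_integral_pinfty_cover g (B : nat -> set X) :
  borel_fun g -> (forall x, 0 <= g x) -> (forall n, open (B n)) ->
  (forall x, exists n, B n x) -> (forall n, integral_on mu (B n) g < +oo) ->
  modulus1 mu [set p | path_integral p g = +oo] = 0.
Proof.
move=> bg g0 oB cB goo; pose h n := g \_ (B n).
have bh n : borel_fun (h n) by apply: borel_fun_restrict => //; exact: open_borel.
have h0 n x : 0 <= h n x by rewrite /h /patch; case: ifP.
apply: (@modulus1_sub _ (\bigcup_n [set p | path_integral p (h n) = +oo])); last first.
  apply: modulus1_bigcup => n; apply: modulus1_path_integral_pinfty => //.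
  by rewrite /integral_on -integral_mkcond; exact: goo.
move=> p /= poo.
have /= := @segment_compact R 0%R (plen p); rewrite compact_cover.
move=> /(_ nat setT (fun n => pclamp p @^-1` B n))[n _| |D _ cD].
- by move/continuousP: (@pclamp_continuous R X p); exact.
- by move=> s _; have [n Bn] := cB (pclamp p s); exists n.
have le_sum : path_integral p g <= \sum_(n <- finmap.enum_fset D) path_integral p (h n).
  rewrite path_integralE; under eq_bigr do rewrite path_integralE.
  rewrite -ge0_integral_sum//; last by move=> n; exact: pclamp_measurable.
  apply: ge0_le_integral => //.
  - exact: pclamp_measurable.
  - by apply: emeasurable_sum => n; exact: pclamp_measurable.
  move=> s /cD[n /= nD Bn].
  rewrite (big_rem n)//= {1}/h patchT ?inE// leeDl// sume_ge0//.
apply: contrapT => H.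
have : \sum_(n <- finmap.enum_fset D) path_integral p (h n) < +oo.
  elim/big_ind : _ => [|x y xoo yoo|n _]; first exact: ltry.
    by rewrite lte_add_pinfty.
  rewrite ltey; apply/eqP => hn; by apply: H; exists n.
by move=> /(le_lt_trans le_sum); rewrite poo ltxx.
Qed.

End modulus.

(** * Existence of minimal weak upper gradients *)

Section interval_arguments.
Variable R : realType.
Implicit Types (a b s t x : R).

(* Real induction: the supremum of the t with P a t is b. *)
Lemma interval_local_to_global (P : R -> R -> Prop) a b : a <= b ->
  (forall s t x, a <= s -> s <= t -> t <= x -> x <= b -> P s t -> P t x -> P s x) ->
  (forall x, a <= x -> x <= b -> exists2 d, 0 < d & forall s t,
     a <= s -> s <= x -> x <= t -> t <= b -> x - s < d -> t - x < d -> P s t) ->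
  P a b.
Proof.
move=> ab trans loc; pose S := [set t | a <= t <= b /\ P a t].
have Sa : S a.
  split; first by rewrite lexx.
  by have [d d0] := loc a (lexx a) ab; apply; rewrite ?subrr.
have ubS : ubound S b by move=> t [/andP[_]].
have hS : has_sup S by split; [exists a|exists b].
set c := sup S.
have ac : a <= c by exact: ub_le_sup hS.2 _ Sa.
have cb : c <= b by apply: ge_sup => //; exists a.
have [d d0 hd] := loc c ac cb.
have Pac : P a c.
  have [t [/andP[a_t tb] Pat] ct] := sup_adherent d0 hS.
  have tc : t <= c by apply: ub_le_sup hS.2 _ _; split => //; rewrite a_t.
  apply: (trans a t c) => //; apply: hd => //; rewrite ?subrr//.
  by rewrite ltrBlDr addrC -ltrBlDr.
move: cb; rewrite le_eqVlt => /orP[/eqP<-//|cb]; exfalso.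
pose t := Num.min b (c + d / 2).
have ct : c < t by rewrite /t lt_min cb ltrDl divr_gt0.
have tb : t <= b by rewrite /t ge_min lexx.
suff : t <= c by rewrite leNgt ct.
apply: ub_le_sup hS.2 _ _; split; first by rewrite tb (le_trans ac)// ltW.
apply: (trans a c t) => //; first exact: ltW.
apply: hd => //; [exact: ltW|by rewrite subrr|].
have : t <= c + d / 2 by rewrite /t ge_min lexx orbT.
by lra.
Qed.

Local Open Scope ereal_scope.

Lemma ge0_integral_itv_cat (f : R -> \bar R) s t x : (s <= t)%R -> (t <= x)%R ->
  measurable_fun [set: measurableTypeR R] f -> (forall y, 0 <= f y) ->
  \int[lebesgue_measure]_(y in `[s, x]) f y =
  \int[lebesgue_measure]_(y in `[s, t]) f y + \int[lebesgue_measure]_(y in `[t, x]) f y.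
Proof.
move=> st tx mf f0.
rewrite -(integral_itv_obnd_cbnd (r := t)); last exact: measurable_funTS.
rewrite -ge0_integral_setU//=.
- by congr integral; rewrite (@itv_bndbnd_setU _ _ (BLeft s) (BRight t)) ?bnd_simp.
- exact: measurable_funTS.
- apply/disj_setPS => y [/=]; rewrite !in_itv/= => /andP[_ yt] /andP[ty _].
  by move: yt; rewrite leNgt ty.
Qed.

(** Under concatenation of intervals the left side is subadditive and the right side additive, which
    is what real induction needs. *)
Lemma increment_local_to_global (v : R -> R) (G : R -> \bar R) a b : (a <= b)%R ->
  measurable_fun [set: measurableTypeR R] G -> (forall y, 0 <= G y) ->
  (forall x, (a <= x)%R -> (x <= b)%R -> exists2 d, (0 < d)%R & forall s t,
     (a <= s)%R -> (s <= x)%R -> (x <= t)%R -> (t <= b)%R -> (x - s < d)%R -> (t - x < d)%R ->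
     `|v s - v t|%:E <= \int[lebesgue_measure]_(y in `[s, t]) G y) ->
  `|v a - v b|%:E <= \int[lebesgue_measure]_(y in `[a, b]) G y.
Proof.
move=> ab mG G0; apply: (@interval_local_to_global (fun s t =>
  `|v s - v t|%:E <= \int[lebesgue_measure]_(y in `[s, t]) G y)) => //.
move=> s t x _ st tx _ Pst Ptx; rewrite (ge0_integral_itv_cat st tx)//.
apply: le_trans (leeD Pst Ptx); rewrite -EFinD lee_fin.
by rewrite (le_trans _ (ler_normD _ _))// addrA subrK.
Qed.

(** A finite integral makes f finite almost everywhere. It can thus be replaced by [fine \o f], to
    which the density of continuous functions in L^1 applies. *)
Lemma continuous_approximation (f : R -> \bar R) a b e : (0 < e)%R ->
  measurable_fun [set: measurableTypeR R] f -> (forall y, 0 <= f y) ->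
  \int[lebesgue_measure]_(y in `[a, b]) f y < +oo ->
  exists2 k : R -> R, continuous k &
    \int[lebesgue_measure]_(y in `[a, b]) `|f y - (k y)%:E| <= e%:E.
Proof.
move=> e0 mf f0 foo.
have intf : lebesgue_measure.-integrable `[a, b] f.
  apply/integrableP; split; first exact: measurable_funTS.
  by under eq_integral do rewrite gee0_abs//.
have muab : lebesgue_measure `[a, b]%classic < +oo.
  by rewrite lebesgue_measure_itv/=; case: ifP => _; rewrite ltry.
have mab : measurable (`[a, b]%classic : set (measurableTypeR R)) by [].
have ae : {ae lebesgue_measure, forall x, `[a, b]%classic x -> (fine (f x))%:E = f x}.
  by apply: filterS (integrable_ae mab intf) => x H /H /fineK.
have mff : measurable_fun [set: measurableTypeR R] (fine \o f) by exact: measurableT_comp.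
have intff : lebesgue_measure.-integrable `[a, b] (EFin \o (fine \o f)).
  apply/integrableP; split; first exact/measurable_EFinP/measurable_funTS.
  apply: le_lt_trans foo; apply: ge0_le_integral => //.
  - by apply: measurableT_comp => //; exact/measurable_EFinP/measurable_funTS.
  - exact: measurable_funTS.
  - move=> x _ /=; case: (f x) (f0 x) => [r r0| |]//=; last by rewrite normr0 leey.
    by rewrite lee_fin ger0_norm// -lee_fin.
have [k [kc intk]] := approximation_continuous_integrable mab muab intff.
move=> /fine_cvgP[[m _ fin]] /cvgrPdist_lt /(_ e e0) [n _ close].
have /= fmn := fin (maxn m n) (leq_maxl _ _).
have /= := close (maxn m n) (leq_maxr _ _).
set I := integral _ _ _ in fmn * => Ie.
exists (k (maxn m n)); first exact: kc.
have mk : measurable_fun `[a, b] (EFin \o k (maxn m n)) by exact: measurable_int (intk _).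
rewrite [leLHS](_ : _ = I); last first.
  apply: ge0_ae_eq_integral => //.
  - apply: (@measurableT_comp _ _ _ _ _ _ abse) => //.
    by apply: (emeasurable_funB (measurable_funTS mf) mk).
  - apply/measurable_EFinP/measurableT_comp => //.
    by apply/measurable_funB; [exact: measurable_funTS|exact/measurable_EFinP].
  - have [N [mN N0 NS]] := ae; exists N; split => // x nx; apply: NS => /= H; apply: nx => xab /=.
    by rewrite -{1}(H xab).
rewrite -(fineK fmn) lee_fin; move: Ie; rewrite sub0r normrN => /ltW.
exact/le_trans/ler_norm.
Qed.

(** Here a1, a2 are the approximations at a point and x1 <= x2 their values at a nearby centre, so
    f1 is below f2 up to e and the two approximation errors. If f1 or f2 is infinite, so is its
    error term. *)
Lemma le_mine_approx (f1 f2 : \bar R) (a1 a2 x1 x2 e : R) : (0 < e)%R ->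
  0 <= f1 -> 0 <= f2 -> (x1 <= x2)%R -> (`|a1 - x1| < e / 2)%R -> (`|a2 - x2| < e / 2)%R ->
  f1 <= mine f1 f2 + ((2 * e)%:E + (2%:E * `|f1 - a1%:E| + 2%:E * `|f2 - a2%:E|)).
Proof.
move=> e0 f10 f20 x12 a1x a2x.
have D0 (f : \bar R) a : 0 <= 2%:E * `|f - a%:E|.
  by apply: mule_ge0; [rewrite lee_fin|exact: abse_ge0].
have E0 : 0 <= (2 * e)%:E by rewrite lee_fin; lra.
have oo (f : \bar R) a : f = +oo -> 2%:E * `|f - a%:E| = +oo.
  by move=> ->; rewrite addye// gt0_muley.
have mf : 0 <= mine f1 f2 by rewrite le_min f10 f20.
set S := 2%:E * _ + _.
have big (t : \bar R) : t <= S -> t <= mine f1 f2 + ((2 * e)%:E + S).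
  by move=> tS; apply: (le_trans tS); rewrite addeA leeDr// adde_ge0.
have [f1oo|f1f] := eqVneq f1 +oo.
  by rewrite [X in X <= _]f1oo big// -(oo f1 a1 f1oo) leeDl.
have [f2oo|f2f] := eqVneq f2 +oo.
  apply: (@le_trans _ _ +oo); first exact: leey.
  by rewrite big// -(oo f2 a2 f2oo) leeDr.
rewrite /S {big S}.
case: f1 f10 f1f mf => [r1 r10 _ _| |]//; case: f2 f20 f2f => [r2 r20 _| |]//.
rewrite -EFin_min -!EFinB /= -!EFinM -!EFinD lee_fin.
have n1 := ler_norm (r1 - a1)%R; have n2 := ler_norm (a2 - r2)%R; rewrite distrC in n2.
have z1 := normr_ge0 (r1 - a1)%R; have z2 := normr_ge0 (r2 - a2)%R.
move: a1x a2x; rewrite !ltr_norml => /andP[? ?] /andP[? ?].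
by have [r12|r21] := leP r1 r2; lra.
Qed.

(* On short intervals one of the two continuous approximations is the smaller
   one throughout, up to a small error. *)
Lemma increment_le_mine (v : R -> R) (f1 f2 : R -> \bar R) L : (0 <= L)%R ->
  measurable_fun [set: measurableTypeR R] f1 -> (forall y, 0 <= f1 y) ->
  measurable_fun [set: measurableTypeR R] f2 -> (forall y, 0 <= f2 y) ->
  \int[lebesgue_measure]_(y in `[0%R, L]) f1 y < +oo ->
  \int[lebesgue_measure]_(y in `[0%R, L]) f2 y < +oo ->
  (forall s t, (0 <= s)%R -> (s <= t)%R -> (t <= L)%R ->
    `|v s - v t|%:E <= \int[lebesgue_measure]_(y in `[s, t]) f1 y /\
    `|v s - v t|%:E <= \int[lebesgue_measure]_(y in `[s, t]) f2 y) ->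
  `|v 0 - v L|%:E <= \int[lebesgue_measure]_(y in `[0%R, L]) mine (f1 y) (f2 y).
Proof.
move=> L0 mf1 f10 mf2 f20 f1oo f2oo le12.
apply/lee_addgt0Pr => e0 e0_gt0.
(* The error terms of [G] below integrate over [0, L] to at most 2 e L + 2 e + 2 e = e0. *)
pose e := (e0 / (4 + 2 * L))%R.
have e_gt0 : (0 < e)%R by rewrite divr_gt0// ltr_pwDl// mulr_ge0.
have [k1 k1c k1e] := continuous_approximation e_gt0 mf1 f10 f1oo.
have [k2 k2c k2e] := continuous_approximation e_gt0 mf2 f20 f2oo.
have mk k : continuous k -> measurable_fun [set: measurableTypeR R] (EFin \o k : R -> \bar R).
  by move=> kc; apply/measurable_EFinP; exact: continuous_measurable_fun.
pose D1 y := `|f1 y - (k1 y)%:E|; pose D2 y := `|f2 y - (k2 y)%:E|.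
have mD1 : measurable_fun [set: measurableTypeR R] D1.
  by apply: (@measurableT_comp _ _ _ _ _ _ abse) => //; apply: (emeasurable_funB mf1 (mk _ k1c)).
have mD2 : measurable_fun [set: measurableTypeR R] D2.
  by apply: (@measurableT_comp _ _ _ _ _ _ abse) => //; apply: (emeasurable_funB mf2 (mk _ k2c)).
have mm : measurable_fun [set: measurableTypeR R] (fun y => mine (f1 y) (f2 y)).
  exact: measurable_mine.
have m0 y : 0 <= mine (f1 y) (f2 y) by rewrite le_min f10 f20.
pose G y := mine (f1 y) (f2 y) + ((2 * e)%:E + (2%:E * D1 y + 2%:E * D2 y)).
have D10 y : 0 <= 2%:E * D1 y by apply: mule_ge0; [rewrite lee_fin|exact: abse_ge0].
have D20 y : 0 <= 2%:E * D2 y by apply: mule_ge0; [rewrite lee_fin|exact: abse_ge0].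
have D0 y : 0 <= 2%:E * D1 y + 2%:E * D2 y by exact: adde_ge0.
have E0 y : 0 <= (2 * e)%:E + (2%:E * D1 y + 2%:E * D2 y).
  by rewrite adde_ge0// lee_fin mulr_ge0// ltW.
have mD1' : measurable_fun [set: measurableTypeR R] (fun y => 2%:E * D1 y).
  exact: measurable_funeM.
have mD2' : measurable_fun [set: measurableTypeR R] (fun y => 2%:E * D2 y).
  exact: measurable_funeM.
have mD' : measurable_fun [set: measurableTypeR R] (fun y => 2%:E * D1 y + 2%:E * D2 y).
  exact: emeasurable_funD.
have mE : measurable_fun [set: measurableTypeR R]
    (fun y => (2 * e)%:E + (2%:E * D1 y + 2%:E * D2 y)).
  exact: emeasurable_funD.
have mG : measurable_fun [set: measurableTypeR R] G by exact: emeasurable_funD.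
have G0 y : 0 <= G y by exact: adde_ge0.
have GE : \int[lebesgue_measure]_(y in `[0%R, L]) G y <=
    \int[lebesgue_measure]_(y in `[0%R, L]) mine (f1 y) (f2 y) + e0%:E.
  rewrite ge0_integralD//; [|by apply: measurable_funTS; exact: mm|by apply: measurable_funTS; exact: mE].
  rewrite leeD2l// ge0_integralD//; last 2 first.
  - by move=> *; rewrite lee_fin mulr_ge0// ltW.
  - by apply: measurable_funTS; exact: mD'.
  rewrite ge0_integralD//; [|by apply: measurable_funTS; exact: mD1'|by apply: measurable_funTS; exact: mD2'].
  rewrite (ge0_integralZl_EFin _ _ _ (measurable_funTS mD1))//; last by move=> *; exact: abse_ge0.
  rewrite (ge0_integralZl_EFin _ _ _ (measurable_funTS mD2))//; last by move=> *; exact: abse_ge0.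
  rewrite integral_cst//= lebesgue_measure_itv/=.
  apply: (@le_trans _ _ ((2 * e)%:E * L%:E + (2%:E * e%:E + 2%:E * e%:E))).
    apply: leeD; last by apply: leeD; apply: lee_wpmul2l => //; rewrite lee_fin.
    apply: lee_wpmul2l; first by rewrite lee_fin mulr_ge0// ltW.
    by case: ifP => _; rewrite lee_fin ?oppr0 ?addr0.
  rewrite -!EFinM -!EFinD lee_fin /e.
  have -> // : (2 * (e0 / (4 + 2 * L)) * L + (2 * (e0 / (4 + 2 * L)) + 2 * (e0 / (4 + 2 * L))) = e0)%R.
  by field; rewrite gt_eqF// ltr_pwDl// mulr_ge0.
apply: le_trans GE; apply: increment_local_to_global => // x x0 xL.
have kcont (k : R -> R) : continuous k -> exists2 d, (0 < d)%R & forall y, (`|y - x| < d)%R -> (`|k y - k x| < e / 2)%R.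
  move=> kc; have /cvgrPdist_lt/(_ (e / 2)%R) := kc x.
  rewrite divr_gt0// => /(_ isT)[d /= d0 hd]; exists d => // y yx.
  by rewrite distrC; apply: hd; rewrite /= distrC.
have [d1 d10 h1] := kcont _ k1c; have [d2 d20 h2] := kcont _ k2c.
exists (Num.min d1 d2); first by rewrite lt_min d10.
move=> s t s0 sx xt tL; rewrite !lt_min => /andP[xs1 xs2] /andP[tx1 tx2].
have near y : y \in `[s, t] -> (`|k1 y - k1 x| < e / 2)%R /\ (`|k2 y - k2 x| < e / 2)%R.
  rewrite in_itv/= => /andP[sy yt]; split; [apply: h1|apply: h2];
  by rewrite ltr_norml; apply/andP; split; lra.
have [le1 le2] := le12 s t s0 (le_trans sx xt) tL.
have [k12|/ltW k21] := leP (k1 x) (k2 x).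
  apply: (le_trans le1); apply: ge0_le_integral => //; [exact: measurable_funTS..|].
  move=> y yst; have [? ?] := near y yst.
  by rewrite /G /D1 /D2; apply: (@le_mine_approx _ _ _ _ (k1 x) (k2 x)).
apply: (le_trans le2); apply: ge0_le_integral => //; [exact: measurable_funTS..|].
move=> y yst; have [? ?] := near y yst.
rewrite /G /D1 /D2 minC (addeC (_ * `|f1 _ - _|)).
by apply: (@le_mine_approx _ _ _ _ (k2 x) (k1 x)).
Qed.

End interval_arguments.

Lemma metric_ball_open (R : realType) (X : metricType R) (x : X) (r : R) : open (ball x r).
Proof.
rewrite openE => y; rewrite ballEmdist /= => xy; apply/nbhs_ballP.
exists (r - mdist x y) => /=; first by rewrite subr_gt0.
move=> z; rewrite !ballEmdist /= => yz.
by apply: le_lt_trans (metric_triangle x y z) _; lra.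
Qed.

(** * Weak upper gradients: minima, decreasing limits and a least element *)

Section minimal_upper_gradient.
Variables (R : realType) (X : pmetricType R).
Variable mu : {outer_measure set X -> \bar R}.
Hypothesis mms : metric_measure_space mu.
Local Open Scope ereal_scope.
Implicit Types (g h : X -> \bar R) (E : set (rpath X)) (u : X -> R).

(* All that is needed of a subpath p' of p. *)
Definition dominated_subpath (p' p : rpath X) : Prop :=
  forall g, borel_fun g -> (forall x, 0 <= g x) -> path_integral p' g <= path_integral p g.

(** A function admissible for E is admissible for all paths with a subpath in E, as its integral
    only grows. Discarding these paths makes an inequality hold on all subpaths of the remaining
    ones at once. *)
Lemma modulus1_dominated_subpath E : modulus1 mu E = 0 ->
  modulus1 mu [set p | exists2 p', E p' & dominated_subpath p' p] = 0.
Proof.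
move=> /modulus1_eq0P H; apply/modulus1_eq0P => e /H[g [bg g0 ag] ge].
exists g => //; split => // p [p' Ep' pp'].
exact: le_trans (ag _ Ep') (pp' _ bg g0).
Qed.

Lemma upper_gradient_along_subinterval u g (p : rpath X) (E : set (rpath X)) (s t : R) :
  borel_fun g -> (forall x, 0 <= g x) ->
  (forall p, nonconstant p -> ~ E p -> upper_gradient_along (EFin \o u) g p) ->
  ~ (exists2 p', E p' & dominated_subpath p' p) ->
  (0 <= s)%R -> (s <= t)%R -> (t <= plen p)%R ->
  `|u (pclamp p s) - u (pclamp p t)|%:E <=
    \int[lebesgue_measure]_(y in `[s, t]) g (pclamp p y).
Proof.
move=> bg g0 ug nE s0 st tL.
have [p' [p's p't p'g]] := subpath_integral s0 st tL.
have sub : dominated_subpath p' p.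
  move=> f bf f0; rewrite (p'g f bf f0) path_integralE.
  apply: ge0_subset_integral => //; first exact: pclamp_measurable.
  by move=> y /=; rewrite !in_itv/= => /andP[sy yt]; rewrite (le_trans s0)//= (le_trans yt).
rewrite !pclampE ?in_itv/= ?s0 ?tL ?(le_trans s0 st) ?(le_trans st tL)//.
rewrite -p's -p't -(p'g g bg g0).
have [nc|c] := pselect (nonconstant p').
  apply: (ug _ nc) => Ep'.
  by apply: nE; exists p'.
(* The hypothesis is silent about constant subpaths, but on them the increment is 0. *)
have -> : p' (rpath_end p') = p' (rpath_start p').
  apply: contrapT => ne; apply: c; exists (rpath_end p') => //.
  by rewrite in_itv/= lexx rpath_le.
by rewrite subrr normr0 path_integral_ge0.
Qed.

Lemma upper_gradient_along_pclamp u g (p : rpath X) :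
  `|u (pclamp p 0) - u (pclamp p (plen p))|%:E <= path_integral p g ->
  upper_gradient_along (EFin \o u) g p.
Proof.
rewrite /upper_gradient_along /=.
rewrite !pclampE ?in_itv/= ?lexx ?plen_ge0//.
by rewrite arclength_param0 arclength_param_plen.
Qed.

Lemma borel_fun_mine g h : borel_fun g -> borel_fun h ->
  borel_fun (fun x => mine (g x) (h x)).
Proof. exact: measurable_mine. Qed.

(** Outside the four families discarded below, the increments of u over all subintervals are bounded
    by both integrals, and both integrals are finite, as [increment_le_mine] requires. *)
Lemma weak_upper_gradient_mine u g h :
  weak_upper_gradient mu (EFin \o u) g -> weak_upper_gradient mu (EFin \o u) h ->
  modulus1 mu [set p | path_integral p g = +oo] = 0 ->
  modulus1 mu [set p | path_integral p h = +oo] = 0 ->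
  weak_upper_gradient mu (EFin \o u) (fun x => mine (g x) (h x)).
Proof.
move=> [bg g0 [E1 E10 ug]] [bh h0 [E2 E20 uh]] goo hoo; split.
- exact: borel_fun_mine.
- by move=> x; rewrite le_min g0 h0.
exists ([set p | exists2 p', E1 p' & dominated_subpath p' p] `|`
  [set p | exists2 p', E2 p' & dominated_subpath p' p] `|`
  ([set p | path_integral p g = +oo] `|` [set p | path_integral p h = +oo])).
  by do !apply: modulus1_setU => //; exact: modulus1_dominated_subpath.
move=> p _ /not_orP[/not_orP[nE1 nE2] /not_orP[/= /eqP ngoo /eqP nhoo]].
apply: upper_gradient_along_pclamp; rewrite path_integralE.
have fin f : path_integral p f != +oo ->
    \int[lebesgue_measure]_(y in `[0%R, plen p]) (f \o pclamp p) y < +oo.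
  by rewrite ltey path_integralE.
apply: (@increment_le_mine _ (u \o pclamp p) (g \o pclamp p) (h \o pclamp p)) => //.
- exact: plen_ge0.
- exact: (@pclamp_measurable _ _ p g setT).
- by move=> y; exact: g0.
- exact: (@pclamp_measurable _ _ p h setT).
- by move=> y; exact: h0.
- exact: fin.
- exact: fin.
move=> s t s0 st tL; split.
  exact: (upper_gradient_along_subinterval bg g0 ug nE1).
exact: (upper_gradient_along_subinterval bh h0 uh nE2).
Qed.

(** Along a path on which [h 0] has a finite integral, dominated convergence carries the inequality
    to the limit. The other paths have modulus zero because [h 0] is integrable. *)
Lemma weak_upper_gradient_einfs u (h : nat -> X -> \bar R) :
  (forall n, weak_upper_gradient mu (EFin \o u) (h n)) ->
  (forall n x, h n.+1 x <= h n x) ->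
  integral_on mu setT (h 0%N) < +oo ->
  weak_upper_gradient mu (EFin \o u) (fun x => einfs (h ^~ x) 0%N).
Proof.
move=> uh dec h0oo.
have bh n : borel_fun (h n) by have [] := uh n.
have h0 n x : 0 <= h n x by have [_ + _] := uh n; exact.
have /choice[E EP] : forall n, exists E, modulus1 mu E = 0 /\ forall p, nonconstant p ->
    ~ E p -> upper_gradient_along (EFin \o u) (h n) p.
  by move=> n; have [_ _ [E ? ?]] := uh n; exists E.
have bi : borel_fun (fun x => einfs (h ^~ x) 0%N).
  exact: (@measurable_fun_einfs _ (g_sigma_algebraType [set U : set X | open U])).
have i0 x : 0 <= einfs (h ^~ x) 0%N.
  by rewrite /einfs/=; apply: le_ereal_inf_tmp => _ [n _ <-].
split => //.
exists ((\bigcup_n E n) `|` [set p | path_integral p (h 0%N) = +oo]).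
  apply: modulus1_setU => //; first by apply: (modulus1_bigcup mms) => n; have [] := EP n.
  exact: modulus1_path_integral_pinfty.
move=> p nc /not_orP[nE /eqP poo].
have cvg x : h ^~ x @ \oo --> einfs (h ^~ x) 0%N.
  have -> : einfs (h ^~ x) 0%N = ereal_inf (range (h ^~ x)).
    by rewrite /einfs/= /sdrop; congr ereal_inf; apply/seteqP; split => _ [n _ <-]; exists n.
  by apply: ereal_nonincreasing_cvgn; apply/nonincreasing_seqP => n; exact: dec.
have dom n x : h n x <= h 0%N x.
  by elim: n => [|n]; [exact: lexx|exact/le_trans/dec].
have mh n := @pclamp_measurable _ _ p (h n) `[0%R, plen p]%classic (bh n).
have int0 : lebesgue_measure.-integrable `[0%R, plen p] (h 0%N \o pclamp p).
  apply/integrableP; split => //.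
  under eq_integral => y _ do rewrite gee0_abs ?h0//=.
  by rewrite -path_integralE ltey.
have mi := @pclamp_measurable _ _ p _ `[0%R, plen p]%classic bi.
pose D : set (measurableTypeR R) := `[0%R, plen p]%classic.
have mD : measurable D by exact: measurable_itv.
have ae1 : {ae lebesgue_measure, forall s, D s ->
    (fun n => (h n \o pclamp p) s) @ \oo --> einfs (h ^~ (pclamp p s)) 0%N}.
  by apply: aeW => s _ /=; exact: cvg.
have ae2 : {ae lebesgue_measure, forall s n, D s ->
    `|(h n \o pclamp p) s| <= (h 0%N \o pclamp p) s}.
  by apply: aeW => s n _ /=; rewrite gee0_abs.
have [_ _ cvgI] := dominated_convergence mD mh mi ae1 int0 ae2.
rewrite /upper_gradient_along path_integralE; move/cvg_lim : (cvgI) => <-//.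
apply: lime_ge; first by apply/cvg_ex; eexists; exact: cvgI.
apply: nearW => n; have [_ /(_ p nc)] := EP n.
rewrite /upper_gradient_along path_integralE; apply.
by move=> En; apply: nE; exists n.
Qed.

Lemma integrable_onP (A : set X) g : open A -> borel_fun g -> (forall x, 0 <= g x) ->
  integrable_on mu A g <-> integral_on mu A g < +oo.
Proof.
move=> oA bg g0; rewrite /integrable_on /integral_on.
split=> [/integrableP[_]|goo]; first by under eq_integral do rewrite gee0_abs//.
apply/integrableP; split; first by apply: measurable_funTS; exact: borel_fun_measurable.
by under eq_integral do rewrite gee0_abs//.
Qed.

(* A minimizer of the integral over the integrable weak upper gradients is
   minimal among the locally integrable ones, since min (k, g') competes with k. *)
Lemma exists_minimal_weak_upper_gradient u g0 :
  weak_upper_gradient mu (EFin \o u) g0 -> integral_on mu setT g0 < +oo ->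
  (forall g, borel_fun g -> (forall x, 0 <= g x) -> locally_integrable_fun mu g ->
    modulus1 mu [set p | path_integral p g = +oo] = 0) ->
  exists g, minimal_weak_upper_gradient mu (EFin \o u) g.
Proof.
move=> ug0 g0oo loc.
pose W := [set g | weak_upper_gradient mu (EFin \o u) g /\ integral_on mu setT g < +oo].
have Wg0 : W g0 by [].
have W0 g x : W g -> 0 <= g x by move=> [[_ + _] _]; exact.
have Wb g : W g -> borel_fun g by move=> [[]].
have Wm g : W g -> measurable_fun (setT : set (caratheodory_type mu)) g.
  by move=> /Wb; exact: borel_fun_measurable.
have Wmod g : W g -> modulus1 mu [set p | path_integral p g = +oo] = 0.
  move=> Wg; apply: modulus1_path_integral_pinfty => //; first exact: Wb.
    by move=> x; exact: W0.
  by case: Wg.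
have Wmine g h : W g -> weak_upper_gradient mu (EFin \o u) h ->
    modulus1 mu [set p | path_integral p h = +oo] = 0 -> W (fun x => mine (g x) (h x)).
  move=> Wg uh hoo; have [ug goo] := Wg; split.
    by apply: weak_upper_gradient_mine => //; exact: Wmod.
  apply: le_lt_trans goo; apply: ge0_le_integral => //.
  - by move=> x _; rewrite le_min W0//; case: uh => _ ->.
  - by apply: measurable_mine; [exact: Wm|case: uh => bh _ _; exact: borel_fun_measurable].
  - exact: Wm.
  - by move=> x _; rewrite ge_min lexx.
pose I := ereal_inf [set integral_on mu setT g | g in W].
have I0 : 0 <= I by apply: le_ereal_inf_tmp => _ [g Wg <-]; apply: integral_ge0 => x _; exact: W0.
have Ile g : W g -> I <= integral_on mu setT g by move=> Wg; apply: ereal_inf_lbound; exists g.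
have Ifin : I \is a fin_num by rewrite ge0_fin_numE// (le_lt_trans (Ile _ Wg0)).
have /choice[g gP] : forall n : nat, exists g, W g /\ integral_on mu setT g <= I + (n.+1%:R^-1)%:E.
  move=> n; have n0 : (0 < n.+1%:R^-1 :> R)%R by rewrite invr_gt0.
  by have [_ [g Wg <-] /ltW] := lb_ereal_inf_adherent n0 Ifin; exists g.
(* Running minima turn the minimizing sequence into a decreasing one that is still in W. *)
pose h := fix h n := if n is k.+1 then (fun x => mine (h k x) (g n x)) else g 0%N.
have Wh n : W (h n).
  elim: n => [|n ih] /=; first by case: (gP 0%N).
  by apply: Wmine => //; [case: (gP n.+1) => -[]|apply: Wmod; case: (gP n.+1)].
have hg n x : h n x <= g n x by case: n => [|n] /=; rewrite ?lexx// ge_min lexx orbT.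
pose k x := einfs (h ^~ x) 0%N.
have kh n x : k x <= h n x by apply: ereal_inf_lbound; exists n.
have Wk : W k.
  have uk : weak_upper_gradient mu (EFin \o u) k.
    apply: weak_upper_gradient_einfs => [n|n x|]; last by case: (Wh 0%N).
      by case: (Wh n).
    by rewrite /= ge_min lexx.
  split => //; apply: le_lt_trans (Wh 0%N).2; case: uk => bk k0 _.
  by apply: ge0_le_integral => //; [exact: borel_fun_measurable|exact: Wm].
have kI : integral_on mu setT k <= I.
  apply/lee_addgt0Pr => e e0; have [n ne] := ltr_add_invr e0.
  apply: (@le_trans _ _ (I + (n.+1%:R^-1)%:E)); last first.
    by rewrite leeD2l// lee_fin; apply/ltW; move: ne; rewrite add0r.
  apply: le_trans (gP n).2; apply: ge0_le_integral => //.
  - by move=> x _; exact: W0.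
  - exact: Wm.
  - by apply: Wm; case: (gP n).
  - by move=> x _; exact: le_trans (kh n x) (hg n x).
have kfin : integral_on mu setT k \is a fin_num.
  rewrite ge0_fin_numE; first by case: Wk.
  by apply: integral_ge0 => x _; exact: W0.
exists k; split; first by case: Wk.
  move=> x; exists 1%R => //; apply/integrable_onP; [exact: metric_ball_open|exact: Wb| |].
    by move=> y; exact: W0.
  apply: le_lt_trans Wk.2; apply: ge0_subset_integral => //.
  - by apply: (open_measurable_cara mms); exact: metric_ball_open.
  - exact: Wm.
  - by move=> y _; exact: W0.
move=> g' ug' locg'; have [bg' g'0 _] := ug'.
have Wm' : W (fun x => mine (k x) (g' x)) by apply: Wmine => //; exact: loc.
set m := (fun x => mine _ _) in Wm'.
have mk x : m x <= k x by rewrite /m ge_min lexx.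
have mkI : integral_on mu setT m = integral_on mu setT k.
  apply/eqP; rewrite eq_le (le_trans kI (Ile _ Wm')) andbT.
  apply: ge0_le_integral => //; [|exact: Wm..].
  by move=> x _; exact: W0.
have intk : (cara_measure mu).-integrable setT k.
  by apply/integrable_onP; [exact: openT|exact: Wb|move=> x; exact: W0|case: Wk].
have intm : (cara_measure mu).-integrable setT m.
  by apply/integrable_onP; [exact: openT|exact: Wb|move=> x; exact: W0|case: Wm'].
have aek : {ae cara_measure mu, forall x, setT x -> k x \is a fin_num} by exact: integrable_ae.
have mdiff : measurable_fun (setT : set (caratheodory_type mu)) (fun x => k x - m x).
  by apply: emeasurable_funB; exact: Wm.
(* The nonnegative difference of k and m has integral 0. Where k is infinite the subtraction has no
   meaning, so the null set of these points is treated apart. *)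
have aed : ae_eq (cara_measure mu) setT (fun x => k x - m x) (cst 0).
  apply/(ae_eq_integral_abs _ measurableT mdiff).
  transitivity (\int[cara_measure mu]_x (k x - m x)).
    apply: ae_eq_integral => //; first exact: measurableT_comp.
    have [N [mN N0 NS]] := aek; exists N; split => // x nx; apply: NS => /= H; apply: nx => _ /=.
    by rewrite gee0_abs// sube_ge0 ?(H Logic.I) ?orbT//; exact: mk.
  have := integralB measurableT intk intm; rewrite /= => ->.
  rewrite -/(integral_on mu setT k) -/(integral_on mu setT m) mkI subee//.
have [N1 [mN1 N10 NS1]] := aek; have [N2 [mN2 N20 NS2]] := aed.
exists (N1 `|` N2); split; [exact: measurableU|exact: null_set_setU|].
apply: subset_trans (setUSS NS1 NS2); rewrite -setCI; apply: subsetC.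
move=> x [/(_ Logic.I) kf /(_ Logic.I) /= d0].
have km : k x = m x.
  move: d0 kf; case: (k x) => [a| |]//; case: (m x) => [b| |]// [] /eqP.
  by rewrite subr_eq0 => /eqP ->.
by rewrite km /m ge_min lexx orbT.
Qed.

End minimal_upper_gradient.

(** * Upper gradients of locally Lipschitz functions, and nets *)

Section local_lipschitz.
Variables (R : realType) (X : pmetricType R).
Local Open Scope ereal_scope.

(** The point z stands for an arbitrary point of a short arc from x to y. Since the bound holds for
    all of them, it can be averaged over the arc, which yields the integral of K g. *)
Lemma local_lipschitz_upper_gradient (u g : X -> R) (d K : R) : (0 < d)%R ->
  borel_fun (EFin \o g) -> (forall x, 0 <= g x)%R -> (0 <= K)%R ->
  (forall x y z, mdist x y < d -> mdist x z < d ->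
    `|u x - u y| <= K * mdist x y * g z)%R ->
  upper_gradient (EFin \o u) (fun x => (K * g x)%:E).
Proof.
move=> d0 bg g0 K0 lip.
have bKg : borel_fun (fun x => (K * g x)%:E).
  by under eq_fun do rewrite EFinM; exact: measurable_funeM.
have Kg0 x : 0 <= (K * g x)%:E by rewrite lee_fin mulr_ge0.
split=> // p nc; apply: upper_gradient_along_pclamp; rewrite path_integralE.
have L0 := plen_ge0 p.
apply: (@increment_local_to_global _ (u \o pclamp p) (fun y => (K * g (pclamp p y))%:E)) => //.
  exact: (@pclamp_measurable _ _ p _ setT bKg).
move=> x x0 xL; exists (d / 2)%R; first by rewrite divr_gt0.
move=> s t s0 sx xt tL xsd txd; have st := le_trans sx xt.
move: st; rewrite le_eqVlt => /orP[/eqP <-|st].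
  by rewrite subrr normr0 integral_ge0.
set c := `|_ - _|%R.
have cE : c%:E = \int[lebesgue_measure]_(y in `[s, t]) (c / (t - s))%:E.
  rewrite integral_cst//= lebesgue_measure_itv/= lte_fin st -EFinB -EFinM.
  by rewrite divfK// gt_eqF// subr_gt0.
rewrite cE; apply: ge0_le_integral => //.
- by move=> ? _; rewrite lee_fin; apply: divr_ge0; [exact: normr_ge0|rewrite subr_ge0 ltW].
- exact: (@pclamp_measurable _ _ p _ _ bKg).
move=> y /=; rewrite in_itv/= => /andP[sy yt].
rewrite lee_fin ler_pdivrMr ?subr_gt0//.
have dst : (mdist (pclamp p s) (pclamp p t) <= t - s)%R.
  by rewrite (le_trans (pclamp_lip _ _ _))// distrC ger0_norm// subr_ge0 ltW.
have dsy : (mdist (pclamp p s) (pclamp p y) <= y - s)%R.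
  by rewrite (le_trans (pclamp_lip _ _ _))// distrC ger0_norm// subr_ge0.
have := @lip (pclamp p s) (pclamp p t) (pclamp p y).
rewrite (le_lt_trans dst) ?(le_lt_trans dsy); [|lra..].
move=> /(_ isT isT)/le_trans; apply.
by rewrite -!mulrA ler_wpM2l// mulrC ler_wpM2l.
Qed.

End local_lipschitz.

Lemma sum_measure_seq d (T : measurableType d) (R : realType)
  (m : {measure set T -> \bar R}) (I : choiceType) (l : seq I) (F : I -> set T) :
  uniq l -> (forall i, measurable (F i)) -> trivIset [set` l] F ->
  (\sum_(i <- l) m (F i) = m (\bigcup_(i in [set` l]) F i))%E.
Proof. by move=> ul mF tF; rewrite measure_fin_bigcup// fsbig_seq. Qed.

(** * Separated sets, quasi-lattices and separability *)

Section nets.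
Variables (R : realType) (X : pmetricType R).
Implicit Types (x y : X) (r : R) (A G : set X).

Lemma card_le_seqP (A : set X) (n : nat) : (A #<= `I_n)%card <->
  forall s : seq X, uniq s -> (forall x, x \in s -> A x) -> (size s <= n)%N.
Proof.
split=> [An s us sA|H].
  apply: leq_trans (geq_card_fset_set An).
  apply: uniq_leq_size => // x /sA Ax.
  by rewrite in_fset_set ?inE//; apply/finite_set_leP; exists n.
have fA : finite_set A.
  apply: contrapT => /(infinite_set_fset n.+1)[B BA].
  by rewrite leqNgt ltnS H ?finmap.fset_uniq// => ? /BA.
rewrite -(fset_setK fA).
rewrite (card_le_eql (_ : _ #= `I_(size (finmap.enum_fset (fset_set A))))%card).
  rewrite card_le_II H// => [|x]; first exact: finmap.fset_uniq.
  by rewrite in_fset_set// inE.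
exact/card_eq_fsetP.
Qed.

Definition separated r A := forall x y, A x -> A y -> x <> y -> r <= mdist x y.

(** A point at distance at least r from every point of a maximal separated set could be added to
    it. *)
Lemma maximal_separated_set r : 0 < r ->
  exists2 G, separated r G & forall x, exists2 y, G y & mdist x y < r.
Proof.
move=> r0; have [|G [sG maxG]] := @Zorn_bigcup X (separated r).
  move=> F FP tot x y [A FA Ax] [B FB By] xy.
  have [AB|BA] := tot _ _ FA FB.
    by apply: (FP _ FB) => //; exact: AB.
  by apply: (FP _ FA) => //; exact: BA.
exists G => // x; apply: contrapT => nx.
have far y : G y -> r <= mdist x y.
  by move=> Gy; rewrite leNgt; apply/negP => xy; apply: nx; exists y.
have nGx : ~ G x by move=> /far; rewrite mdistxx leNgt r0.
apply: (maxG (x |` G)).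
  by split; [move=> y Gy; right|move=> /(_ x (or_introl erefl))].
move=> y z [->|Gy] [->|Gz] // yz; [exact: far|rewrite metric_sym; exact: far|].
exact: sG.
Qed.

Variable mu : {outer_measure set X -> \bar R}.
Hypothesis mms : metric_measure_space mu.
Hypothesis unif : uniform_measure mu.

Lemma measurable_ball_cara x r : measurable (ball x r : set (caratheodory_type mu)).
Proof. exact/(open_measurable_cara mms)/metric_ball_open. Qed.

(** Packing: the balls of radius r / 2 around the points of G in a ball of radius s are disjoint,
    have measure at least [f (r / 2)] and lie in a ball of radius s + r / 2. *)
Lemma separated_uniformly_locally_finite r G : 0 < r -> separated r G ->
  uniformly_locally_finite G.
Proof.
move=> r0 sG; have [f [g [fg0 fg_mono fgmu]]] := unif.
pose r2 := r / 2; have r20 : 0 < r2 by rewrite divr_gt0.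
exists (fun s => Num.truncn (g (s + r2) / f r2)) => x s s0.
apply/card_le_seqP => l ul lG.
have [f0 _] := fg0 _ r20.
rewrite truncn_ge_nat; last by rewrite divr_ge0// ltW// (fg0 _ _).2// addr_gt0.
rewrite ler_pdivlMr//.
have : (\sum_(y <- l) (f r2)%:E <= (g (s + r2))%:E)%E.
  apply: (@le_trans _ _ (\sum_(y <- l) cara_measure mu (ball y r2 : set (caratheodory_type mu))))%E.
    by apply: lee_sum => y _; have /andP[] := fgmu y r2 r20.
  apply: le_trans (_ : (mu (ball x (s + r2)) <= _)%E); last first.
    by have /andP[] := fgmu x (s + r2) (addr_gt0 s0 r20).
  have tl : trivIset [set` l] (fun y => ball y r2).
    move=> y z /= yl zl [w]; rewrite !ballEmdist => -[/= yw zw].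
    apply: contrapT => yz; have := sG y z (lG y yl).1 (lG z zl).1 yz.
    have := metric_triangle y w z; rewrite (metric_sym w) /r2.
    by move: yw zw; rewrite /r2; lra.
  have -> : (\sum_(y <- l) cara_measure mu (ball y r2 : set (caratheodory_type mu)) =
      cara_measure mu (\bigcup_(y in [set` l]) (ball y r2 : set (caratheodory_type mu))))%E.
    apply: (@sum_measure_seq _ (caratheodory_type mu)) => // y.
    exact: measurable_ball_cara.
  apply: le_outer_measure => y [z /= /lG [_]]; rewrite !ballEmdist /= => xz zy.
  by apply: le_lt_trans (metric_triangle x z y) _; exact: ltrD.
by rewrite sumEFin lee_fin big_const_seq count_predT iter_addr_0 mulr_natl.
Qed.

Lemma exists_quasi_lattice r : 0 < r ->
  exists G : set X, [/\ quasi_lattice G, separated r G &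
    forall x, exists2 y, G y & mdist x y < r].
Proof.
move=> r0; have [G sG cG] := maximal_separated_set r0.
exists G; split => //; split; first by exists r.
exact: separated_uniformly_locally_finite sG.
Qed.

Lemma uniformly_locally_finite_countable G : uniformly_locally_finite G -> countable G.
Proof.
move=> [N GN]; rewrite (_ : G = \bigcup_(n : nat) (G `&` ball (point : X) n.+1%:R)).
  apply: bigcup_countable; first exact: countableP.
  move=> n _; apply: finite_set_countable; apply/finite_set_leP.
  by exists (N n.+1%:R); apply: GN.
apply/seteqP; split=> [x Gx|x [n _ []]//].
exists (Num.truncn (mdist (point : X) x)) => //; split => //.
by rewrite ballEmdist /=; apply: truncnS_gt.
Qed.

(** The union of quasi-lattices of spacing 1 / (n + 1) is countable and dense. *)
Lemma countable_dense_sequence : exists e : nat -> X, forall x r, 0 < r ->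
  exists i, mdist x (e i) < r.
Proof.
have /choice[G GP] : forall n : nat, exists G : set X, quasi_lattice G /\
    forall x, exists2 y, G y & mdist x y < n.+1%:R^-1.
  move=> n; have [|G [qG _ cG]] := @exists_quasi_lattice n.+1%:R^-1.
    by rewrite invr_gt0.
  by exists G.
have cU : countable (\bigcup_n G n).
  apply: bigcup_countable; first exact: countableP.
  by move=> n _; apply: uniformly_locally_finite_countable; case: (GP n) => -[].
have [U0|[e]] := pfcard_geP cU.
  have [y Gy _] := (GP 0%N).2 point.
  by have : (\bigcup_n G n) y by [exists 0%N]; rewrite U0.
exists e => x r r0; have [n nr] := ltr_add_invr r0.
have [y Gy xy] := (GP n).2 x.
have [i _ ei] : (e @` setT) y by apply: (@surj _ _ _ _ e); exists n.
by exists i; rewrite ei (lt_trans xy)//; move: nr; rewrite add0r.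
Qed.

(** By separability, countably many balls on which g has finite integral cover X. *)
Lemma modulus1_path_integral_pinfty_loc (g : X -> \bar R) :
  borel_fun g -> (forall x, 0 <= g x)%E -> locally_integrable_fun mu g ->
  modulus1 mu [set p | path_integral p g = +oo%E] = 0%E.
Proof.
move=> bg g0 lg; have [e eP] := countable_dense_sequence.
(* The index n codes a centre and a radius; codes without meaning and balls with infinite integral
   give the empty set. *)
pose B (n : nat) : set X := if unpickle n is Some (i, m) then
  (if pselect (integral_on mu (ball (e i) (m.+1%:R^-1)) g < +oo)%E
   then ball (e i) (m.+1%:R^-1) else set0) else set0.
apply: (@modulus1_path_integral_pinfty_cover _ _ _ mms _ B) => //.
- move=> n; rewrite /B; case: (unpickle n) => [[i m]|]; last exact: open0.
  by case: pselect => ? /=; [exact: metric_ball_open|exact: open0].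
- move=> x; have [r r0 xr] := lg x.
  have [m mr] := ltr_add_invr (divr_gt0 r0 (ltr0Sn _ 1)); rewrite add0r in mr.
  have [|i xi] := eP x m.+1%:R^-1; first by rewrite invr_gt0.
  exists (pickle (i, m)); rewrite /B pickleK.
  case: pselect => [? /=|[]]; first by rewrite ballEmdist /= metric_sym.
  have sub : ball (e i) m.+1%:R^-1 `<=` ball x r.
    move=> y; rewrite !ballEmdist /= => iy.
    apply: le_lt_trans (metric_triangle x (e i) y) _.
    by rewrite [r]splitr ltrD// (lt_trans _ mr).
  have oB := metric_ball_open x r.
  have /(integrable_onP mms oB bg g0) := xr; apply: le_lt_trans.
  apply: ge0_subset_integral => //; try exact: measurable_ball_cara.
  by apply: measurable_funTS; exact: borel_fun_measurable.
- move=> n; rewrite /B; case: (unpickle n) => [[i m]|]; last first.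
    by rewrite /integral_on integral_set0 ltry.
  by case: pselect => ? /=; rewrite /integral_on ?integral_set0 ?ltry.
Qed.

End nets.

(** * Isoperimetry and flows *)

Section hahn_banach.
Variables (R : realType) (E : Type).
Implicit Types (u v : E -> R) (a r t : R) (G : set ((E -> R) * R)).

Definition lincomb a u v : E -> R := fun e => a * u e + v e.

Variables (S : set (E -> R)) (p : (E -> R) -> R).
Hypothesis S_lin : forall a u v, S u -> S v -> S (lincomb a u v).
Hypothesis p_add : forall u v, S u -> S v -> p (fun e => u e + v e) <= p u + p v.
Hypothesis p_scale : forall a u, 0 < a -> S u -> p (fun e => a * u e) = a * p u.

(* The graph of a linear functional dominated by p on a subspace of S. *)
Let dominated_graph G :=
  [/\ forall a u v r s, G (u, r) -> G (v, s) -> G (lincomb a u v, a * r + s),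
      forall u r, G (u, r) -> S u & forall u r, G (u, r) -> r <= p u].

Variable G0 : set ((E -> R) * R).
Hypothesis G0_dom : dominated_graph G0.
Hypothesis G00 : G0 (fun=> 0, 0).

Let S0 : S (fun=> 0). Proof. by case: G0_dom => _ /(_ _ _ G00). Qed.

Let S_scale a u : S u -> S (fun e => a * u e).
Proof.
move=> Su; rewrite (_ : (fun _ => _) = lincomb a u (fun=> 0)); first exact: S_lin.
by apply/funext => e; rewrite /lincomb addr0.
Qed.

(** A value al for v0 must respect the bound p on u + v0 and on u - v0. Subadditivity leaves room
    for it, and homogeneity reduces all other multiples of v0 to these two. *)
Let extension G v0 : dominated_graph G -> G (fun=> 0, 0) -> S v0 ->
  exists al, forall u r, G (u, r) ->
    r - al <= p (lincomb (-1) v0 u) /\ r + al <= p (lincomb 1 v0 u).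
Proof.
move=> [Glin GS Gp] G0_ Sv0.
have le u r v s : G (u, r) -> G (v, s) ->
    r - p (lincomb (-1) v0 u) <= p (lincomb 1 v0 v) - s.
  move=> Gu Gv; rewrite lerBlDr addrAC lerBrDr.
  have := Gp _ _ (Glin 1 _ _ _ _ Gu Gv); rewrite mul1r => /le_trans; apply.
  have := p_add (S_lin (-1) Sv0 (GS _ _ Gu)) (S_lin 1 Sv0 (GS _ _ Gv)).
  rewrite addrC; congr (p _ <= _); apply/funext => e; rewrite /lincomb; ring.
pose B := [set x | exists u r, G (u, r) /\ x = r - p (lincomb (-1) v0 u)].
have hB : has_sup B.
  split; first by exists (0 - p (lincomb (-1) v0 (fun=> 0))), (fun=> 0), 0.
  by exists (p (lincomb 1 v0 (fun=> 0)) - 0) => _ [u [r [Gu ->]]]; exact: le.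
exists (sup B) => u r Gu; split.
  rewrite lerBlDr addrC -lerBlDr; apply: ub_le_sup hB.2 _ _.
  by exists u, r.
rewrite addrC -lerBrDr; apply: ge_sup; first exact: hB.1.
by move=> _ [u' [r' [Gu' ->]]]; exact: le.
Qed.

(** Functionals defined on a subspace are encoded by their graphs, ordered by inclusion. The ambient
    subspace S is there because the norm used later is a sum that has its meaning for finitely
    supported functions. *)
Lemma hahn_banach : exists f : (E -> R) -> R,
  [/\ forall a u v, S u -> S v -> f (lincomb a u v) = a * f u + f v,
      forall u, S u -> f u <= p u & forall u r, G0 (u, r) -> f u = r].
Proof.
pose P G := G = set0 \/ (G0 `<=` G /\ dominated_graph G).
have [|G [PG maxG]] := @Zorn_bigcup _ P.
  move=> F FP tot; have [none|] := pselect (forall A, F A -> A = set0).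
    by left; apply/seteqP; split=> // x [A /none ->].
  move=> /existsNP[A0 /not_implyP[FA0 A00]]; right.
  have [//|[G0A0 _]] := FP _ FA0; split; first by move=> x /G0A0 A0x; exists A0.
  have dom A x : F A -> A x -> dominated_graph A.
    by move=> FA Ax; case: (FP _ FA) => [A_|[]//]; rewrite A_ in Ax.
  split.
  - move=> a u v r s [A FA Au] [B FB Bv].
    have [AB|BA] := tot _ _ FA FB.
      exists B => //; have [lin _ _] := dom _ _ FB Bv; apply: lin => //; exact: AB.
    exists A => //; have [lin _ _] := dom _ _ FA Au; apply: lin => //; exact: BA.
  - by move=> u r [A FA Au]; have [_ AS _] := dom _ _ FA Au; exact: AS Au.
  - by move=> u r [A FA Au]; have [_ _ Ap] := dom _ _ FA Au; exact: Ap Au.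
have [G0G domG] : G0 `<=` G /\ dominated_graph G.
  case: PG => // G_0; exfalso; have lt : G `<` G0.
    by rewrite G_0; split => // /(_ _ G00).
  by apply: (maxG G0 lt); right; split.
have [Glin GS Gp] := domG.
have G_0 : G (fun=> 0, 0) by exact: G0G.
have p0 : p (fun=> 0) = 0.
  have := p_scale (ltr0Sn _ 1) S0; rewrite (_ : (fun _ => _) = (fun=> 0)); last first.
    by apply/funext => e; rewrite mulr0.
  by lra.
have Gscale a u r : G (u, r) -> G (fun e => a * u e, a * r).
  move=> Gu; have := Glin a _ _ _ _ Gu G_0; rewrite addr0.
  by congr (G (_, _)); apply/funext => e; rewrite /lincomb addr0.
have total v0 : S v0 -> exists r, G (v0, r).
  move=> Sv0; apply: contrapT => nG.
  have [al alP] := extension domG G_0 Sv0.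
  pose G' := [set ur | exists a v s, G (v, s) /\ ur = (lincomb a v0 v, a * al + s)].
  have lt : G `<` G'.
    split.
      move=> [u r] Gu; exists 0, u, r; split=> //; rewrite mul0r add0r; congr (_, _).
      by apply/funext => e; rewrite /lincomb mul0r add0r.
    move=> G'G; apply: nG; exists al; apply: G'G; exists 1, (fun=> 0), 0; split=> //.
    rewrite mul1r addr0; congr (_, _).
    by apply/funext => e; rewrite /lincomb mul1r addr0.
  apply: (maxG G' lt); right; split.
    move=> [u r] /G0G Gu; exists 0, u, r; split=> //; rewrite mul0r add0r; congr (_, _).
    by apply/funext => e; rewrite /lincomb mul0r add0r.
  split.
  - move=> a u v r s [a1 [v1 [s1 [Gv1 [-> ->]]]]] [a2 [v2 [s2 [Gv2 [-> ->]]]]].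
    exists (a * a1 + a2), (lincomb a v1 v2), (a * s1 + s2); split; first exact: Glin.
    by congr (_, _); [apply/funext => e; rewrite /lincomb|]; ring.
  - by move=> u r [a [v [s [Gv [-> _]]]]]; apply: S_lin => //; exact: GS Gv.
  move=> u r [a [v [s [Gv [-> ->]]]]].
  have [a0|a0|->] := ltgtP a 0; last first.
  - rewrite mul0r add0r (_ : lincomb 0 v0 v = v); first exact: Gp.
    by apply/funext => e; rewrite /lincomb mul0r add0r.
  - have [_] := alP _ _ (Gscale a^-1 _ _ Gv).
    rewrite (_ : lincomb a v0 v = fun e => a * lincomb 1 v0 (fun e => a^-1 * v e) e); last first.
      by apply/funext => e; rewrite /lincomb mul1r mulrDr mulrA divff ?mul1r// gt_eqF.
    rewrite p_scale//; last by apply: S_lin => //; apply: S_scale; exact: GS Gv.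
    by rewrite -(ler_pM2l a0) mulrDr mulrA divff ?gt_eqF// mul1r addrC.
  - have na0 : 0 < - a by rewrite oppr_gt0.
    have [+ _] := alP _ _ (Gscale (- a)^-1 _ _ Gv).
    rewrite (_ : lincomb a v0 v = fun e => - a * lincomb (-1) v0 (fun e => (- a)^-1 * v e) e); last first.
      by apply/funext => e; rewrite /lincomb; field; rewrite lt_eqF.
    rewrite p_scale//; last by apply: S_lin => //; apply: S_scale; exact: GS Gv.
    by rewrite -(ler_pM2l na0) mulrBr mulrA divff ?gt_eqF// mul1r mulNr opprK addrC.
(* A dominated graph is single-valued: it contains (0, r - s), and p vanishes at 0. *)
have uniq u r s : G (u, r) -> G (u, s) -> r <= s.
  move=> Gur Gus; have := Gp _ _ (Glin (-1) _ _ _ _ Gus Gur).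
  rewrite (_ : lincomb _ _ _ = (fun=> 0)); last first.
    by apply/funext => e; rewrite /lincomb mulN1r addNr.
  by rewrite p0; lra.
pose f u := xget 0 [set r | G (u, r)].
have fG u r : G (u, r) -> f u = r.
  move=> Gur; rewrite /f; case: xgetP => [s _ /= Gus|/(_ r)//].
  by apply/eqP; rewrite eq_le !(uniq u).
exists f; split.
- move=> a u v /total[r Gu] /total[s Gv].
  by rewrite (fG _ _ Gu) (fG _ _ Gv); apply: fG; exact: Glin.
- by move=> u /total[r Gu]; rewrite (fG _ _ Gu); exact: Gp Gu.
- by move=> u r /G0G; exact: fG.
Qed.

End hahn_banach.

Section finitely_supported_sums.
Variables (R : realType) (I : choiceType).
Implicit Types (F : I -> R) (l : seq I).

Lemma fsum_seq F l : uniq l -> (forall i, i \notin l -> F i = 0) ->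
  \sum_(i \in [set: I]) F i = \sum_(i <- l) F i.
Proof.
move=> ul Fl; rewrite [RHS]fsbig_seq//; apply/esym/fsbig_widen => // i [_ /= il].
by apply: Fl; apply/negP.
Qed.

End finitely_supported_sums.

Lemma seq_argmin (R : realType) (T : eqType) (phi : T -> R) (F : seq T) : F != [::] ->
  exists2 y, y \in F & forall z, z \in F -> phi y <= phi z.
Proof.
elim: F => // x [|x' F] ih _.
  by exists x; rewrite ?inE// => z; rewrite inE => /eqP ->.
have [//|y yF ymin] := ih.
have [xy|yx] := leP (phi x) (phi y).
  exists x; rewrite ?mem_head// => z; rewrite inE => /orP[/eqP->//|/ymin].
  exact: le_trans.
exists y; first by rewrite inE yF orbT.
by move=> z; rewrite inE => /orP[/eqP->|/ymin//]; exact: ltW.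
Qed.

Section isoperimetry.
Variables (R : realType) (T : choiceType) (nb : T -> seq T) (W : T -> T -> R).
Hypothesis nb_uniq : forall x, uniq (nb x).
Hypothesis nb_sym : forall x y, (y \in nb x) = (x \in nb y).
Hypothesis W0 : forall x y, 0 <= W x y.
Hypothesis iso : forall F : seq T, uniq F ->
  (size F)%:R <= \sum_(y <- F) \sum_(z <- nb y | z \notin F) W y z.
Implicit Types (F : seq T) (phi : T -> R).

(* Induction on the support: the least value of phi on F is split off. *)
Lemma isoperimetric_layer_cake phi F : uniq F -> (forall y, 0 <= phi y) ->
  (forall y, y \notin F -> phi y = 0) ->
  \sum_(y <- F) phi y <=
  \sum_(y <- F) \sum_(z <- nb y) W y z * Num.max 0 (phi y - phi z).
Proof.
have [n] := ubnP (size F); elim: n => // n ih in phi F *.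
move=> szF uF phi0 phiF.
have [->|FN0] := eqVneq F [::]; first by rewrite !big_nil.
have [y0 y0F y0min] := seq_argmin phi FN0.
pose m := phi y0; pose F' := rem y0 F.
(* Subtracting the minimum on F keeps the function nonnegative and removes y0 from its support. *)
pose phi' y := if y \in F then phi y - m else 0.
have phi'0 y : 0 <= phi' y.
  by rewrite /phi'; case: ifPn => // yF; rewrite subr_ge0 y0min.
have phi'y0 : phi' y0 = 0 by rewrite /phi' y0F subrr.
have pF : perm_eq F (y0 :: F') by exact: perm_to_rem.
have sumF' (f : T -> R) : \sum_(y <- F) f y = f y0 + \sum_(y <- F') f y.
  by rewrite (perm_big _ pF) big_cons.
have IH : \sum_(y <- F') phi' y <=
    \sum_(y <- F') \sum_(z <- nb y) W y z * Num.max 0 (phi' y - phi' z).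
  apply: ih => //; first by rewrite size_rem//; case: (F) szF FN0.
    exact: rem_uniq.
  move=> y; rewrite mem_rem_uniq// inE negb_and negbK => /orP[/eqP->//|yF].
  by rewrite /phi' (negbTE yF).
(* Edges inside F keep their difference, while each edge leaving F loses exactly m; the hypothesis
   [iso] for F pays for m times the size of F. *)
have term y : y \in F -> \sum_(z <- nb y) W y z * Num.max 0 (phi y - phi z) =
    m * (\sum_(z <- nb y | z \notin F) W y z) +
    \sum_(z <- nb y) W y z * Num.max 0 (phi' y - phi' z).
  move=> yF; rewrite [X in m * X]big_mkcond/= mulr_sumr -big_split/=.
  apply: eq_bigr => z _; rewrite /phi' yF.
  case: (boolP (z \in F)) => zF /=.
    by rewrite mulr0 add0r; congr (_ * Num.max 0 _); lra.
  rewrite (phiF _ zF) !subr0 (max_idPr (phi0 y)) (max_idPr _) ?subr_ge0 ?y0min//.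
  ring.
have -> : \sum_(y <- F) phi y = m * (size F)%:R + \sum_(y <- F') phi' y.
  have -> : \sum_(y <- F) phi y = \sum_(y <- F) (m + phi' y).
    by rewrite big_seq [RHS]big_seq; apply: eq_bigr => y yF; rewrite /phi' yF; lra.
  rewrite big_split/= (sumF' phi') phi'y0 add0r; congr (_ + _).
  by rewrite big_const_seq count_predT iter_addr_0 mulr_natr.
rewrite [leRHS]big_seq (eq_bigr _ term) -big_seq big_split/= -mulr_sumr.
apply: lerD; first by apply: ler_wpM2l; [exact: phi0|exact: iso].
apply: (le_trans IH); rewrite sumF' lerDr.
by apply: sumr_ge0 => z _; rewrite mulr_ge0// le_max lexx.
Qed.

Definition finitely_supported (I : choiceType) (u : I -> R) : Prop :=
  exists2 l : seq I, uniq l & forall i, i \notin l -> u i = 0.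

Lemma finitely_supported2 (I : choiceType) (u v : I -> R) :
  finitely_supported u -> finitely_supported v ->
  exists2 l : seq I, uniq l & forall i, i \notin l -> u i = 0 /\ v i = 0.
Proof.
move=> [l1 _ u0] [l2 _ v0]; exists (undup (l1 ++ l2)); first exact: undup_uniq.
move=> i; rewrite mem_undup mem_cat negb_or => /andP[i1 i2].
by rewrite u0// v0.
Qed.

(** The coboundary of phi, up to sign, on the graph with neighbour lists [nb]. *)
Definition edge_diff (phi : T -> R) (e : T * T) : R :=
  if e.2 \in nb e.1 then phi e.1 - phi e.2 else 0.

(** A weighted l^1 norm on finitely supported u; on infinite supports the sum has a default
    value. *)
Definition edge_norm (u : T * T -> R) : R :=
  \sum_(e \in [set: T * T]) `|u e| * W e.1 e.2.

Lemma edge_normE u (l : seq (T * T)) : uniq l -> (forall e, e \notin l -> u e = 0) ->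
  edge_norm u = \sum_(e <- l) `|u e| * W e.1 e.2.
Proof. by move=> ul u0; apply: fsum_seq => // e /u0 ->; rewrite normr0 mul0r. Qed.

Definition edges_from F : seq (T * T) := [seq (y, z) | y <- F, z <- nb y].

Lemma edges_from_uniq F : uniq F -> uniq (edges_from F).
Proof.
move=> uF; apply: allpairs_uniq_dep => //.
by move=> [y z] [y' z'] _ _ /= [-> ->].
Qed.

Lemma mem_edges_from F y z : ((y, z) \in edges_from F) = (y \in F) && (z \in nb y).
Proof.
apply/allpairsPdep/andP => [[y' [z' [yF zy [-> ->]]]]//|[yF zy]].
by exists y, z.
Qed.

(** Differences are nonzero also on edges entering F, hence the reversed edges. *)
Lemma edge_diff_supp F phi : (forall y, y \notin F -> phi y = 0) ->
  forall e, e \notin undup (edges_from F ++ map (fun e => (e.2, e.1)) (edges_from F)) ->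
    edge_diff phi e = 0.
Proof.
move=> phi0 [y z]; rewrite mem_undup mem_cat negb_or => /andP[yz zy].
rewrite /edge_diff /=; case: ifPn => // zy'.
rewrite mem_edges_from zy' andbT in yz.
have zF : z \notin F.
  apply: contra zy => zF; apply/mapP; exists (z, y) => //.
  by rewrite mem_edges_from zF -nb_sym.
by rewrite !phi0// subrr.
Qed.

(** The layer cake inequality is applied to the positive part of phi, whose sum is larger and whose
    positive differences are at most the absolute differences of phi. *)
Lemma sum_le_edge_norm F phi : uniq F -> (forall y, y \notin F -> phi y = 0) ->
  \sum_(y <- F) phi y <= edge_norm (edge_diff phi).
Proof.
move=> uF phi0.
rewrite (edge_normE (undup_uniq _) (edge_diff_supp phi0)).
set l := undup _.
have sub : {subset edges_from F <= l} by move=> e eF; rewrite mem_undup mem_cat eF.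
rewrite (bigID [in edges_from F])/= ler_wpDr//.
  by apply: sumr_ge0 => e _; rewrite mulr_ge0.
rewrite -[leRHS]big_filter [leRHS](perm_big (edges_from F)); last first.
  apply: uniq_perm; [by apply: filter_uniq; exact: undup_uniq|exact: edges_from_uniq|].
  move=> e; rewrite mem_filter; case: (boolP (e \in edges_from F)) => //= eF.
  exact: sub.
rewrite big_allpairs_dep/=.
pose psi y := Num.max 0 (phi y).
have psi0 y : 0 <= psi y by rewrite /psi le_max lexx.
apply: (@le_trans _ _ (\sum_(y <- F) psi y)).
  by apply: ler_sum => y _; rewrite /psi le_max lexx orbT.
apply: le_trans (isoperimetric_layer_cake uF psi0 _) _.
  by move=> y yF; rewrite /psi phi0// maxxx.
apply: ler_sum => y _; rewrite big_seq [leRHS]big_seq; apply: ler_sum => z zy.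
rewrite /edge_diff /= zy mulrC ler_wpM2r// ge_max normr_ge0/= /psi.
have := ler_norm (phi y - phi z); have := normr_ge0 (phi y - phi z).
by case: (leP 0 (phi y)) => hy; case: (leP 0 (phi z)) => hz n0 n; lra.
Qed.

(* The functional mapping edge_diff phi to the sum of phi is dominated by
   edge_norm; the flow consists of the values on single edges of an extension. *)
Lemma exists_unit_flow : exists c : T -> T -> R,
  [/\ forall y z, c z y = - c y z, forall y z, `|c y z| <= W y z + W z y,
      forall y z, z \notin nb y -> c y z = 0 &
      forall y, \sum_(z <- nb y) c y z = 1].
Proof.
pose S := @finitely_supported (T * T)%type.
have S_lin a u v : S u -> S v -> S (lincomb a u v).
  move=> Su Sv; have [l ul l0] := finitely_supported2 Su Sv.
  by exists l => // e /l0[ue ve]; rewrite /lincomb ue ve mulr0 addr0.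
have N_add u v : S u -> S v -> edge_norm (fun e => u e + v e) <= edge_norm u + edge_norm v.
  move=> Su Sv; have [l ul l0] := finitely_supported2 Su Sv.
  rewrite !(edge_normE ul) => [|e /l0[]//|e /l0[]//|e /l0[-> ->]]; last by rewrite addr0.
  rewrite -big_split/=; apply: ler_sum => e _.
  by rewrite -mulrDl ler_wpM2r// ler_normD.
have N_scale a u : 0 < a -> S u -> edge_norm (fun e => a * u e) = a * edge_norm u.
  move=> a0 [l ul l0].
  rewrite !(edge_normE ul) => [|//|e /l0->]; last by rewrite mulr0.
  rewrite mulr_sumr; apply: eq_bigr => e _.
  by rewrite normrM gtr0_norm// mulrA.
pose G0 := [set ur | exists phi : T -> R, finitely_supported phi /\
  ur = (edge_diff phi, \sum_(y \in [set: T]) phi y)].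
have S_edge phi : finitely_supported phi -> S (edge_diff phi).
  by move=> [F uF phi0]; exists (undup (edges_from F ++ map (fun e => (e.2, e.1)) (edges_from F)));
    [exact: undup_uniq|exact: edge_diff_supp].
have [||f [f_lin f_le f_G0]] := @hahn_banach R (T * T)%type S edge_norm S_lin N_add N_scale G0.
- split.
  + move=> a u v r s [phi [Sphi [-> ->]]] [psi [Spsi [-> ->]]].
    have [F uF F0] := finitely_supported2 Sphi Spsi.
    exists (fun y => a * phi y + psi y); split.
      by exists F => // y /F0[-> ->]; rewrite mulr0 addr0.
    congr (_, _).
      apply/funext => e; rewrite /lincomb /edge_diff; case: ifP => _; ring.
    rewrite !(fsum_seq uF) => [|y /F0[]//|y /F0[]//|y /F0[-> ->]]; last by rewrite mulr0 addr0.
    by rewrite mulr_sumr -big_split.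
  + by move=> u r [phi [Sphi [-> _]]]; exact: S_edge.
  + move=> u r [phi [[F uF F0] [-> ->]]].
    by rewrite (fsum_seq uF)// sum_le_edge_norm.
- exists (fun=> 0); split; first by exists [::].
  congr (_, _); last by rewrite fsbig1.
  by apply/funext => e; rewrite /edge_diff subrr if_same.
pose delta (e : T * T) : T * T -> R := fun e' => (e' == e)%:R.
have S_delta e : S (delta e).
  by exists [:: e] => // e'; rewrite inE /delta => /negbTE ->.
have N_delta e : edge_norm (delta e) = W e.1 e.2.
  rewrite (@edge_normE _ [:: e])// => [|e'].
    by rewrite big_seq1 /delta eqxx normr1 mul1r.
  by rewrite inE /delta => /negbTE ->.
have S0 : S (fun=> 0) by exists [::].
have f0 : f (fun=> 0) = 0.
  have := f_lin 1 _ _ S0 S0; rewrite (_ : lincomb _ _ _ = (fun=> 0)); first by lra.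
  by apply/funext => e; rewrite /lincomb mulr0 addr0.
have f_delta e : `|f (delta e)| <= W e.1 e.2.
  rewrite ler_norml -{2}N_delta f_le ?andbT//.
  rewrite lerNl -(N_delta e).
  have := f_lin (-1) _ _ (S_delta e) S0; rewrite f0 addr0 mulN1r => <-.
  apply: le_trans (f_le _ (S_lin _ _ _ (S_delta e) S0)) _.
  rewrite le_eqVlt; apply/orP; left; apply/eqP.
  by apply: eq_fsbigr => e' _; rewrite /lincomb addr0 mulN1r normrN.
pose c0 y z := f (delta (y, z)).
(* Antisymmetrizing the values of f on single edges costs the second summand in the bound W y z + W
   z y. *)
exists (fun y z => if z \in nb y then c0 y z - c0 z y else 0); split.
- by move=> y z; rewrite nb_sym; case: ifP => _; rewrite ?oppr0// opprB.
- move=> y z; case: ifP => _; last by rewrite normr0 addr_ge0.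
  by rewrite (le_trans (ler_normB _ _))// lerD//; apply: (f_delta (_, _)).
- by move=> y z /negbTE ->.
move=> x.
(* The indicator of x has sum 1, and its differences are 1 on edges leaving x and -1 on edges
   entering x. Evaluating f on them gives the flux of c at x; a loop at x cancels. *)
pose dx y : R := (y == x)%:R.
have Sdx : finitely_supported dx.
  by exists [:: x] => // y; rewrite inE /dx => /negbTE ->.
have : f (edge_diff dx) = 1.
  apply: f_G0; exists dx; split; first exact: Sdx.
  congr (_, _).
  rewrite (@fsum_seq _ _ dx [:: x])// ?big_seq1 /dx ?eqxx// => y.
  by rewrite inE => /negbTE ->.
have f_sum (l : seq T) : f (fun e => \sum_(z <- l) (delta (x, z) e - delta (z, x) e)) =
      \sum_(z <- l) (c0 x z - c0 z x) /\
    S (fun e => \sum_(z <- l) (delta (x, z) e - delta (z, x) e)).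
  elim: l => [|z l [fl Sl]].
    by under eq_fun do rewrite big_nil; rewrite big_nil f0.
  have SS := S_lin (-1) _ _ (S_delta (z, x)) Sl.
  rewrite (_ : (fun e => _) = lincomb 1 (delta (x, z)) (lincomb (-1) (delta (z, x))
     (fun e => \sum_(z <- l) (delta (x, z) e - delta (z, x) e)))); last first.
    by apply/funext => e; rewrite big_cons /lincomb; ring.
  split; last exact: S_lin.
  by rewrite !f_lin// fl big_cons /c0; ring.
have -> : edge_diff dx = fun e => \sum_(z <- nb x) (delta (x, z) e - delta (z, x) e).
  apply/funext => -[a b]; rewrite /edge_diff /= sumrB.
  have cnt (P : T -> bool) (y : T) (s : seq T) : uniq s -> P =1 pred1 y ->
      \sum_(z <- s) (P z)%:R = (y \in s)%:R :> R.
    move=> us Py; rewrite -natr_sum; congr (_%:R).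
    rewrite -(count_uniq_mem _ us) -sum1_count [RHS]big_mkcond; apply: eq_bigr => z _.
    by rewrite -Py; case: (P z).
  have -> : \sum_(z <- nb x) delta (x, z) (a, b) = if a == x then (b \in nb x)%:R else 0.
    rewrite /delta; under eq_bigr do rewrite xpair_eqE.
    case: eqVneq => _ /=; last by rewrite big1.
    by apply: cnt => // z /=; rewrite eq_sym.
  have -> : \sum_(z <- nb x) delta (z, x) (a, b) = if b == x then (a \in nb x)%:R else 0.
    rewrite /delta; under eq_bigr do rewrite xpair_eqE.
    case: (eqVneq b x) => _ /=; last by under eq_bigr do rewrite andbF; rewrite big1.
    by under eq_bigr do rewrite andbT; apply: cnt => // z /=; rewrite eq_sym.
  rewrite /dx; case: (eqVneq a x) => [->|ax]; case: (eqVneq b x) => [->|bx] /=.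
  - by rewrite !subrr if_same.
  - by rewrite !subr0; case: (b \in nb x).
  - by rewrite !sub0r nb_sym; case: (a \in nb x); rewrite ?oppr0.
  - by rewrite subrr if_same.
rewrite (f_sum _).1 => fx1; rewrite -[RHS]fx1 big_seq [RHS]big_seq.
by apply: eq_bigr => z ->.
Qed.

End isoperimetry.

(* Restated because lra does not identify the distances in the instances of
   metric_triangle and metric_sym with those in hypotheses. *)
Lemma mdist_triangleR (R : realType) (X : pmetricType R) (x y z : X) :
  mdist x z <= mdist x y + mdist y z.
Proof. exact: metric_triangle. Qed.

Lemma mdist_symR (R : realType) (X : pmetricType R) (x y : X) : mdist x y = mdist y x.
Proof. exact: metric_sym. Qed.

(** * Control functions, sums of indicators and Borel functions *)

Section control.
Variables (R : realType) (rho : R -> R).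
Hypothesis ctl : control_function rho.

Lemma control_ge1 t : 0 <= t -> 1 <= rho t.
Proof. by case: ctl => _ mono <- _ t0; exact: mono. Qed.

Lemma control_ge0 t : 0 <= t -> 0 <= rho t.
Proof. by move=> /control_ge1; exact: le_trans. Qed.

Lemma control_le s t : 0 <= s -> s <= t -> rho s <= rho t.
Proof. by case: ctl => _ mono _ _; exact: mono. Qed.

(** The defining inequality speaks of t > 0 only; taking the maximum with [rho e] covers t = 0,
    where rho is 1. *)
Lemma control_shift e : 0 < e -> exists2 L, 0 < L &
  forall s t, 0 <= s -> 0 <= t -> s <= e + t -> rho s <= L * rho t.
Proof.
move=> e0; case: (ctl) => _ mono rho0 [L [M LM]].
have [L0 _ Lt] := LM e e0.
exists (Num.max (L e) (rho e)); first by rewrite lt_max L0.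
move=> s t s0 t0 st; apply: (le_trans (mono _ _ s0 st)).
move: t0; rewrite le_eqVlt => /orP[/eqP <-|t0].
  by rewrite addr0 rho0 mulr1 le_max lexx orbT.
apply: (le_trans (Lt t t0).1); rewrite ler_wpM2r ?le_max ?lexx//.
exact/control_ge0/ltW.
Qed.

End control.

Lemma integral_sum_indic d (T : measurableType d) (R : realType)
    (m : {measure set T -> \bar R}) (I : Type) (l : seq I) (k : I -> R) (B : I -> set T) :
  (forall i, 0 <= k i) -> (forall i, measurable (B i)) ->
  (\int[m]_x (\sum_(i <- l) (k i * \1_(B i) x)%:E) = \sum_(i <- l) (k i)%:E * m (B i))%E.
Proof.
move=> k0 mB; rewrite ge0_integral_sum//.
- apply: eq_bigr => i _; under eq_integral do rewrite EFinM.
  rewrite ge0_integralZl_EFin//; last exact/measurable_EFinP.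
  by rewrite integral_indic// setIT.
- by move=> i; apply/measurable_EFinP/measurable_funM.
- by move=> i x _; rewrite lee_fin mulr_ge0.
Qed.

Lemma measurable_sum_indic d (T : measurableType d) (R : realType)
    (I : Type) (l : seq I) (k : I -> R) (B : I -> set T) (D : set T) :
  (forall i, measurable (B i)) ->
  measurable_fun D (fun x => \sum_(i <- l) (k i * \1_(B i) x)%:E)%E.
Proof.
move=> mB; apply: emeasurable_sum => i.
by apply/measurable_EFinP/measurable_funM => //; exact: measurable_indic.
Qed.

Section borel_functions.
Variables (R : realType) (X : pmetricType R).

Lemma continuous_borel_fun (u : X -> R) : continuous u -> borel_fun (EFin \o u).
Proof.
move=> cu; apply/measurable_EFinP.
apply: (@measurability _ _ (g_sigma_algebraType [set U : set X | open U])
  (measurableTypeR R) setT u _ (RGenOpens.measurableE R)) => //.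
move=> _ [_ [a [b ->] <-]]; rewrite setTI; apply: open_borel.
by move/continuousP : cu; apply; exact: interval_open.
Qed.

Lemma lipschitz_continuous_metric (u : X -> R) (K : R) :
  (forall x y, `|u x - u y| <= K * mdist x y) -> continuous u.
Proof.
move=> lip x; apply/cvgrPdist_lt => e e0.
have K0 : 0 < `|K| + 1 by rewrite ltr_wpDl.
apply/nbhs_ballP; exists (e / (`|K| + 1)) => /=; first exact: divr_gt0.
move=> y; rewrite ballEmdist /= ltr_pdivlMr// => xy.
apply: le_lt_trans (lip x y) _; apply: le_lt_trans xy.
rewrite mulrC ler_wpM2l ?mdist_ge0//.
by rewrite (le_trans (ler_norm K))// lerDl.
Qed.

Lemma borel_fun_dist (f : R -> R) (o : X) :
  (forall s t, 0 <= s -> s <= t -> f s <= f t) ->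
  borel_fun (fun x => (f (mdist o x))%:E).
Proof.
(* Monotonicity of f is given on nonnegative reals; clamping makes it global, hence measurable. *)
move=> mono; pose h t := f (Num.max 0 t).
have mh : measurable_fun [set: measurableTypeR R] (h : _ -> measurableTypeR R).
  apply: nondecreasing_measurable => // s t st.
  by apply: mono; [rewrite le_max lexx|rewrite ge_max !le_max lexx st orbT].
have md : measurable_fun [set: g_sigma_algebraType [set U : set X | open U]]
    ((mdist o) : _ -> measurableTypeR R).
  apply/measurable_EFinP; apply: continuous_borel_fun.
  apply: (@lipschitz_continuous_metric _ 1) => x y; rewrite mul1r ler_norml.
  have := metric_triangle o x y; have := metric_triangle o y x.
  by rewrite (metric_sym y x) => *; apply/andP; split; lra.
apply/measurable_EFinP; rewrite (_ : (fun _ => _) = h \o mdist o); first exact: measurableT_comp.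
by apply/funext => x /=; rewrite /h (max_idPr (mdist_ge0 _ _)).
Qed.

Lemma borel_fun_indic (A : set X) : borel_set A -> borel_fun (EFin \o (\1_A : X -> R)).
Proof.
move=> bA; apply/measurable_EFinP.
exact: (@measurable_indic _ (g_sigma_algebraType [set U : set X | open U])).
Qed.

End borel_functions.

Section lattice_neighbours.
Variables (R : realType) (X : pmetricType R) (G : set X).
Hypothesis ulf : uniformly_locally_finite G.

Lemma lattice_ball_seq (x : X) (r : R) : 0 < r ->
  exists2 l : seq G, uniq l & forall z : G, (z \in l) = (mdist x (\val z) < r).
Proof.
move=> r0; have [N GN] := ulf.
have /finite_seqP[s sE] : finite_set (G `&` ball x r).
  by apply/finite_set_leP; exists (N r); exact: GN.
exists (pmap insub (undup s)); first exact/pmap_sub_uniq/undup_uniq.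
move=> z; rewrite mem_pmap_sub mem_undup; apply/idP/idP => [zs|xz].
  have : [set` s] (\val z) by [].
  by rewrite -sE ballEmdist => -[].
have : (G `&` ball x r) (\val z) by split; [exact/set_mem/valP|rewrite ballEmdist].
by rewrite sE.
Qed.

Lemma lattice_count (N : R -> nat) (F : seq G) (x : X) (s : R) :
  (forall x r, 0 < r -> (G `&` ball x r #<= `I_(N r))%card) ->
  0 < s -> uniq F -> (count (fun y : G => (mdist x (\val y) < s)%R) F <= N s)%N.
Proof.
move=> GN s0 uF; rewrite -size_filter -(size_map \val).
have /card_le_seqP := GN x s s0; apply.
  by rewrite map_inj_uniq ?filter_uniq//; exact: val_inj.
move=> _ /mapP[y + ->]; rewrite mem_filter => /andP[xy _].
by split; [exact/set_mem/valP|rewrite ballEmdist].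
Qed.

End lattice_neighbours.

(** * From the Sobolev inequality to a flow *)

Section tent.
Variables (R : realType) (X : pmetricType R) (C : R).
Hypothesis C0 : 0 < C.
Implicit Types (x y : X) (F : seq X).

Definition ramp (t : R) : R := Num.max 0 (Num.min 1 (3 - t / C)).

Lemma ramp_lip s t : `|ramp s - ramp t| <= C^-1 * `|s - t|.
Proof.
have -> : C^-1 * `|s - t| = `|s / C - t / C|.
  by rewrite -mulrBl normrM mulrC [`|C^-1|]gtr0_norm// invr_gt0.
rewrite /ramp; set a := s / C; set b := t / C.
have := ler_norm (a - b); have := ler_norm (b - a); rewrite (distrC b a) => h1 h2.
rewrite ler_norml; apply/andP.
by case: (leP 1 (3 - a)) => ?; case: (leP 1 (3 - b)) => ?; case: (leP 0 (3 - a)) => ?;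
  case: (leP 0 (3 - b)) => ?; rewrite ?(max_idPr ler01); split; lra.
Qed.

Definition tent F x : R := \big[Num.max/0]_(y <- F) ramp (mdist x y).

Lemma tent_ge0 F x : 0 <= tent F x.
Proof.
rewrite /tent; elim: F => [|y F ih]; rewrite ?big_nil// big_cons.
by rewrite le_max ih orbT.
Qed.

Lemma tent_le1 F x : tent F x <= 1.
Proof.
rewrite /tent; elim: F => [|y F ih]; rewrite ?big_nil// big_cons.
by rewrite ge_max ih andbT ge_max ler01 ge_min lexx.
Qed.

Lemma tent_lip F x y : `|tent F x - tent F y| <= C^-1 * mdist x y.
Proof.
have d0 : 0 <= C^-1 * mdist x y by rewrite mulr_ge0 ?mdist_ge0 ?invr_ge0 ?ltW.
rewrite /tent; elim: F => [|z F ih]; first by rewrite !big_nil subrr normr0.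
rewrite !big_cons.
have : `|ramp (mdist x z) - ramp (mdist y z)| <= C^-1 * mdist x y.
  apply: (le_trans (ramp_lip _ _)); rewrite ler_wpM2l ?invr_ge0 ?(ltW C0)// ler_norml.
  have := mdist_triangleR x y z; have := mdist_triangleR y x z.
  by rewrite (mdist_symR y x) => *; apply/andP; split; lra.
move: ih; set a := ramp _; set b := ramp _; set c := bigop _ _ _; set d := bigop _ _ _.
rewrite !ler_norml => /andP[? ?] /andP[? ?].
by case: (leP a c) => ?; case: (leP b d) => ?; apply/andP; split; lra.
Qed.

Lemma tent_eq1 F x y : y \in F -> mdist x y <= 2 * C -> tent F x = 1.
Proof.
move=> yF xy; apply/eqP; rewrite eq_le tent_le1/= /tent.
elim: F yF => // z F ih; rewrite inE big_cons le_max => /orP[/eqP <-|yF]; last first.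
  by rewrite ih// orbT.
apply/orP; left; rewrite le_max; apply/orP; right; rewrite le_min lexx/=.
have : mdist x y / C <= 2 by rewrite ler_pdivrMr.
by lra.
Qed.

Lemma tent_eq0 F x : (forall y, y \in F -> 3 * C <= mdist x y) -> tent F x = 0.
Proof.
rewrite /tent; elim: F => [|z F ih] H; first by rewrite big_nil.
rewrite big_cons ih; last by move=> y yF; apply: H; rewrite inE yF orbT.
have h : 3 <= mdist x z / C by rewrite ler_pdivlMr// H// mem_head.
rewrite (_ : ramp _ = 0) ?maxxx//; apply/max_idPl.
by rewrite ge_min; apply/orP; right; lra.
Qed.

(** The bound [C < mdist x y] forces a lattice point within C of x to lie outside F. The strict
    inequalities make the shell open, so its indicator is Borel. *)
Definition tent_shell F : set X :=
  [set x | (exists2 y, y \in F & mdist x y < 4 * C) /\ forall y, y \in F -> C < mdist x y].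

Lemma open_near F r : open [set x : X | exists2 y, y \in F & mdist x y < r].
Proof.
rewrite (_ : [set _ | _] = \bigcup_(y in [set` F]) ball y r).
  by apply: bigcup_open => y _; exact: metric_ball_open.
by apply/seteqP; split=> x [y yF xy]; exists y => //; move: xy; rewrite ballEmdist /= mdist_symR.
Qed.

Lemma open_far F r : open [set x : X | forall y, y \in F -> r < mdist x y].
Proof.
elim: F => [|y F ih]; first by rewrite (_ : [set _ | _] = setT); [exact: openT|apply/seteqP; split].
rewrite (_ : [set _ | _] = [set x | r < mdist x y] `&` [set x | forall y, y \in F -> r < mdist x y]).
  apply: openI => //; rewrite openE => x /= rxy; apply/nbhs_ballP.
  exists (mdist x y - r) => /=; first by rewrite subr_gt0.
  by move=> z; rewrite ballEmdist /= => xz; have := mdist_triangleR x z y; lra.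
apply/seteqP; split=> x /=.
  by move=> H; split=> [|z zF]; apply: H; rewrite inE ?eqxx// zF orbT.
by move=> [h H] z; rewrite inE => /orP[/eqP->//|]; exact: H.
Qed.

Lemma open_tent_shell F : open (tent_shell F).
Proof. exact: openI (open_near F _) (open_far F _). Qed.

(** Off the shell, z is within C of F or at least 4 C away from it. The points x and y are less than
    C away from z, so both lie where the tent is 1 (within 2 C) or both where it is 0 (beyond 3
    C). *)
Lemma tent_local_lip F x y z : mdist x y < C / 2 -> mdist x z < C / 2 ->
  `|tent F x - tent F y| <= C^-1 * mdist x y * \1_(tent_shell F) z.
Proof.
move=> xy xz; have C1 : 0 < C by [].
rewrite indicE; have [zA|nA] := boolP (z \in tent_shell F).
  by rewrite mulr1 tent_lip.
rewrite mulr0; suff -> : tent F x = tent F y by rewrite subrr normr0.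
move: nA; rewrite notin_setE => /not_andP[H|/existsNP[w /not_implyP[wF /negP]]]; last first.
  rewrite -leNgt => zw'; have zw : mdist z w <= C by [].
  have xw := mdist_triangleR x z w.
  have yw := mdist_triangleR y x w; rewrite (mdist_symR y x) in yw.
  by rewrite (@tent_eq1 F x w)// ?(@tent_eq1 F y w)//; lra.
have far w : w \in F -> 4 * C <= mdist z w.
  by move=> wF; rewrite leNgt; apply/negP => zw; apply: H; exists w.
have zx := mdist_symR z x.
rewrite (@tent_eq0 F x) ?(@tent_eq0 F y)// => w /far zw.
  by have := mdist_triangleR z x w; have := mdist_triangleR x y w; lra.
by have := mdist_triangleR z x w; lra.
Qed.

Lemma tent_upper_gradient F :
  upper_gradient (EFin \o tent F) (fun x => (C^-1 * \1_(tent_shell F) x)%:E).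
Proof.
apply: (@local_lipschitz_upper_gradient _ _ _ _ (C / 2)) => //.
- by rewrite divr_gt0.
- by apply: borel_fun_indic; apply: open_borel; exact: open_tent_shell.
- by rewrite invr_ge0 ltW.
- exact: tent_local_lip.
Qed.

End tent.

Lemma le_sum_indic (R : realType) (T : Type) (I : eqType) (l : seq I) (k : I -> R)
    (B : I -> set T) (i : I) (x : T) :
  (forall i, 0 <= k i) -> i \in l -> B i x -> k i <= \sum_(j <- l) k j * \1_(B j) x.
Proof.
move=> k0 il Bx; rewrite (big_rem i)//= indicE mem_set// mulr1 lerDl.
by apply: sumr_ge0 => j _; rewrite mulr_ge0.
Qed.

Section sobolev_isoperimetry.
Variables (R : realType) (X : pmetricType R).
Variables (mu : {outer_measure set X -> \bar R}) (rho : R -> R).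
Hypothesis mms : metric_measure_space mu.
Hypothesis unif : uniform_measure mu.
Hypothesis ctl : control_function rho.

Lemma ball_lty (x : X) (r : R) : 0 < r -> (mu (ball x r) < +oo)%E.
Proof. by case: mms => _ _; exact. Qed.

Let mball (x : X) r : measurable (ball x r : set (caratheodory_type mu)).
Proof. exact: measurable_ball_cara. Qed.

Lemma integral_sum_balls (I : Type) (l : seq I) (k r : I -> R) (c : I -> X) :
  (forall i, 0 <= k i) ->
  (integral_on mu setT (fun x => (\sum_(i <- l) k i * \1_(ball (c i) (r i)) x)%:E) =
   \sum_(i <- l) (k i)%:E * mu (ball (c i) (r i)))%E.
Proof.
move=> k0; rewrite /integral_on.
under eq_integral do rewrite -sumEFin.
exact: (@integral_sum_indic _ (caratheodory_type mu)).
Qed.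

Lemma measurable_sum_balls (I : Type) (l : seq I) (k r : I -> R) (c : I -> X) :
  measurable_fun (setT : set (caratheodory_type mu))
    (fun x => (\sum_(i <- l) k i * \1_(ball (c i) (r i)) x)%:E).
Proof.
under eq_fun do rewrite -sumEFin.
exact: (@measurable_sum_indic _ (caratheodory_type mu)).
Qed.

Lemma integral_dominated_balls (f : X -> R) (l : seq X) (k r : R) : 0 <= k -> 0 < r ->
  borel_fun (EFin \o f) -> (forall x, 0 <= f x) ->
  (forall x, f x <= \sum_(y <- l) k * \1_(ball y r) x) ->
  (integral_on mu setT (EFin \o f) < +oo)%E.
Proof.
move=> k0 r0 bf f0 fl.
apply: (@le_lt_trans _ _ (\sum_(y <- l) k%:E * mu (ball y r))%E).
  rewrite -(@integral_sum_balls _ l (fun=> k) (fun=> r) id)//.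
  apply: ge0_le_integral => //.
  - by move=> x _; rewrite lee_fin.
  - exact: (borel_fun_measurable mms bf).
  - exact: (@measurable_sum_balls _ l (fun=> k) (fun=> r) id).
  - by move=> x _; rewrite lee_fin.
apply: lte_sum_pinfty => y _; apply: lte_mul_pinfty => //; exact: ball_lty.
Qed.

Variables (G : set X) (C : R) (o : X) (N : R -> nat).
Hypothesis C0 : 0 < C.
Hypothesis cG : forall x : X, exists2 y, G y & mdist x y < C.
Hypothesis GN : forall (x : X) r, 0 < r -> (G `&` ball x r #<= `I_(N r))%card.
Variable nb : G -> seq G.
Hypothesis nbP : forall y z, (z \in nb y) = (mdist (\val y) (\val z) < 5 * C).

(** At most [N C] of the balls contain x, and if one does, the tent is 1 at x. *)
Lemma sum_balls_le_tent (F : seq G) (x : X) : uniq F ->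
  \sum_(y <- F) 1 * \1_(ball (\val y) C) x <= (N C)%:R * tent C (map \val F) x.
Proof.
move=> uF; pose l := [seq y <- F | mdist x (\val y) < C].
have -> : \sum_(y <- F) 1 * \1_(ball (\val y) C) x = (size l)%:R :> R.
  rewrite /l size_filter -sum1_count natr_sum [RHS]big_mkcond; apply: eq_bigr => y _.
  rewrite mul1r indicE (_ : (x \in (ball (\val y) C : set X)) = (mdist x (\val y) < C)).
    by case: ifP.
  by apply/idP/idP; rewrite inE ballEmdist /= mdist_symR.
have szl : (size l <= N C)%N.
  by rewrite size_filter; exact: lattice_count GN C0 uF.
have [->|[y]] : l = [::] \/ exists y, y \in l.
    by case: (l) => [|y s]; [left|right; exists y; rewrite mem_head].
  by rewrite mulr_ge0 ?tent_ge0.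
rewrite mem_filter => /andP[xy yF].
rewrite (@tent_eq1 _ _ C C0 _ _ (\val y)) ?map_f ?mulr1 ?ler_nat//.
by have C1 : 0 < C by []; lra.
Qed.

(** A shell point x has some y of F within 4 C and a lattice point z within C, which is outside F.
    So (y, z) leaves F and is shorter than 5 C, which is where the radius of [nb] comes from. *)
Lemma tent_shell_boundary (F : seq G) (x : X) :
  tent_shell C (map \val F) x ->
  exists y z, [/\ y \in F, z \in nb y, z \notin F, mdist (\val y) x < 4 * C & mdist (\val z) x < C].
Proof.
move=> [[_ /mapP[y yF ->] xy] far]; have [z Gz xz] := cG x.
exists y, (SigSub (mem_set Gz)); split => //=.
- rewrite nbP /=; have h := mdist_triangleR (\val y) x z.
  rewrite (mdist_symR _ x) in h; apply: le_lt_trans h _.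
  by rewrite (_ : 5 * C = 4 * C + C) ?ltrD//; ring.
- apply/negP => zF; have := far z; rewrite ltNge (ltW xz) => H.
  by have : false by apply: H; apply/mapP; exists (SigSub (mem_set Gz)).
- by rewrite mdist_symR.
- by rewrite mdist_symR.
Qed.

Lemma tent_newton_sobolev (F : seq X) : newton_sobolev mu (EFin \o tent C F).
Proof.
have ct : continuous (tent C F) := lipschitz_continuous_metric (tent_lip C0 F).
have iC0 : 0 <= C^-1 by rewrite invr_ge0 ltW.
have four : 0 < 4 * C by rewrite mulr_gt0.
have bt := continuous_borel_fun ct.
have ugt := tent_upper_gradient C0 F; have [bg g0 _] := ugt.
split.
  apply/integrable_onP => //; first exact: openT.
    by move=> x; rewrite lee_fin tent_ge0.
  apply: (@integral_dominated_balls _ F 1 (3 * C)) => //; first by rewrite mulr_gt0.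
    exact: tent_ge0.
  move=> x; have [[y [yF xy]]|none] := pselect (exists y, y \in F /\ mdist x y < 3 * C).
    apply: (@le_trans _ _ 1); first exact: tent_le1.
    apply: (@le_sum_indic _ _ _ F (fun=> 1) (fun y => ball y (3 * C)) y) => //.
    by rewrite ballEmdist /= mdist_symR.
  rewrite tent_eq0//; last move=> y yF.
    by apply: sumr_ge0 => y _; rewrite mulr_ge0.
  by rewrite leNgt; apply/negP => xy; apply: none; exists y.
exists (fun x => (C^-1 * \1_(tent_shell C F) x)%:E) => //.
apply/integrable_onP => //; first exact: openT.
apply: (@integral_dominated_balls (fun x => C^-1 * \1_(tent_shell C F) x) F C^-1 (4 * C)) => //.
move=> x; rewrite [leLHS]/= indicE; have [xA|_] := boolP (x \in tent_shell C F); last first.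
  by rewrite mulr0 sumr_ge0// => y _; rewrite mulr_ge0.
rewrite mulr1; have [[y yF xy] _] := set_mem xA.
apply: (@le_sum_indic _ _ _ F (fun=> C^-1) (fun y => ball y (4 * C)) y) => //.
by rewrite ballEmdist /= mdist_symR.
Qed.

Lemma tent_bounded_support (F : seq X) :
  bounded_subset (closure [set x | (EFin \o tent C F) x != 0%E]).
Proof.
pose M := \sum_(y <- F) mdist o y + 3 * C.
exists o, (M + C) => x clx.
have [|y [/= ty xy]] := clx (ball x C).
  by apply: open_nbhs_nbhs; split; [exact: metric_ball_open|rewrite ballEmdist /= mdistxx].
have [z zF yz] : exists2 z, z \in F & mdist y z < 3 * C.
  apply: contrapT => none; move: ty => /negP; apply; apply/eqP; congr EFin.
  apply: tent_eq0 => // z zF; rewrite leNgt; apply/negP => yz; apply: none.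
  by exists z.
have zM : mdist o z <= \sum_(y <- F) mdist o y.
  by rewrite (big_rem z)//= lerDl sumr_ge0// => ? _; exact: mdist_ge0.
rewrite ballEmdist in xy; rewrite ballEmdist /=; move: xy => /= xy.
have h1 := mdist_triangleR o z y; have h2 := mdist_triangleR o y x.
rewrite (mdist_symR z) in h1; rewrite (mdist_symR y) in h2.
apply: (le_lt_trans h2); apply: ltrD => //; apply: (le_lt_trans h1).
exact: ler_ltD.
Qed.

(** For the tent over F, the measures of the balls of radius C around F add up to at least [f C]
    times the size of F and to at most [N C] times the integral of the tent. Its gradient is at most
    1 / C on the shell, which is covered by balls of radius C, of measure at most [g C], around the
    ends of the edges leaving F. The constant collects these factors. *)
Lemma sobolev_isoperimetric : sobolev11 mu rho -> exists2 K, 0 <= K &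
  forall F : seq G, uniq F -> (size F)%:R <=
    \sum_(y <- F) \sum_(z <- nb y | z \notin F) K * rho (mdist o (\val y)).
Proof.
move=> [S [oS [S0 sob]]].
have [f [g [fg0 fg_mono fgmu]]] := unif.
have [fC0 gC0] := fg0 C C0.
have iC0 : 0 <= C^-1 by rewrite invr_ge0 ltW.
(* The Sobolev weight is based at oS and taken at a shell point x, the edge weight is based at o and
   taken at y with mdist y x < 4 C; the two distances differ by less than e. *)
pose e := mdist oS o + 6 * C.
have e0 : 0 < e by rewrite ltr_wpDl ?mdist_ge0// mulr_gt0.
have [L L0 HL] := control_shift ctl e0.
pose r0 y := rho (mdist o y).
have r00 y : 0 <= r0 y by apply: (control_ge0 ctl); exact: mdist_ge0.
exists ((N C)%:R * S * C^-1 * L * g C / f C).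
  by rewrite !mulr_ge0 ?invr_ge0// ltW.
move=> F uF; pose u := tent C (map \val F); pose A := tent_shell C (map \val F).
pose g0 x := (C^-1 * \1_A x)%:E.
have ugt : upper_gradient (EFin \o u) g0 := tent_upper_gradient C0 _.
have [bg0 g00 ug0] := ugt.
have wug : weak_upper_gradient mu (EFin \o u) g0.
  split => //; exists set0 => //; last by move=> p nc _; exact: ug0.
  apply/modulus1_eq0P => d d0; exists (cst 0%E).
    by split => //; exact: measurable_cst.
  by rewrite /integral_on integral0 lee_fin ltW.
have [_ [g1 ug1 _]] := tent_newton_sobolev (map \val F).
have g0int : (integral_on mu setT g0 < +oo)%E.
  apply: (@integral_dominated_balls (fun x => C^-1 * \1_A x) (map \val F) C^-1 (4 * C)) => //.
  - by rewrite mulr_gt0.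
  - move=> x; rewrite indicE; have [xA|_] := boolP (x \in A); last first.
      by rewrite mulr0 sumr_ge0// => y _; rewrite mulr_ge0.
    rewrite mulr1; have [[y yF xy] _] := set_mem xA.
    apply: (@le_sum_indic _ _ _ _ (fun=> C^-1) (fun y => ball y (4 * C)) y) => //.
    by rewrite ballEmdist /= mdist_symR.
have [gm gmP] := exists_minimal_weak_upper_gradient mms wug g0int
  (modulus1_path_integral_pinfty_loc mms unif).
have [[bgm gm0 _] _ /(_ _ wug) gm_le] := gmP.
have {}gm_le : {ae cara_measure mu, forall x, (gm x <= g0 x)%E}.
  apply: gm_le => x; exists 1 => //.
  apply/(integrable_onP mms) => //; first exact: metric_ball_open.
  apply: le_lt_trans g0int; apply: ge0_subset_integral => //.
  exact: (borel_fun_measurable mms).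
have := sob _ _ (tent_newton_sobolev _) (tent_bounded_support _) gmP.
have bu : borel_fun (EFin \o u).
  exact: continuous_borel_fun (lipschitz_continuous_metric (tent_lip C0 _)).
have brho : borel_fun (fun x => (rho (mdist oS x))%:E).
  by apply: borel_fun_dist => s t; exact: control_le.
have rhoS0 x : (0 <= (rho (mdist oS x))%:E)%E.
  by rewrite lee_fin (control_ge0 ctl)// mdist_ge0.
pose pairs := [seq (y, z) | y <- F, z <- [seq z <- nb y | z \notin F]].
pose k (yz : G * G) := C^-1 * L * r0 (\val yz.1).
have k0 yz : 0 <= k yz by rewrite /k !mulr_ge0// ltW.
have upper : (integral_on mu setT (fun x => gm x * (rho (mdist oS x))%:E) <=
    \sum_(yz <- pairs) (k yz)%:E * mu (ball (\val yz.2) C))%E.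
  rewrite -(integral_sum_balls pairs (fun=> C) (fun yz => \val yz.2) k0).
  apply: (@le_trans _ _ (integral_on mu setT (fun x => g0 x * (rho (mdist oS x))%:E))%E).
    apply: ae_ge0_le_integral => //.
    - by move=> x _; apply: mule_ge0.
    - by apply: emeasurable_funM; exact: (borel_fun_measurable mms).
    - by move=> x _; apply: mule_ge0.
    - by apply: emeasurable_funM; exact: (borel_fun_measurable mms).
    - have [M [mM M0 MS]] := gm_le; exists M; split=> // x nx; apply: MS => /= H.
      by apply: nx => _; apply: lee_wpmul2r.
  apply: ge0_le_integral => //.
  - by move=> x _; apply: mule_ge0.
  - by apply: emeasurable_funM; exact: (borel_fun_measurable mms).
  - exact: (measurable_sum_balls pairs k (fun=> C) (fun yz => \val yz.2)).
  - move=> x _; rewrite -EFinM lee_fin indicE.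
    have [xA|_] := boolP (x \in A); last first.
      by rewrite mulr0 mul0r; apply: sumr_ge0 => yz _; rewrite mulr_ge0.
    have [y [z [yF zy zF yx zx]]] := tent_shell_boundary (set_mem xA).
    apply: (@le_trans _ _ (k (y, z))); last first.
      apply: (@le_sum_indic _ _ _ pairs k (fun yz => ball (\val yz.2) C)) => //.
        apply/allpairsPdep; exists y, z; split => //.
        by rewrite mem_filter zF.
      by rewrite ballEmdist.
    rewrite mulr1 /k -mulrA ler_wpM2l//; apply: HL; rewrite ?mdist_ge0// /e.
    have h1 := mdist_triangleR oS o x; have h2 := mdist_triangleR o (\val y) x.
    have h3 : 4 * C <= 6 * C by apply: ler_wpM2r; [exact: ltW|rewrite ler_nat].
    apply: (le_trans h1); rewrite -addrA lerD2l; apply: (le_trans h2).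
    by rewrite [leRHS]addrC; apply: lerD => //; exact: le_trans (ltW yx) h3.
have lower : (((size F)%:R * f C)%:E <= (N C)%:R%:E * integral_on mu setT (EFin \o u))%E.
  rewrite -[X in (_ <= _ * X)%E](_ : integral_on mu setT (fun x => (u x)%:E) = _)//.
  rewrite /integral_on -ge0_integralZl_EFin//; last first.
  - exact: (borel_fun_measurable mms).
  - by move=> x _; rewrite lee_fin tent_ge0.
  apply: (@le_trans _ _ (integral_on mu setT
      (fun x => (\sum_(y <- F) 1 * \1_(ball (\val y) C) x)%:E))%E); last first.
    apply: ge0_le_integral => //.
    - by move=> x _; rewrite lee_fin sumr_ge0// => y _; rewrite mulr_ge0.
    - exact: (measurable_sum_balls F (fun=> 1) (fun=> C) \val).
    - by apply: measurable_funeM; exact: (borel_fun_measurable mms).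
    - by move=> x _; rewrite -EFinM lee_fin; exact: sum_balls_le_tent.
  rewrite (integral_sum_balls F (fun=> C) (k := fun=> 1))//.
  apply: (@le_trans _ _ (\sum_(y <- F) (f C)%:E)%E).
    by rewrite sumEFin lee_fin big_const_seq count_predT iter_addr_0 mulr_natl.
  by apply: lee_sum => y _; rewrite mul1e; have /andP[] := fgmu (\val y) C C0.
move=> sobu.
have {}sobu : (integral_on mu setT (EFin \o u) <=
    S%:E * integral_on mu setT (fun x => gm x * (rho (mdist oS x))%:E))%E.
  apply: le_trans sobu; rewrite /integral_on le_eqVlt; apply/orP; left; apply/eqP.
  by apply: eq_integral => x _ /=; rewrite ger0_norm// tent_ge0.
have main : (((size F)%:R * f C)%:E <=
    ((N C)%:R * (S * \sum_(yz <- pairs) k yz * g C))%:E)%E.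
  apply: (le_trans lower); rewrite EFinM [(S * _)%:E]EFinM -sumEFin.
  apply: lee_wpmul2l; first by rewrite lee_fin.
  apply: (le_trans sobu); apply: lee_wpmul2l; first by rewrite lee_fin ltW.
  apply: (le_trans upper); apply: lee_sum => yz _.
  rewrite [leRHS](_ : _ = (k yz)%:E * (g C)%:E)%E//.
  apply: lee_wpmul2l; first by rewrite lee_fin.
  by have /andP[] := fgmu (\val yz.2) C C0.
rewrite lee_fin -ler_pdivlMr// in main; apply: (le_trans main).
rewrite le_eqVlt; apply/orP; left; apply/eqP.
rewrite /pairs big_allpairs_dep/= 2!mulr_sumr mulr_suml; apply: eq_bigr => y _.
rewrite big_filter 2!mulr_sumr mulr_suml; apply: eq_bigr => z _.
by rewrite /k /r0 /=; field; rewrite !gt_eqF.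
Qed.

End sobolev_isoperimetry.

(** * Chains of degree 1 and the vanishing of the fundamental class *)

Section one_chains.
Variables (R : realType) (X : pmetricType R) (rho : R -> R).
Variables (G : set X) (o : G).
Hypothesis ulf : uniformly_locally_finite G.

Definition edge (a b : G) : @simplex R X G 1 := fun i => if i == ord0 then a else b.

Lemma edge_eta (x : @simplex R X G 1) : edge (x ord0) (x ord_max) = x.
Proof.
apply/funext => i; rewrite /edge; case: eqVneq => [->//|i0]; congr x.
by apply/val_inj => /=; case: i i0 => -[|[|]].
Qed.

Lemma boundary_edges (b : @formal_chain R X G 1) (y : @simplex R X G 0) :
  boundary b y = \sum_(z \in [set: G]) b (edge z (y ord0)) -
                 \sum_(z \in [set: G]) b (edge (y ord0) z).
Proof.
have lift0 : lift (ord0 : 'I_2) (ord0 : 'I_1) = ord_max by apply/val_inj.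
have liftM : lift (ord_max : 'I_2) (ord0 : 'I_1) = ord0 by apply/val_inj.
rewrite /boundary big_ord_recl big_ord1 /= expr0 mul1r expr1 mulN1r; congr (_ - _).
  apply: reindex_fsbig; split.
  - move=> z _ /=; apply/funext => j; rewrite /face (ord1 j) lift0.
    by rewrite /edge.
  - move=> z z' _ _ /(congr1 (fun x : @simplex R X G 1 => x ord0)).
    by rewrite /edge eqxx.
  - move=> x /= <-; exists (x ord0) => //.
    by rewrite /face lift0 edge_eta.
rewrite (_ : lift ord0 ord0 = ord_max); last by apply/val_inj.
apply: reindex_fsbig; split.
- move=> z _ /=; apply/funext => j; rewrite /face (ord1 j) liftM.
  by rewrite /edge eqxx.
- move=> z z' _ _ /(congr1 (fun x : @simplex R X G 1 => x ord_max)).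
  by rewrite /edge.
- move=> x /= <-; exists (x ord_max) => //.
  by rewrite /face liftM edge_eta.
Qed.

Lemma simplex_diam_edge (x : @simplex R X G 1) :
  simplex_diam x = mdist (\val (x ord0)) (\val (x ord_max)).
Proof.
apply/eqP; rewrite eq_le; apply/andP; split.
  rewrite /simplex_diam; elim/big_ind: _ => [|a b ha hb|[i j] /= ij].
  - exact: mdist_ge0.
  - by rewrite ge_max ha.
  - case: (eqVneq i ord0) ij => [->|i0] ij.
      by rewrite (_ : j = ord_max)//; apply/val_inj; case: j ij => -[|[|]].
    have -> : i = ord_max by apply/val_inj; case: i i0 ij => -[|[|]].
    have -> : j = ord0 by apply/val_inj; case: i j i0 ij => -[|[|]]// ? [[|[|]]].
    by rewrite mdist_symR.
exact: (@le_bigmax_cond _ _ _ _ (ord0, ord_max) _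
  (fun ij => mdist (\val (x ij.1)) (\val (x ij.2)))).
Qed.

Lemma alternating_edge (b : @formal_chain R X G 1) :
  (forall (s : 'S_2) x, b (x \o s) = (-1) ^+ s * b x) <->
  forall u v, b (edge u v) = - b (edge v u).
Proof.
split=> [alt u v|anti s x].
  have := alt (tperm ord0 ord_max) (edge v u).
  rewrite odd_tperm /= expr1 mulN1r => <-; congr b; apply/funext => i.
  rewrite /edge /=; case: tpermP => [->|->|i0 i1]//.
  by exfalso; case: i i0 i1 => -[|[|]] // i2 h1 h2; [apply: h1|apply: h2]; apply/val_inj.
have two (i : 'I_2) : i = ord0 \/ i = ord_max.
  by case: i => -[|[|]]// i2; [left|right]; apply/val_inj.
have [s0|s0] := two (s ord0).
  have -> : s = 1%g.
    apply/permP => i; rewrite perm1; have [->//|->] := two i.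
    have [smax|//] := two (s ord_max).
    by have /perm_inj := etrans s0 (esym smax).
  by rewrite odd_perm1 mul1r; congr b; apply/funext => i /=; rewrite perm1.
have -> : s = tperm ord0 ord_max.
  apply/permP => i; have [->|->] := two i; rewrite ?tpermL ?tpermR//.
  have [//|smax] := two (s ord_max).
  by have /perm_inj := etrans s0 (esym smax).
rewrite odd_tperm /= expr1 mulN1r -[in RHS](edge_eta x) -anti; congr b.
apply/funext => i; rewrite /edge /=.
by have [->|->] := two i; rewrite ?tpermL ?tpermR.
Qed.

Definition chain_bound (b : @formal_chain R X G 1) (P : R) :=
  forall u v, P < mdist (\val u) (\val v) -> b (edge u v) = 0.

Lemma is_chain1P (b : @formal_chain R X G 1) : is_chain rho o b <->
  [/\ exists2 K, 0 <= K & forall u v, `|b (edge u v)| <=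
        K * rho (Num.max (mdist (\val u) (\val o)) (mdist (\val v) (\val o))),
      forall u v, b (edge u v) = - b (edge v u) &
      exists2 P, 0 <= P & chain_bound b P].
Proof.
have dist_edge u v : simplex_dist (edge u v) (fun=> o) =
    Num.max (mdist (\val u) (\val o)) (mdist (\val v) (\val o)).
  rewrite /simplex_dist !big_ord_recl big_ord0 /edge /=.
  by rewrite (max_idPl (mdist_ge0 (\val v) _)).
split=> [[[K K0 bK] alt [P P0 bP]]|[[K K0 bK] anti [P P0 bP]]].
- split; first by exists K => // u v; rewrite -dist_edge.
    exact/alternating_edge.
  by exists P => // u v uv; apply: bP; rewrite simplex_diam_edge.
- split; first by exists K => // x; rewrite -(edge_eta x) dist_edge.
    exact/alternating_edge.
  exists P => // x; rewrite simplex_diam_edge => /bP.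
  by rewrite edge_eta.
Qed.

(** By antisymmetry the edges entering v and those leaving v contribute equally, whence the factor
    2. *)
Lemma boundary_seq (b : @formal_chain R X G 1) (P : R) (v : G) (l : seq G) :
  (forall u v, b (edge u v) = - b (edge v u)) -> chain_bound b P -> uniq l ->
  (forall u, mdist (\val v) (\val u) <= P -> u \in l) ->
  forall y : @simplex R X G 0, y ord0 = v -> boundary b y = 2 * \sum_(z <- l) b (edge z v).
Proof.
move=> anti bP ul lP y yv; rewrite boundary_edges yv.
have out u : u \notin l -> P < mdist (\val v) (\val u).
  by apply: contraNT; rewrite -leNgt; exact: lP.
rewrite !(fsum_seq ul) => [|u /out/bP//|u /out h]; last by apply: bP; rewrite mdist_symR.
under [X in _ - X]eq_bigr do rewrite anti.
by rewrite sumrN opprK mulrDl mul1r.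
Qed.

Lemma boundary_lin (a : R) (b c : @formal_chain R X G 1) :
  is_chain rho o b -> is_chain rho o c ->
  boundary (fun x => a * b x + c x) = fun y => a * boundary b y + boundary c y.
Proof.
move=> /is_chain1P[_ antib [P P0 bP]] /is_chain1P[_ antic [Q Q0 cQ]].
apply/funext => y.
have M0 : 0 < Num.max P Q + 1 by rewrite ltr_pwDr// le_max P0.
have [l ul lP] := lattice_ball_seq ulf (\val (y ord0)) M0.
have lM u : mdist (\val (y ord0)) (\val u) <= Num.max P Q -> u \in l.
  by move=> h; rewrite lP ltr_pwDr// .
have big u v : Num.max P Q < mdist (\val u) (\val v) -> b (edge u v) = 0 /\ c (edge u v) = 0.
  by rewrite gt_max => /andP[/bP-> /cQ->].
rewrite !(@boundary_seq _ (Num.max P Q) (y ord0) l)//.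
- rewrite big_split/= -mulr_sumr; ring.
- by move=> u v /big[].
- by move=> u v /big[].
- by move=> u v; rewrite antib antic; ring.
- by move=> u v /big[-> ->]; rewrite mulr0 addr0.
Qed.

Lemma is_chain_lin (a : R) (b c : @formal_chain R X G 1) :
  is_chain rho o b -> is_chain rho o c -> is_chain rho o (fun x => a * b x + c x).
Proof.
move=> /is_chain1P[[K K0 bK] antib [P P0 bP]] /is_chain1P[[L L0 cL] antic [Q Q0 cQ]].
apply/is_chain1P; split.
- exists (`|a| * K + L); first by rewrite addr_ge0 ?mulr_ge0.
  move=> u v; rewrite (le_trans (ler_normD _ _))// mulrDl lerD// normrM -mulrA.
  by rewrite ler_wpM2l.
- by move=> u v; rewrite antib antic; ring.
- exists (Num.max P Q) => [|u v]; first by rewrite le_max P0.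
  by rewrite gt_max => /andP[/bP-> /cQ->]; rewrite mulr0 addr0.
Qed.

Let zero_chain : @formal_chain R X G 1 := fun=> 0.

Lemma is_chain_zero : is_chain rho o zero_chain.
Proof.
apply/is_chain1P; split.
- exists 0 => // u v; rewrite normr0 mul0r//.
- by move=> u v; rewrite oppr0.
- by exists 0.
Qed.

Lemma boundary_zero : boundary zero_chain = fun=> 0.
Proof.
have := boundary_lin (-1) is_chain_zero is_chain_zero.
rewrite (_ : (fun x => _) = zero_chain); last by apply/funext => x; rewrite mulr0 addr0.
by move=> ->; apply/funext => y; rewrite mulN1r addNr.
Qed.

(** The function 0 lies in the zero class, so equality of the cosets gives 0 = 1 + boundary b, and
    -b is as required. Conversely, adding or subtracting b0 carries each coset into the other. *)
Lemma fundamental_class_zeroP : fundamental_class rho o = homology_zero rho o 0 <->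
  exists2 b : @formal_chain R X G 1, is_chain rho o b & forall y, boundary b y = 1.
Proof.
split=> [fz|[b0 chb0 b01]].
  have : homology_zero rho o 0 (fun=> 0).
    split; last first.
      exists zero_chain; first exact: is_chain_zero.
      by rewrite boundary_zero; apply/funext => x; rewrite addr0.
    split; first by exists 0 => // x; rewrite normr0 mul0r.
      by move=> s x; rewrite mulr0.
    by exists 0.
  rewrite -fz => -[_ [b chb b1]].
  exists (fun x => -1 * b x + zero_chain x); first exact: is_chain_lin chb is_chain_zero.
  move=> y; rewrite (boundary_lin (-1) chb is_chain_zero) boundary_zero.
  by have /= := congr1 (fun h => h y) b1; lra.
have b0E : boundary b0 = fun=> 1 by apply/funext.
apply/seteqP; split=> z [cz [b chb zE]]; split => //; rewrite {}zE {cz}.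
  exists (fun x => 1 * b0 x + b x); first exact: is_chain_lin chb0 chb.
  rewrite (boundary_lin 1 chb0 chb) b0E; apply/funext => x; ring.
exists (fun x => -1 * b0 x + b x); first exact: is_chain_lin chb0 chb.
rewrite (boundary_lin (-1) chb0 chb) b0E; apply/funext => x; ring.
Qed.

End one_chains.

Lemma sobolev_fundamental_class_zero (R : realType) (X : pmetricType R)
    (mu : {outer_measure set X -> \bar R}) (rho : R -> R) (G : set X) (o : G) :
  metric_measure_space mu -> uniform_measure mu -> control_function rho ->
  sobolev11 mu rho -> quasi_lattice G ->
  fundamental_class rho o = homology_zero rho o 0.
Proof.
move=> mms unif ctl sob [[C C0 cG] ulf]; have [N GN] := ulf.
have P0 : 0 < 5 * C by rewrite mulr_gt0.
have /choice[nb nbP] : forall y : G, exists l : seq G, uniq l /\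
    forall z : G, (z \in l) = (mdist (\val y) (\val z) < 5 * C).
  by move=> y; have [l ul lP] := lattice_ball_seq ulf (\val y) P0; exists l.
have nb_uniq y : uniq (nb y) by case: (nbP y).
have nbE y z : (z \in nb y) = (mdist (\val y) (\val z) < 5 * C) by case: (nbP y).
have [K K0 iso] := sobolev_isoperimetric mms unif ctl (\val o) C0 cG GN nbE sob.
pose W (y z : G) := K * rho (mdist (\val o) (\val y)).
have W0 y z : 0 <= W y z.
  by rewrite /W mulr_ge0// (control_ge0 ctl)// mdist_ge0.
have nb_sym y z : (z \in nb y) = (y \in nb z) by rewrite !nbE mdist_symR.
have [c [anti cW cnb c1]] := exists_unit_flow nb_uniq nb_sym W0 iso.
apply/(fundamental_class_zeroP rho o ulf).
(* The boundary is twice the inflow of b, whereas c has outflow 1; this explains both the sign and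
   the half. *)
pose b (x : @simplex R X G 1) := - 2^-1 * c (x ord0) (x ord_max).
have bE u v : b (edge u v) = - 2^-1 * c u v by [].
have b_anti u v : b (edge u v) = - b (edge v u) by rewrite !bE anti; ring.
have bP : chain_bound b (5 * C).
  move=> u v uv; rewrite bE cnb ?mulr0// nbE -leNgt; exact: ltW.
exists b.
  apply/is_chain1P; split => //; last by exists (5 * C) => //; exact: ltW.
  exists K => // u v; rewrite bE normrM normrN [`|2^-1|]gtr0_norm ?invr_gt0//.
  have := cW u v; rewrite /W -mulrDr.
  set m := Num.max _ _.
  have m0 : 0 <= m by rewrite le_max mdist_ge0.
  have h1 : rho (mdist (\val o) (\val u)) <= rho m.
    by apply: (control_le ctl); rewrite ?mdist_ge0// mdist_symR le_max lexx.
  have h2 : rho (mdist (\val o) (\val v)) <= rho m.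
    by apply: (control_le ctl); rewrite ?mdist_ge0// mdist_symR le_max lexx orbT.
  have h3 : K * (rho (mdist (\val o) (\val u)) + rho (mdist (\val o) (\val v))) <=
      K * (2 * rho m) by rewrite ler_wpM2l//; lra.
  move=> /le_trans /(_ h3) h; rewrite (_ : K * rho m = 2^-1 * (K * (2 * rho m))); last by field.
  by apply: ler_wpM2l => //; rewrite invr_ge0.
move=> y; set v := y ord0.
(* [boundary_seq] wants all points of the closed ball of radius 5 C, hence a larger open one. *)
have P1 : 0 < 5 * C + 1 by rewrite addr_gt0.
have [l ul lP] := lattice_ball_seq ulf (\val v) P1.
rewrite (@boundary_seq _ _ _ b (5 * C) v l)// => [|u uv]; last first.
  by rewrite lP ltr_pwDr.
have sum1 : \sum_(z <- l) c v z = 1.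
  rewrite -(c1 v) (bigID [in nb v])/= addrC big1 ?add0r => [|z /cnb//].
  rewrite -big_filter; apply: perm_big; apply: uniq_perm => //; first exact: filter_uniq.
  move=> z; rewrite mem_filter; case: (boolP (z \in nb v)) => //= zv.
  by rewrite lP ltr_pwDr// ltW// -nbE.
by rewrite -[RHS]sum1 mulr_sumr; apply: eq_bigr => z _; rewrite bE (anti v z); field.
Qed.

(** * From a flow to the Sobolev inequality *)

Section averages.
Context d (T : measurableType d) (R : realType) (m : {measure set T -> \bar R}).
Local Open Scope ereal_scope.

(** The integral of v - k over A is m A times the mean minus k. Later k is the mean over a larger
    ball. *)
Lemma average_deviation (A : set T) (v : T -> R) (k : R) : measurable A ->
  0 < m A -> m A < +oo -> m.-integrable A (EFin \o v) ->
  m A * `|fine ((fine (m A))^-1%:E * \int[m]_(x in A) (v x)%:E) - k|%:E <=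
  \int[m]_(x in A) `|v x - k|%:E.
Proof.
move=> mA A0 Aoo iv.
have Afin : m A \is a fin_num by rewrite ge0_fin_numE.
have ik : m.-integrable A (EFin \o cst k).
  apply/integrableP; split; first exact/measurable_EFinP/measurable_cst.
  rewrite (_ : (fun x => _) = cst `|k|%:E)// integral_cst// -(fineK Afin) -EFinM.
  exact: ltry.
have Ifin := integrable_fin_num mA iv.
have D : \int[m]_(x in A) (v x - k)%:E = (fine (\int[m]_(x in A) (v x)%:E) - k * fine (m A))%:E.
  rewrite (_ : (fun x => (v x - k)%:E) = (EFin \o v) \- (EFin \o cst k)); last first.
    by apply/funext => x; rewrite /= EFinB.
  have Ik : \int[m]_(x in A) (EFin \o cst k) x = k%:E * m A by exact: (integral_cst m mA k%:E).
  by rewrite integralB// Ik EFinB EFinM !fineK.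
have mAr : (0 < fine (m A))%R by rewrite fine_gt0// A0 Aoo.
have mv : measurable_fun A (fun x => (v x - k)%:E).
  by apply/measurable_EFinP/measurable_funB => //; apply/measurable_EFinP; case/integrableP: iv.
apply: le_trans (le_abse_integral m mA mv); rewrite D.
rewrite -(fineK Ifin) -EFinM /= -{1}(fineK Afin) -EFinM lee_fin.
rewrite -{1}(gtr0_norm mAr) -normrM mulrBr mulrA divff ?gt_eqF// mul1r.
by rewrite [(_ * k)%R]mulrC.
Qed.

Lemma integral_abs_le_average (A : set T) (v : T -> R) (k : R) : measurable A ->
  measurable_fun A v ->
  \int[m]_(x in A) `|v x|%:E <= \int[m]_(x in A) `|v x - k|%:E + m A * `|k|%:E.
Proof.
move=> mA mv; rewrite muleC -(integral_cst m mA) -ge0_integralD//.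
- apply: ge0_le_integral => //.
  + by apply/measurable_EFinP; exact: measurableT_comp.
  + apply: emeasurable_funD => //; apply/measurable_EFinP.
    by apply: measurableT_comp => //; exact: measurable_funB.
  + by move=> x _; rewrite lee_fin -{1}(subrK k (v x)) ler_normD.
- by apply/measurable_EFinP; apply: measurableT_comp => //; exact: measurable_funB.
- by move=> x _; rewrite lee_fin.
Qed.

Lemma sum_integral_overlap (I : Type) (l : seq I) (B : I -> set T) (h : T -> \bar R) (n : nat) :
  measurable_fun setT h -> (forall x, 0 <= h x) -> (forall i, measurable (B i)) ->
  (forall x, (count (fun i => x \in B i) l <= n)%N) ->
  \sum_(i <- l) \int[m]_(x in B i) h x <= n%:R%:E * \int[m]_x h x.
Proof.
move=> mh h0 mB cn.
under eq_bigr do rewrite integral_mkcond.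
have hB0 i x : 0 <= (h \_ (B i)) x by rewrite /patch; case: ifP.
have mhB i : measurable_fun setT (h \_ (B i)).
  by apply/(measurable_restrictT h (mB i)); apply: measurable_funTS.
rewrite -ge0_integral_sum// -ge0_integralZl_EFin//.
apply: ge0_le_integral => //.
- by move=> x _; exact: sume_ge0.
- exact: emeasurable_sum.
- exact: measurable_funeM.
move=> x _; apply: (@le_trans _ _ ((count (fun i => x \in B i) l)%:R%:E * h x)).
  elim: (l) => [|i s ih] /=; first by rewrite big_nil mul0e.
  rewrite big_cons natrD EFinD ge0_muleDl ?lee_fin// leeD//.
  by rewrite /patch; case: ifP => _; rewrite ?mul1e ?mul0e.
by apply: lee_wpmul2r => //; rewrite lee_fin ler_nat.
Qed.

Lemma integral_le_sum_cover (I : eqType) (l : seq I) (B : I -> set T) (h : T -> \bar R) :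
  measurable_fun setT h -> (forall x, 0 <= h x) -> (forall i, measurable (B i)) ->
  (forall x, h x != 0 -> exists2 i, i \in l & B i x) ->
  \int[m]_x h x <= \sum_(i <- l) \int[m]_(x in B i) h x.
Proof.
move=> mh h0 mB cov; under eq_bigr do rewrite integral_mkcond.
have hB0 i x : 0 <= (h \_ (B i)) x by rewrite /patch; case: ifP.
have mhB i : measurable_fun setT (h \_ (B i)).
  by apply/(measurable_restrictT h (mB i)); apply: measurable_funTS.
rewrite -ge0_integral_sum//; apply: ge0_le_integral => //.
  exact: emeasurable_sum.
move=> x _; have [->|/cov[i il Bx]] := eqVneq (h x) 0; first exact: sume_ge0.
by rewrite (big_rem i)//= patchT ?inE// leeDl// sume_ge0.
Qed.

End averages.

(* Summation by parts: by antisymmetry, twice the sum of the c z y * a y is the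
   sum of the c z y * (a y - a z). *)
Lemma flow_sum_le (R : realType) (T : eqType) (F : seq T) (a : T -> R) (c : T -> T -> R) :
  (forall u v, c u v = - c v u) ->
  (forall y, y \in F -> a y != 0 -> 2 * \sum_(z <- F) c z y = 1) ->
  \sum_(y <- F) a y <= \sum_(y <- F) \sum_(z <- F) `|c z y| * `|a y - a z|.
Proof.
move=> anti half.
have -> : \sum_(y <- F) a y = \sum_(y <- F) \sum_(z <- F) c z y * (a y - a z).
  pose S := \sum_(y <- F) \sum_(z <- F) c z y * a y.
  have -> : \sum_(y <- F) a y = 2 * S.
    rewrite mulr_sumr big_seq [RHS]big_seq; apply: eq_bigr => y yF.
    rewrite -mulr_suml mulrA; have [->|ay] := eqVneq (a y) 0; first by rewrite mulr0.
    by rewrite half// mul1r.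
  have S2 : \sum_(y <- F) \sum_(z <- F) c z y * a z = - S.
    rewrite exchange_big/= /S -sumrN; apply: eq_bigr => z _; rewrite -sumrN.
    by apply: eq_bigr => y _; rewrite anti mulNr.
  under [RHS]eq_bigr do under eq_bigr do rewrite mulrBr.
  under [RHS]eq_bigr do rewrite sumrB.
  by rewrite sumrB S2 -/S; ring.
apply: ler_sum => y _; apply: ler_sum => z _.
by rewrite (le_trans (ler_norm _))// normrM.
Qed.

(** * Comparison of means along chains of balls *)

Section poincare_chain.
Variables (R : realType) (X : pmetricType R).
Variable mu : {outer_measure set X -> \bar R}.
Hypothesis mms : metric_measure_space mu.
Local Open Scope ereal_scope.

Let mball (x : X) r : measurable (ball x r : set (caratheodory_type mu)).
Proof. exact: measurable_ball_cara. Qed.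

(** Multiplying by the measure of the small ball clears both averages, since its quotient by the
    measure of the large ball is at most 1. *)
Lemma poincare_ball (CP RP tau : R) (x : X) (s : R) (v : X -> R) (g : X -> \bar R) :
  (0 < s)%R -> (1 <= tau)%R -> (0 <= CP)%R -> (forall y, 0 <= g y) ->
  0 < mu (ball x s) -> mu (ball x (tau * s)%R) < +oo ->
  emean mu (ball x s) (fun y => (`|v y - mean mu (ball x s) v|%R)%:E)
    <= (CP * s)%:E * emean mu (ball x (tau * s)%R) g ->
  integral_on mu (ball x s) (fun y => `|v y - mean mu (ball x s) v|%:E)
    <= (CP * s)%:E * integral_on mu (ball x (tau * s)%R) g.
Proof.
move=> s0 tau1 CP0 g0 B0 tBoo; rewrite /emean.
set I1 := integral_on _ _ _; set I2 := integral_on _ _ _ => H.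
have I10 : 0 <= I1 by apply: integral_ge0 => y _; rewrite lee_fin.
have I20 : 0 <= I2 by exact: integral_ge0.
have sub : mu (ball x s) <= mu (ball x (tau * s)%R).
  apply: le_outer_measure => y; rewrite !ballEmdist /= => /lt_le_trans; apply.
  by rewrite ler_peMl// ltW.
have a0 : (0 < fine (mu (ball x s)))%R by rewrite fine_gt0// B0 (le_lt_trans sub).
have ab : (fine (mu (ball x s)) <= fine (mu (ball x (tau * s)%R)))%R.
  rewrite fine_le// ge0_fin_numE ?outer_measure_ge0//; exact: le_lt_trans sub tBoo.
set a := fine _ in H a0 ab; set b := fine _ in H ab.
have b0 : (0 < b)%R by exact: lt_le_trans ab.
have -> : I1 = a%:E * (a^-1%:E * I1).
  by rewrite muleA -EFinM divff ?mul1e// gt_eqF.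
apply: (@le_trans _ _ (a%:E * ((CP * s)%:E * (b^-1%:E * I2)))).
  by apply: lee_wpmul2l => //; rewrite lee_fin ltW.
rewrite muleCA; apply: lee_wpmul2l; first by rewrite lee_fin mulr_ge0// ltW.
rewrite muleA -EFinM -[leRHS]mul1e; apply: lee_wpmul2r => //.
by rewrite lee_fin ler_pdivrMr// mul1r.
Qed.

Variables (f : R -> R) (v : X -> R) (g : X -> \bar R) (CP RP tau r : R).
Hypothesis f0 : forall s, (0 < s)%R -> (0 < f s)%R.
Hypothesis fmu : forall x s, (0 < s)%R -> (f s)%:E <= mu (ball x s).
Hypothesis iv : integrable_on mu setT (EFin \o v).
Hypothesis bg : borel_fun g.
Hypothesis g0 : forall y, 0 <= g y.
Hypothesis r0 : (0 < r)%R.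
Hypothesis rRP : (2 * r <= RP)%R.
Hypothesis CP0 : (0 < CP)%R.
Hypothesis poincare : forall x s, (0 < s)%R -> (s <= RP)%R ->
  integral_on mu (ball x s) (fun y => `|v y - mean mu (ball x s) v|%:E)
    <= (CP * s)%:E * integral_on mu (ball x (tau * s)%R) g.

Lemma integrable_on_ball (x : X) s : integrable_on mu (ball x s) (EFin \o v).
Proof. by apply: integrableS iv => //; exact: mball. Qed.

Lemma measurable_real_fun : measurable_fun (setT : set (caratheodory_type mu)) v.
Proof. by apply/measurable_EFinP; case/integrableP : iv. Qed.

Lemma mean_ball_deviation (x x' : X) s s' : (0 < s)%R -> (0 < s')%R -> (s <= RP)%R ->
  ball x' s' `<=` ball x s ->
  (f s')%:E * `|mean mu (ball x' s') v - mean mu (ball x s) v|%:E <=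
    (CP * s)%:E * integral_on mu (ball x (tau * s)%R) g.
Proof.
move=> s0 s'0 sRP sub; apply: le_trans (poincare x s0 sRP).
set k := mean mu (ball x s) v.
have B0 : 0 < mu (ball x' s') by apply: lt_le_trans (fmu x' s'0); rewrite lte_fin f0.
have Boo : mu (ball x' s') < +oo by case: mms => _ _; exact.
apply: (@le_trans _ _ (integral_on mu (ball x' s') (fun y => `|v y - k|%:E))).
  apply: le_trans (average_deviation k (mball x' s') B0 Boo (integrable_on_ball x' s')).
  by apply: lee_wpmul2r; [rewrite lee_fin|exact: fmu].
apply: ge0_subset_integral => //.
apply/measurable_EFinP; apply: measurableT_comp => //.
by apply: measurable_funB => //; apply: measurable_funTS; exact: measurable_real_fun.
Qed.

(* Both balls lie in the ball of radius 2 r around x. *)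
Lemma mean_adjacent_balls (x x' : X) : (mdist x x' < r)%R ->
  `|mean mu (ball x r) v - mean mu (ball x' r) v|%:E <=
    (4 * CP * r / f r)%:E * integral_on mu (ball x (tau * (2 * r))%R) g.
Proof.
move=> xx'; set J := integral_on _ _ _.
have J0 : 0 <= J by exact: integral_ge0.
have r20 : (0 < 2 * r)%R by rewrite mulr_gt0.
have [Joo|Joo] := eqVneq J +oo.
  by rewrite Joo gt0_muley ?leey// lte_fin divr_gt0 ?f0// !mulr_gt0.
have [j jE] : exists j, J = j%:E.
  by exists (fine J); rewrite fineK// ge0_fin_numE// ltey.
have := @mean_ball_deviation x x (2 * r)%R r r20 r0 rRP.
have := @mean_ball_deviation x x' (2 * r)%R r r20 r0 rRP.
rewrite -/J jE -!EFinM !lee_fin => h1 h2.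
have s1 : ball x' r `<=` ball x (2 * r)%R.
  move=> y; rewrite !ballEmdist /= => xy; apply: le_lt_trans (mdist_triangleR x x' y) _.
  by rewrite (_ : 2 * r = r + r)%R ?ltrD//; ring.
have s2 : ball x r `<=` ball x (2 * r)%R.
  move=> y; rewrite !ballEmdist /= => xy; apply: lt_trans xy _.
  by rewrite ltr_pMl// ltr1n.
have {}h1 := h1 s1; have {}h2 := h2 s2.
have fr0 := f0 r0.
rewrite mulrAC ler_pdivlMr// mulrC.
set m1 := mean _ _ _ in h1 h2 *; set m2 := mean _ _ _ in h1 h2 *; set m3 := mean _ _ _ in h1 *.
have : (`|m1 - m3| <= `|m1 - m2| + `|m3 - m2|)%R.
  by rewrite -[(m3 - m2)%R]opprB normrN (le_trans _ (ler_normD _ _))// addrA subrK.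
rewrite distrC => /(ler_wpM2l (ltW fr0)) /le_trans; apply; rewrite mulrDr.
by apply: (le_trans (lerD h1 h2)); lra.
Qed.

(** The steps telescope, and every enlarged ball of the chain lies in the one ball around y. *)
Lemma mean_chain (n : nat) (c : nat -> X) (y : X) (D : R) :
  (forall i, (i < n)%N -> (mdist (c i) (c i.+1) < r)%R) ->
  (forall i, (i < n)%N -> (mdist y (c i) <= D)%R) ->
  `|mean mu (ball (c 0%N) r) v - mean mu (ball (c n) r) v|%:E <=
    n%:R%:E * ((4 * CP * r / f r)%:E * integral_on mu (ball y (D + tau * (2 * r))%R) g).
Proof.
set A := (4 * CP * r / f r)%:E; set J := integral_on _ _ _.
have A0 : 0 <= A by rewrite lee_fin !mulr_ge0 ?invr_ge0 ?ltW// f0.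
have J0 : 0 <= J by exact: integral_ge0.
elim: n => [|n ih] hc hD; first by rewrite subrr normr0 mul0e.
rewrite -natr1 EFinD ge0_muleDl ?lee_fin// mul1e.
apply: (@le_trans _ _ (`|mean mu (ball (c 0%N) r) v - mean mu (ball (c n) r) v|%:E +
    `|mean mu (ball (c n) r) v - mean mu (ball (c n.+1) r) v|%:E)).
  by rewrite -EFinD lee_fin (le_trans _ (ler_normD _ _))// addrA subrK.
apply: leeD.
  by apply: ih => i ilt; [apply: hc|apply: hD]; exact: ltnW.
apply: (le_trans (mean_adjacent_balls (hc n (ltnSn n)))).
apply: lee_wpmul2l => //; apply: ge0_subset_integral => //.
  by apply: measurable_funTS; exact: (borel_fun_measurable mms).
move=> x; rewrite !ballEmdist /= => cx.
exact: le_lt_trans (mdist_triangleR y (c n) x) (ler_ltD (hD n (ltnSn n)) cx).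
Qed.

Lemma mean_difference (Q P : R) (y z : X) : (1 <= Q)%R -> (0 <= P)%R ->
  (exists p : rpath X, [/\ p (rpath_start p) = y, p (rpath_end p) = z &
        path_length p <= (Q * mdist y z)%:E]) ->
  (mdist y z <= P)%R ->
  `|mean mu (ball y r) v - mean mu (ball z r) v|%:E <=
    (Num.truncn (Q * P / r)).+1%:R%:E * ((4 * CP * r / f r)%:E *
       integral_on mu (ball y (Q * P + tau * (2 * r))%R) g).
Proof.
move=> Q1 P0 [p [py pz pL]] yz; set n := (Num.truncn _).+1.
have Q0 : (0 <= Q)%R by exact: le_trans Q1.
have LQP : (plen p <= Q * P)%R.
  move: pL; rewrite path_length_plen lee_fin => /le_trans; apply.
  by rewrite ler_wpM2l.
have L0 := plen_ge0 p.
have n0 : (0 < n%:R :> R)%R by rewrite ltr0n.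
(* The path is cut at equal arc lengths. As n exceeds Q P / r, consecutive points are closer than r,
   and n does not depend on y and z. *)
pose t (i : nat) := (i%:R * (plen p / n%:R))%R.
pose c i := pclamp p (t i).
have c0 : c 0%N = y.
  by rewrite /c /t mul0r pclampE ?arclength_param0// in_itv/= lexx.
have cn : c n = z.
  rewrite /c /t mulrC divfK ?gt_eqF// pclampE ?arclength_param_plen//.
  by rewrite in_itv/= L0 lexx.
have := @mean_chain n c y (Q * P); rewrite c0 cn; apply => i ilt.
  apply: le_lt_trans (pclamp_lip _ _ _) _.
  have -> : (t i - t i.+1 = - (plen p / n%:R))%R by rewrite /t -natr1; ring.
  rewrite normrN ger0_norm ?divr_ge0// ltr_pdivrMr// (le_lt_trans LQP)//.
  by rewrite [ltRHS]mulrC -ltr_pdivrMr//; exact: truncnS_gt.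
rewrite -{1}c0; apply: le_trans (pclamp_lip _ _ _) _; apply: le_trans LQP.
rewrite /t mul0r sub0r normrN ger0_norm ?mulr_ge0 ?divr_ge0//.
by rewrite mulrA ler_pdivrMr// mulrC ler_wpM2l// ler_nat ltnW.
Qed.

End poincare_chain.

Section finite_representative.
Variables (R : realType) (X : pmetricType R).
Variable mu : {outer_measure set X -> \bar R}.
Hypothesis mms : metric_measure_space mu.
Local Open Scope ereal_scope.

(* Upper gradients of u have infinite integral over paths ending at an infinite
   value of u, as |oo - oo| = oo; hence such paths are negligible. *)
Lemma minimal_weak_upper_gradient_fine (u g : X -> \bar R) : newton_sobolev mu u ->
  minimal_weak_upper_gradient mu u g ->
  minimal_weak_upper_gradient mu (EFin \o (fine \o u)) g.
Proof.
move=> [_ [g0 [bg0 g00 ug0] ig0]] [[bg gge0 [E E0 ug]] lg gmin].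
pose Einf := [set p : rpath X | path_integral p g0 = +oo].
have Einf0 : modulus1 mu Einf = 0.
  apply: modulus1_path_integral_pinfty => //.
  by apply/(integrable_onP mms openT bg0 g00).
have fin p : nonconstant p -> ~ Einf p ->
    u (p (rpath_start p)) \is a fin_num /\ u (p (rpath_end p)) \is a fin_num.
  move=> nc nE; have := ug0 p nc; rewrite /upper_gradient_along.
  have : path_integral p g0 != +oo by apply/eqP.
  by case: (u _) => [a| |]; case: (u _) => [b| |]//=; rewrite leye_eq => /negbTE ->.
have along p h : nonconstant p -> ~ Einf p ->
    upper_gradient_along u h p <-> upper_gradient_along (EFin \o (fine \o u)) h p.
  move=> nc nE; have [f1 f2] := fin p nc nE.
  by rewrite /upper_gradient_along /= -{1}(fineK f1) -{1}(fineK f2).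
have wug h : weak_upper_gradient mu u h <-> weak_upper_gradient mu (EFin \o (fine \o u)) h.
  split=> -[bh h0 [F F0 uh]]; split => //; exists (F `|` Einf);
    try exact: modulus1_setU; move=> p nc /not_orP[nF nE]; apply/(along p h nc nE); exact: uh.
split=> //; first by apply/wug; split => //; exists E.
by move=> h /wug; exact: gmin.
Qed.

End finite_representative.

(** On each ball of radius r around the lattice, the integral of |u| is at most an oscillation, to
    which Poincare applies directly, plus the absolute mean times the measure. Only the sum of the
    means needs the flow, and the growth of the flow is absorbed by the weight rho. *)
Lemma fundamental_class_zero_sobolev (R : realType) (X : pmetricType R)
    (mu : {outer_measure set X -> \bar R}) (rho : R -> R) :
  metric_measure_space mu -> quasiconvex X -> uniform_measure mu ->
  local_poincare mu -> control_function rho ->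
  (forall (Gamma : set X) (o : Gamma), quasi_lattice Gamma ->
     fundamental_class rho o = homology_zero rho o 0) ->
  sobolev11 mu rho.
Proof.
move=> mms [Q Q1 qc] unif [CP [RP [tau [CP0 RP0 tau1 poinc]]]] ctl vanish.
have [f [fg [fg0 _ fgmu]]] := unif.
have f0 s : 0 < s -> 0 < f s by move=> /fg0[].
have fmu x s : 0 < s -> ((f s)%:E <= mu (ball x s))%E by move=> /(fgmu x)/andP[].
have mball (x : X) s : measurable (ball x s : set (caratheodory_type mu)).
  exact: measurable_ball_cara.
(* Adjacent balls of radius r are compared inside a ball of radius 2 r, where Poincare must hold. *)
pose r := RP / 2; have r0 : 0 < r by rewrite divr_gt0.
have rRP : 2 * r <= RP by rewrite /r mulrC divfK.
have rleRP : r <= RP by rewrite /r ler_pdivrMr// ler_pMr// ler1n.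
have [G [qG _ cG]] := exists_quasi_lattice mms unif r0.
have [y0 Gy0 _] := cG point; pose o : G := SigSub (mem_set Gy0).
have [_ ulf] := qG; have [N GN] := ulf.
have [b chb b1] := (fundamental_class_zeroP rho o ulf).1 (vanish G o qG).
have [[K K0 bK] anti [P P0 bP]] := (is_chain1P rho o b).1 chb.
have tau0 : 0 < tau by exact: lt_le_trans tau1.
have tr0 : 0 < tau * r by rewrite mulr_gt0.
pose R2 := Q * P + tau * (2 * r).
have R20 : 0 < R2 by rewrite ltr_wpDl ?mulr_ge0 ?(le_trans ler01 Q1)// !mulr_gt0.
(* For an edge (z, y) of length at most P and a point x within R2 of y, both ends are at most R2 + P
   farther from o than x is. *)
have [L L0 HL] := control_shift ctl (ltr_wpDr P0 R20).
pose n : R := (Num.truncn (Q * P / r)).+1%:R; pose A := 4 * CP * r / f r.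
have n0 : 0 <= n by rewrite ler0n.
have A0 : 0 <= A by rewrite !mulr_ge0 ?invr_ge0 ?ltW// f0.
have P1 : 0 < P + 1 by rewrite ltr_wpDl.
pose k := K * L * (n * A).
have k0 : 0 <= k.
  by apply: mulr_ge0; apply: mulr_ge0 => //; exact: ltW.
pose k1 := CP * r * (N (tau * r))%:R.
have k10 : 0 <= k1 by rewrite !mulr_ge0// ltW.
pose k2 := fg r * ((N (P + 1))%:R * k * (N R2)%:R).
have fgr0 : 0 < fg r by case: (fg0 r r0).
have k20 : 0 <= k2.
  by apply: mulr_ge0; [exact: ltW|apply: mulr_ge0 => //; apply: mulr_ge0].
(* [k1] comes from the oscillations and [k2] from the means; adding 1 makes the constant
   positive. *)
exists (k1 + k2 + 1), (\val o); split; first by rewrite ltr_wpDl// addr_ge0.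
move=> u gm nu [x0 [R0 supp]] mingm.
(* The Poincare inequality is stated for real-valued functions, whereas u may take infinite
   values. *)
pose v := fine \o u.
have minv := minimal_weak_upper_gradient_fine mms nu mingm.
have [[bgm gm0 _] _ _] := mingm.
have mgm := borel_fun_measurable mms bgm.
have [iu _] := nu; have /integrableP[mu_ uoo] := iu.
have mv : measurable_fun (setT : set (caratheodory_type mu)) v by exact: measurableT_comp.
have mav : measurable_fun (setT : set (caratheodory_type mu)) (fun x => `|v x|%:E).
  by apply/measurable_EFinP; exact: measurableT_comp.
have vu x : (`|v x|%:E <= `|u x|)%E.
  by rewrite /v /=; case: (u x) => [a| |] /=; rewrite ?normr0 ?lexx ?leey.
have iv : integrable_on mu setT (EFin \o v).
  apply/integrableP; split; first exact/measurable_EFinP.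
  apply: le_lt_trans uoo; apply: ge0_le_integral => //.
    by apply: measurableT_comp => //; exact: mu_.
  by move=> x _; exact: vu.
have ivB x s : integrable_on mu (ball x s) (EFin \o v) by exact: integrable_on_ball.
have poinc' x s : 0 < s -> s <= RP ->
    (integral_on mu (ball x s) (fun y => `|v y - mean mu (ball x s) v|%:E)
    <= (CP * s)%:E * integral_on mu (ball x (tau * s)) gm)%E.
  move=> s0 sRP; have [/andP[_ tBoo] pxs] := poinc x s s0 sRP.
  apply: poincare_ball => //; first exact: ltW.
    by apply: lt_le_trans (fmu x s s0); rewrite lte_fin f0.
  exact: pxs.
pose dist_rho (x : X) := (rho (mdist (\val o) x))%:E.
have rho1 x : (1 <= dist_rho x)%E by rewrite lee_fin (control_ge1 ctl)// mdist_ge0.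
have rho0 x : (0 <= dist_rho x)%E by exact: le_trans (rho1 x).
have mrho : measurable_fun (setT : set (caratheodory_type mu)) dist_rho.
  apply: (borel_fun_measurable mms); apply: borel_fun_dist => s t.
  exact: control_le.
pose h x := (gm x * dist_rho x)%E.
have mh : measurable_fun (setT : set (caratheodory_type mu)) h by exact: emeasurable_funM.
have h0 x : (0 <= h x)%E by exact: mule_ge0.
have gh x : (gm x <= h x)%E by rewrite -[leLHS]mule1; apply: lee_wpmul2l.
rewrite -/(integral_on mu setT h); set J := integral_on mu setT h.
have J0 : (0 <= J)%E by exact: integral_ge0.
pose a (y : G) := `|mean mu (ball (\val y) r) v|.
(* A ball of radius r meeting the support has its centre within |R0| + r of x0, and the edges at
   that centre reach at most P farther. The absolute value keeps R1 positive. *)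
pose R1 := `|R0| + r + P + 1.
have R10 : 0 < R1 by rewrite ltr_wpDl// !addr_ge0// ltW.
have [F uF FP] := lattice_ball_seq ulf x0 R10.
have supp_v x : v x != 0 -> mdist x0 x < `|R0|.
  move=> vx; have : ball x0 R0 x.
    apply: supp; apply: subset_closure => /=; apply: contra_neq vx.
    by rewrite /v /= => ->.
  by rewrite ballEmdist /= => /lt_le_trans; apply; exact: ler_norm.
have a_nb (y z : G) : a y != 0 -> mdist (\val y) (\val z) <= P -> z \in F.
  move=> ay yz; have [x yx vx] : exists2 x, ball (\val y) r x & v x != 0.
    apply: contrapT => none; move: ay => /negP; apply; apply/eqP.
    rewrite /a /mean /emean /integral_on integral0_eq ?mule0 ?normr0//.
    move=> x yx /=; congr EFin; apply: contrapT => /eqP vx.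
    by apply: none; exists x.
  rewrite FP /R1; move: yx; rewrite ballEmdist /= => yx.
  have h1 := mdist_triangleR x0 x (\val z); have h2 := mdist_triangleR x (\val y) (\val z).
  rewrite (mdist_symR x (\val y)) in h2; have h3 := supp_v x vx.
  by move: yx yz h1 h2 h3; lra.
(* The sum over F sees the whole flow at y only if F contains all points within P of y. By [a_nb]
   this holds wherever [a y] is nonzero, and elsewhere the summand vanishes. *)
have half y : y \in F -> a y != 0 -> 2 * \sum_(z <- F) b (edge z y) = 1.
  move=> _ ay; have := b1 (fun=> y).
  by rewrite (boundary_seq anti bP uF (v := y))// => z; exact: a_nb.
have suma := flow_sum_le (c := fun z y => b (edge z y)) anti half.
pose Ih (y : G) := integral_on mu (ball (\val y) R2) h.
have Ih0 y : (0 <= Ih y)%E by exact: integral_ge0.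
(* Edges longer than P carry no flow. On the others the growth bound of b at the ends is at most K L
   times rho at any point of the ball around y, so it moves into the integral as the weight of [h].
   The bound P + 1 allows counting in open balls. *)
have term (y z : G) : ((`|b (edge z y)| * `|a y - a z|)%:E <=
    (if mdist (\val y) (\val z) < P + 1 then k else 0)%:E * Ih y)%E.
  have [zy|zy] := ltP P (mdist (\val z) (\val y)).
    by rewrite bP// normr0 mul0r mule_ge0// lee_fin; case: ifP.
  rewrite mdist_symR in zy; rewrite (le_lt_trans zy) ?ltrDl//.
  set Ig := integral_on mu (ball (\val y) R2) gm.
  have Ig0 : (0 <= Ig)%E by exact: integral_ge0.
  pose M := Num.max (mdist (\val z) (\val o)) (mdist (\val y) (\val o)).
  have M0 : 0 <= M by rewrite le_max mdist_ge0.
  have rM0 : 0 <= rho M by apply: (control_ge0 ctl); exact: M0.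
  have amean : ((`|a y - a z|)%:E <= n%:E * (A%:E * Ig))%E.
    apply: (@le_trans _ _ (`|mean mu (ball (\val y) r) v - mean mu (ball (\val z) r) v|%:E)).
      by rewrite lee_fin ler_dist_dist.
    exact: (mean_difference mms f0 fmu iv bgm gm0 r0 rRP CP0 poinc' Q1 P0 (qc _ _) zy).
  have rIg : ((rho M)%:E * Ig <= L%:E * Ih y)%E.
    have -> : ((rho M)%:E * Ig = integral_on mu (ball (\val y) R2) (fun x => (rho M)%:E * gm x))%E.
      by rewrite /integral_on ge0_integralZl_EFin//; exact: measurable_funTS.
    have -> : (L%:E * Ih y = integral_on mu (ball (\val y) R2) (fun x => L%:E * h x))%E.
      by rewrite /integral_on ge0_integralZl_EFin//; [exact: measurable_funTS|exact: ltW].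
    apply: ge0_le_integral => //.
    - by move=> x _; exact: mule_ge0.
    - by apply: measurable_funeM; exact: measurable_funTS.
    - by apply: measurable_funeM; exact: measurable_funTS.
    move=> x; rewrite ballEmdist /= => yx; rewrite /h muleCA muleC.
    apply: lee_wpmul2l => //; rewrite -EFinM lee_fin; apply: HL => //.
      exact: mdist_ge0.
    have h1 := mdist_triangleR (\val z) (\val y) (\val o).
    have h2 := mdist_triangleR (\val y) x (\val o).
    rewrite (mdist_symR x (\val o)) in h2; rewrite (mdist_symR (\val z) (\val y)) in h1.
    rewrite ge_max; apply/andP; split; first by move: zy yx h1 h2; lra.
    by move: yx h2 P0; lra.
  apply: (@le_trans _ _ ((K * rho M)%:E * (n%:E * (A%:E * Ig)))%E).
    rewrite EFinM; apply: lee_pmul; last exact: amean.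
    - by rewrite lee_fin.
    - by rewrite lee_fin.
    - by rewrite lee_fin; exact: bK.
  rewrite (_ : ((K * rho M)%:E * (n%:E * (A%:E * Ig)))%E =
      ((K * (n * A))%:E * ((rho M)%:E * Ig))%E); last first.
    by rewrite !muleA -!EFinM; congr (_%:E * _)%E; ring.
  rewrite (_ : (k%:E * Ih y)%E = ((K * (n * A))%:E * (L%:E * Ih y))%E); last first.
    by rewrite !muleA -!EFinM; congr (_%:E * _)%E; rewrite /k; ring.
  by apply: lee_wpmul2l => //; rewrite lee_fin; apply: mulr_ge0 => //; exact: mulr_ge0.
have suma_le : ((\sum_(y <- F) a y)%:E <= ((N (P + 1))%:R * k * (N R2)%:R)%:E * J)%E.
  apply: (@le_trans _ _ (\sum_(y <- F) \sum_(z <- F) (`|b (edge z y)| * `|a y - a z|)%:E)%E).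
    by under [leRHS]eq_bigr do rewrite sumEFin; rewrite sumEFin lee_fin.
  apply: (@le_trans _ _ (\sum_(y <- F) ((N (P + 1))%:R * k)%:E * Ih y)%E).
    apply: lee_sum => y _.
    apply: (@le_trans _ _ (\sum_(z <- F)
        (if mdist (\val y) (\val z) < P + 1 then k else 0)%:E * Ih y)%E).
      by apply: lee_sum => z _; exact: term.
    rewrite -ge0_sume_distrl; last by move=> z _; rewrite lee_fin; case: ifP.
    apply: lee_wpmul2r => //; rewrite sumEFin lee_fin -big_mkcond big_const_seq iter_addr_0.
    by rewrite -[leLHS]mulr_natl ler_wpM2r// ler_nat; exact: lattice_count.
  rewrite -ge0_sume_distrr; last by move=> y _; exact: Ih0.
  rewrite [in leRHS]EFinM -muleA; apply: lee_wpmul2l; first by rewrite lee_fin mulr_ge0.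
  apply: sum_integral_overlap => // x; rewrite (@eq_count _ _ (fun y : G => mdist x (\val y) < R2)).
    exact: lattice_count.
  by move=> y; apply/idP/idP; rewrite inE ballEmdist /= mdist_symR.
apply: (@le_trans _ _ (integral_on mu setT (fun x => `|v x|%:E))).
  apply: ae_ge0_le_integral => //; first by apply: measurableT_comp => //; exact: mu_.
  have [M [mM M0 MS]] := integrable_ae measurableT iu.
  exists M; split=> // x nx; apply: MS => /= H; apply: nx => _.
  by rewrite /v /= -{1}(fineK (H I)).
(* Lattice balls centred in F cover the set where v is nonzero. *)
apply: (@le_trans _ _ (\sum_(y <- F) integral_on mu (ball (\val y) r) (fun x => `|v x|%:E))%E).
  apply: integral_le_sum_cover => // x; rewrite eqe normr_eq0 => vx.
  have [y Gy xy] := cG x; exists (SigSub (mem_set Gy)); last by rewrite ballEmdist /= mdist_symR.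
  rewrite FP /R1 /=; have h1 := mdist_triangleR x0 x y; have h2 := supp_v x vx.
  by move: xy h1 h2 P0; lra.
apply: (@le_trans _ _ (\sum_(y <- F) ((CP * r)%:E * integral_on mu (ball (\val y) (tau * r)) gm +
    (fg r)%:E * (a y)%:E))%E).
  apply: lee_sum => y _.
  apply: le_trans (integral_abs_le_average (cara_measure mu) (mean mu (ball (\val y) r) v)
    (mball _ _) _) _; first exact: measurable_funTS.
  apply: leeD; first exact: poinc'.
  by apply: lee_wpmul2r; [rewrite lee_fin|have /andP[] := fgmu (\val y) r r0].
rewrite big_split/= -ge0_sume_distrr; last by move=> y _; exact: integral_ge0.
rewrite -ge0_sume_distrr; last by move=> y _; rewrite lee_fin; exact: normr_ge0.
rewrite sumEFin.
have J1 : (\sum_(y <- F) integral_on mu (ball (\val y) (tau * r)) gm <=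
    (N (tau * r))%:R%:E * J)%E.
  apply: (@le_trans _ _ (\sum_(y <- F) integral_on mu (ball (\val y) (tau * r)) h)%E).
    apply: lee_sum => y _; apply: ge0_le_integral => //; exact: measurable_funTS.
  apply: sum_integral_overlap => // x.
  rewrite (@eq_count _ _ (fun y : G => mdist x (\val y) < tau * r)).
    exact: lattice_count.
  by move=> y; apply/idP/idP; rewrite inE ballEmdist /= mdist_symR.
apply: (@le_trans _ _ (k1%:E * J + k2%:E * J)%E).
  apply: leeD.
    rewrite /k1 [X in (_ <= X * _)%E]EFinM -muleA; apply: lee_wpmul2l => //.
    by rewrite lee_fin mulr_ge0// ltW.
  rewrite /k2 [X in (_ <= X * _)%E]EFinM -muleA; apply: lee_wpmul2l => //.
  by rewrite lee_fin ltW.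
rewrite -ge0_muleDl ?lee_fin// -EFinD; apply: lee_wpmul2r => //.
by rewrite lee_fin lerDl.
Qed.

Theorem theoremA (R : realType) (X : pmetricType R)
  (mu : {outer_measure set X -> \bar R}) (rho : R -> R) :
  metric_measure_space mu -> quasiconvex X -> uniform_measure mu ->
  local_poincare mu -> control_function rho ->
  (sobolev11 mu rho <->
   forall (Gamma : set X) (o : Gamma), quasi_lattice Gamma ->
     fundamental_class rho o = homology_zero rho o 0).
Proof.
move=> mms qc unif poinc ctl; split=> [sob Gamma o qG|].
  exact: sobolev_fundamental_class_zero sob qG.
exact: fundamental_class_zero_sobolev.
Qed.
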